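(* Let $\Gamma$ be a group and $f:\Gamma\to\mathcal{G}$ a group morphism such that $\eta=\upsilon\circ f$ and $\delta={\rm d}\circ f$ are distinct and of order $2$, and set $r=\rho\circ f:\Gamma\to{\rm Spin}(7)$. Then $r$ and $\eta r$ are element conjugate in ${\rm Spin}(7)$ (i.e. the pair $(r,\eta)$ satisfies (U1)). The pair $(r,\eta)$ is acceptable (i.e. $r$ and $\eta r$ are ${\rm Spin}(7)$-conjugate) if, and only if, up to conjugating $f$ with some element of $M$, the image of $f(\Gamma)$ in $\underline{\mathcal{G}}$ is included in one of the two subgroups $H_1$ and $H_2$ of $\underline{\mathcal{G}}$.
   Context: For $r:\Gamma\to{\rm Spin}(7)$ and $\eta:\Gamma\to\{\pm1\}$, the pair $(r,\eta)$ satisfies (U1) if $r(\gamma)$ and $\eta(\gamma)r(\gamma)$ are conjugate in ${\rm Spin}(7)$ for all $\gamma\in\Gamma$; it satisfies (U2) if $r$ and $\eta r$ are not ${\rm Spin}(7)$-conjugate. It is unacceptable if it satisfies both, and acceptable otherwise. The group $N$. Let $\pi:{\rm Spin}(7)\to{\rm SO}(7)$ be the canonical double cover (compact groups). Fix an orthogonal decomposition $\mathbb{R}^7=L\perp F$ with $L$ a line, and let $N\subset{\rm Spin}(7)$ be the inverse image under $\pi$ of the stabilizer of $L$ in ${\rm SO}(7)$; it acts on $F$ through a surjection $N\to{\rm O}(F)$ of kernel $\{\pm1\}$. The identity component $N^0$ of $N$ (the subgroup acting with determinant $1$ on $F$) is isomorphic to ${\rm Spin}(6)$ and is identified with ${\rm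 SU}(4)$ via a fixed unitary half-spin representation. The group $\mathcal{G}$. Equip $\mathbb{C}^2$ with the quadratic form $q(x,y)=x^2+y^2$. Let ${\rm GO}_2(\mathbb{C})$ be its group of similitudes, $\mu$ the similitude factor ($q(gv)=\mu(g)q(v)$), and $\epsilon:{\rm GO}_2(\mathbb{C})\to\{\pm1\}$ the signature of the permutation action on the two isotropic lines of $q$. Let ${\rm O}(2)^{\pm}$ be the subgroup of elements $g$ with $\mu(g)=\pm1$ in the maximal compact subgroup ${\rm GO}(2)$ of ${\rm GO}_2(\mathbb{C})$; it is generated by the real orthogonal group ${\rm O}(2)$ and $i\cdot 1_2$. Let $\mathcal{G}$ be the group of $(g_1,g_2)\in{\rm O}(2)^{\pm}\times{\rm O}(2)^{\pm}$ with $\det g_1=\det g_2$ and $\mu(g_2)=\epsilon(g_1)$. Let $\rho:\mathcal{G}\to{\rm SU}(4)=N^0\subset{\rm Spin}(7)$ be the block-diagonal embedding $(g_1,g_2)\mapsto{\rm diag}(g_1,g_2)$; we view $\mathcal{G}$ as a subgroup of $N$ via $\rho$. Define $\upsilon,{\rm d}:\mathcal{G}\to\{\pm1\}$ by $\upsilon(g_1,g_2)=\epsilon(g_1)=\mu(g_2)$ and ${\rm d}(g_1,g_2)=\det g_1=\det g_2$. The decomposition of $F$. There is an orthogonal decomposition $F=F_1\perp F_2\perp F_3$ into planes (unique up to exchanging $F_1$ and $F_2$) such that the torus ${\rm SO}(2)\times{\rm SO}(2)\subset\mathcal{G}$ acts trivially on $F_3$ and surjects onto ${\rm SO}(F_1)\times{\rm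 SO}(F_2)$. The group $\mathcal{G}$ is then the subgroup of all elements $g\in N$ with determinant $1$ on $F$, preserving the pair $\{F_1,F_2\}$ (hence $F_3$), and acting on $F_3$ as a homothety whose sign coincides with the signature of $g$ on the two-element set $\{F_1,F_2\}$. This signature is ${\rm d}(g)$, and if ${\rm d}(g)=1$ then $\upsilon(g)=\det_{F_1}(g)=\det_{F_2}(g)$. Choosing isometries $F_1\simeq\mathbb{R}^2$ and $F_2\simeq\mathbb{R}^2$, identify $F_1\perp F_2$ with $\mathbb{R}^2\perp\mathbb{R}^2=\mathbb{R}^4$, and $\mathcal{G}/\{\pm1\}$ with the subgroup $\underline{\mathcal{G}}$ of ${\rm SO}(4)$ preserving this sum (i.e. the pair of its two summands). Let $M\subset N$ be the subgroup preserving each of $F_1$ and $F_2$ (hence $F_3$) and acting trivially on $F_3$; $M/\{\pm1\}\simeq{\rm O}(2)\times{\rm O}(2)$ and $M$ normalizes $\mathcal{G}$, so elements of $M$ act by conjugation on morphisms $f:\Gamma\to\mathcal{G}$. Using $2\times 2$ blocks, put $\theta=\begin{pmatrix}0&1_2\\1_2&0\end{pmatrix}$ and $s=\begin{pmatrix}0&1\\1&0\end{pmatrix}$. Let $\Delta=\{{\rm diag}(g,g)\,:\,g\in{\rm O}(2)\}\subset{\rm O}(2)\times{\rm O}(2)$, and let $D\simeq\{\pm1\}^4$ be the subgroup of diagonal matrices in ${\rm O}(4)$. Then $H_1$ is the subgroup of $\underline{\mathcal{G}}\subset{\rm SO}(4)$ generated by $D\cap\Delta$ and ${\rm diag}(s,-s)\,\theta$,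 and $H_2$ is the subgroup generated by $\Delta$ and $\theta$. *)

(* Defs.v *)
From HB Require Import structures.
From mathcomp Require Import all_boot all_order all_algebra.
From mathcomp Require Import spectral complex ring.
From mathcomp Require Import boolp classical_sets reals.

Set Implicit Arguments.
Unset Strict Implicit.
Unset Printing Implicit Defensive.

Import Order.TTheory GRing.Theory Num.Theory.

Local Open Scope ring_scope.
Local Open Scope classical_set_scope.
Local Open Scope complex_scope.

(* The Clifford algebra of the standard Euclidean space R^n, normalised by    *)
(* v ^+ 2 = |v|^2.  The element x is \sum_A x A *: e_A, where for             *)
(* A = {i_1 < ... < i_k} e_A is the product e_{i_1} ... e_{i_k}; hence        *)
(* e_A * e_B = (-1) ^ #{(i, j) in A x B | j < i} *: e_(A symd B).             *)
Section CliffordAlgebra.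
Variables (R : comNzRingType) (n : nat).

Definition clifford : Type := {ffun {set 'I_n} -> R^o}.

HB.instance Definition _ := GRing.Lmodule.on clifford.

Definition symd (A B : {set 'I_n}) : {set 'I_n} :=
  ((A :\: B) :|: (B :\: A))%SET.

Definition ninv (A B : {set 'I_n}) : nat :=
  (\sum_(i in A) \sum_(j in B) (j < i))%N.

Definition cl_sign (A B : {set 'I_n}) : R := (-1) ^+ ninv A B.

Definition cl_one : clifford := [ffun A => (A == finset.set0)%:R].

Definition cl_mul (x y : clifford) : clifford :=
  [ffun C => \sum_A cl_sign A (symd A C) * x A * y (symd A C)].

Lemma in_symd i A B : (i \in symd A B) = (i \in A) (+) (i \in B).
Proof. by rewrite !inE; case: (i \in A); case: (i \in B). Qed.

Lemma symdA A B C : symd A (symd B C) = symd (symd A B) C.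
Proof. by apply/setP => i; rewrite !in_symd addbA. Qed.

Lemma symdC A B : symd A B = symd B A.
Proof. by apply/setP => i; rewrite !in_symd addbC. Qed.

Lemma symdK A : cancel (symd A) (symd A).
Proof. by move=> B; apply/setP => i; rewrite !in_symd addbA addbb. Qed.

Lemma sym0d A : symd finset.set0 A = A.
Proof. by apply/setP => i; rewrite in_symd !inE. Qed.

Lemma symdd A : symd A A = finset.set0.
Proof. by apply/setP => i; rewrite in_symd addbb inE. Qed.

Lemma odd_sum_symd (F : 'I_n -> nat) A B :
  odd (\sum_(i in symd A B) F i)
  = odd (\sum_(i in A) F i) (+) odd (\sum_(i in B) F i).
Proof.
rewrite -oddD big_mkcond [X in (X + _)%N]big_mkcond.
rewrite [X in (_ + X)%N]big_mkcond -big_split /=.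
elim/big_rec2: _ => // i a b _; rewrite !oddD => ->; congr (_ (+) _).
by rewrite in_symd; case: (i \in A); case: (i \in B); rewrite //= ?addbF ?addbb.
Qed.

Lemma cl_sign_symdl A B C : cl_sign (symd A B) C = cl_sign A C * cl_sign B C.
Proof.
by rewrite /cl_sign -signr_odd /ninv odd_sum_symd signr_addb !signr_odd.
Qed.

Lemma cl_sign_symdr A B C : cl_sign A (symd B C) = cl_sign A B * cl_sign A C.
Proof.
have E X Y : ninv X Y = (\sum_(j in Y) \sum_(i in X) (j < i))%N.
  by rewrite /ninv exchange_big.
by rewrite /cl_sign -signr_odd !E odd_sum_symd signr_addb !signr_odd.
Qed.

Lemma cl_sign0l A : cl_sign finset.set0 A = 1.
Proof. by rewrite /cl_sign /ninv big_set0. Qed.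

Lemma cl_sign0r A : cl_sign A finset.set0 = 1.
Proof.
by rewrite /cl_sign /ninv big1 // => i _; rewrite big_set0.
Qed.

Lemma cl_mulA : associative cl_mul.
Proof.
move=> x y z; apply/ffunP => C; rewrite !ffunE.
under [RHS]eq_bigr => A _ do rewrite ffunE mulr_sumr mulr_suml.
rewrite [RHS]exchange_big; apply: eq_bigr => B _ /=.
rewrite ffunE mulr_sumr (reindex_inj (can_inj (symdK B))).
apply: eq_bigr => A _ /=.
have -> : symd (symd B A) (symd B C) = symd A C.
  by rewrite (symdC B A) -symdA symdK.
rewrite cl_sign_symdl.
have -> : symd B C = symd (symd B A) (symd A C) by rewrite -symdA symdK.
have aux (s t u a b c : R) : t * t = 1 ->
    s * t * a * (t * u * b * c) = u * (s * a * b) * c.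
  by move=> tt; rewrite -[RHS]mul1r -tt; ring.
by rewrite cl_sign_symdr; apply: aux; rewrite /cl_sign -expr2 sqrr_sign.
Qed.

Lemma cl_mul1l : left_id cl_one cl_mul.
Proof.
move=> x; apply/ffunP => C; rewrite ffunE (bigD1 finset.set0) //= big1.
  by rewrite ffunE eqxx sym0d cl_sign0l !mul1r addr0.
by move=> A /negPf nA; rewrite ffunE nA mulr0 mul0r.
Qed.

Lemma cl_mul1r : right_id cl_one cl_mul.
Proof.
move=> x; apply/ffunP => C; rewrite ffunE (bigD1 C) //= big1.
  by rewrite ffunE symdd eqxx cl_sign0r mul1r mulr1 addr0.
move=> A nAC; rewrite ffunE; case: eqP => [E|_]; last by rewrite mulr0.
by case/eqP: nAC; rewrite -(symdK A C) E symdC sym0d.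
Qed.

Lemma cl_mulDl : left_distributive cl_mul +%R.
Proof.
move=> x y z; apply/ffunP => C; rewrite !ffunE -big_split.
by apply: eq_bigr => A _; rewrite ffunE mulrDr mulrDl.
Qed.

Lemma cl_mulDr : right_distributive cl_mul +%R.
Proof.
move=> x y z; apply/ffunP => C; rewrite !ffunE -big_split.
by apply: eq_bigr => A _; rewrite ffunE mulrDr.
Qed.

Lemma cl_oner_neq0 : cl_one != 0.
Proof.
by apply/eqP => /ffunP /(_ finset.set0); rewrite !ffunE eqxx => /eqP;
  rewrite oner_eq0.
Qed.

HB.instance Definition _ := GRing.Zmodule_isNzRing.Build clifford
  cl_mulA cl_mul1l cl_mul1r cl_mulDl cl_mulDr cl_oner_neq0.

Lemma cl_scalerAl (a : R) (x y : clifford) : a *: (x * y) = (a *: x) * y.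
Proof.
apply/ffunP => C; rewrite !ffunE scaler_sumr; apply: eq_bigr => A _.
by rewrite ffunE /GRing.scale /= !mulrA [a * _]mulrC.
Qed.

HB.instance Definition _ :=
  GRing.Lmodule_isLalgebra.Build R clifford cl_scalerAl.

Lemma cl_scalerAr (a : R) (x y : clifford) : a *: (x * y) = x * (a *: y).
Proof.
apply/ffunP => C; rewrite !ffunE scaler_sumr; apply: eq_bigr => A _.
by rewrite ffunE /GRing.scale /= mulrCA.
Qed.

HB.instance Definition _ :=
  GRing.Lalgebra_isAlgebra.Build R clifford cl_scalerAr.

Definition cl_unit : pred clifford :=
  fun x => `[< exists y, y * x = 1 /\ x * y = 1 >].

Definition cl_inv (x : clifford) : clifford :=
  xget x [set y | y * x = 1 /\ x * y = 1].

Lemma cl_invP x : cl_unit x -> cl_inv x * x = 1 /\ x * cl_inv x = 1.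
Proof.
by move=> /asboolP [y xy]; rewrite /cl_inv; case: xgetP => [z -> //|/(_ y)].
Qed.

Lemma cl_mulVr : {in cl_unit, left_inverse 1 cl_inv *%R}.
Proof. by move=> x /cl_invP []. Qed.

Lemma cl_divrr : {in cl_unit, right_inverse 1 cl_inv *%R}.
Proof. by move=> x /cl_invP []. Qed.

Lemma cl_unitrP x y : y * x = 1 /\ x * y = 1 -> cl_unit x.
Proof. by move=> xy; apply/asboolP; exists y. Qed.

Lemma cl_invr_out : {in [predC cl_unit], cl_inv =1 id}.
Proof.
move=> x /asboolPn nx; rewrite /cl_inv; case: xgetP => // y _ xy.
by case: nx; exists y.
Qed.

HB.instance Definition _ := GRing.NzRing_hasMulInverse.Build clifford
  cl_mulVr cl_divrr cl_unitrP cl_invr_out.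

End CliffordAlgebra.


Section SpinGroup.
Variables (R : realType) (n : nat).

Definition cl_vec (v : 'cV[R]_n) : clifford R n :=
  [ffun A => \sum_(i | A == [set i]%SET) v i 0].

Definition spin : set (clifford R n) :=
  [set x | exists s : seq 'cV[R]_n,
    [/\ ~~ odd (size s), forall v, v \in s -> v^T *m v = 1%:M
       & x = \prod_(v <- s) cl_vec v]].

(* The matrix, acting on column vectors, of v |-> x v x^-1; its restriction   *)
(* to spin is the double cover Spin(n) -> SO(n).                              *)
Definition spin_pi (x : clifford R n) : 'M[R]_n :=
  \matrix_(i, k) (x * cl_vec (delta_mx k 0) * x^-1) [set i]%SET.

End SpinGroup.

Section Acceptability.
Variables (R : realType) (n : nat) (Gamma : groupType).
Variables (r : Gamma -> clifford R n) (eta : Gamma -> R).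

Definition satisfies_U1 : Prop :=
  forall gamma, exists2 x, spin x
    & eta gamma *: r gamma = x * r gamma * x^-1.

Definition satisfies_U2 : Prop :=
  ~ exists2 x, spin x
    & forall gamma, eta gamma *: r gamma = x * r gamma * x^-1.

Definition unacceptable : Prop := satisfies_U1 /\ satisfies_U2.

Definition acceptable : Prop := ~ unacceptable.

End Acceptability.

(* Nontrivial element of order 2 in the group of maps Gamma -> {1, -1}.       *)
Definition of_order2 (R : realType) (Gamma : Type) (eta : Gamma -> R) : Prop :=
  (forall gamma, eta gamma ^+ 2 = 1) /\ eta <> (fun=> 1).

Definition orthogonal_group (R : realType) (n : nat) : set 'M[R]_n :=
  [set A | A^T *m A = 1%:M].

Definition special_orthogonal_group (R : realType) (n : nat) : set 'M[R]_n :=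
  [set A | A^T *m A = 1%:M /\ \det A = 1].

Section GroupG.
Variable R : realType.
Local Notation C := R[i].

Definition qform (v : 'cV[C]_2) : C := v 0 0 ^+ 2 + v 1 0 ^+ 2.

(* When q (g v) = m * q v for all v, this is m, since q (1, 0) = 1.           *)
Definition simil (g : 'M[C]_2) : C := qform (g *m delta_mx 0 0).

Definition GO2C : set 'M[C]_2 :=
  [set g | g \in unitmx /\ forall v, qform (g *m v) = simil g * qform v].

(* A permutation of the two isotropic lines has signature 1 iff it fixes both *)
(* of them.                                                                   *)
Definition eps (g : 'M[C]_2) : R :=
  if `[< forall v, qform v = 0 -> exists c, g *m v = c *: v >] then 1 else -1.

(* The maximal compact subgroup GO(2) of GO_2(C) is its unitary part.         *)
Definition O2pm : set 'M[C]_2 :=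
  [set g | [/\ GO2C g, g \is unitarymx & simil g = 1 \/ simil g = -1]].

Definition calG : set ('M[C]_2 * 'M[C]_2) :=
  [set g | [/\ O2pm g.1, O2pm g.2, \det g.1 = \det g.2
              & simil g.2 = (eps g.1)%:C]].

Definition upsilon (g : 'M[C]_2 * 'M[C]_2) : R := eps g.1.

(* On calG the complex number \det g.1 is 1 or -1.                            *)
Definition dchar (g : 'M[C]_2 * 'M[C]_2) : R := complex.Re (\det g.1).

Definition torusG (a b : 'M[R]_2) : 'M[C]_2 * 'M[C]_2 :=
  (map_mx (real_complex R) a, map_mx (real_complex R) b).

End GroupG.

(* A decomposition R^7 = L _|_ F_1 _|_ F_2 _|_ F_3 is given by orthonormal    *)
(* bases: a unit vector l of L and the columns of u1, u2, u3; u1 and u2 are   *)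
(* also the chosen isometries R^2 -> F_1 and R^2 -> F_2, and F is the         *)
(* orthogonal complement of l, with basis row_mx u1 (row_mx u2 u3).           *)
Section Embedding.
Variable R : realType.
Local Notation C := R[i].
Local Notation Cl7 := (clifford R 7).
Implicit Types (l : 'cV[R]_7) (u : 'M[R]_(7, 2)).

Definition orthogonal_decomposition l u1 u2 u3 : Prop :=
  let P := row_mx l (row_mx u1 (row_mx u2 u3)) in P^T *m P = 1%:M.

Definition basisF u1 u2 u3 : 'M[R]_(7, 2 + (2 + 2)) :=
  row_mx u1 (row_mx u2 u3).

Definition groupN l : set Cl7 :=
  [set x | spin x /\ exists c, spin_pi x *m l = c *: l].

Definition detF (uF : 'M[R]_(7, 2 + (2 + 2))) (x : Cl7) : R :=
  \det (uF^T *m spin_pi x *m uF).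

Definition groupN0 l uF : set Cl7 := [set x | groupN l x /\ detF uF x = 1].

(* The even Clifford algebra of F.                                            *)
Inductive even_clifford l : Cl7 -> Prop :=
| even_one : even_clifford l 1
| even_vec2 v w : l^T *m v = 0 -> l^T *m w = 0 ->
    even_clifford l (cl_vec v * cl_vec w)
| even_mul x y : even_clifford l x -> even_clifford l y ->
    even_clifford l (x * y)
| even_lin (a : R) x y : even_clifford l x -> even_clifford l y ->
    even_clifford l (a *: x + y).

(* Half-spin representations of Spin(6) are the 4-dimensional complex         *)
(* representations of the even Clifford algebra of F (whose complexification  *)
(* is M_4(C) x M_4(C)), restricted to the Spin group.                         *)
Definition half_spin l (sigma : Cl7 -> 'M[C]_(2 + 2)) : Prop :=
  [/\ sigma 1 = 1%:M,
      forall x y, even_clifford l x -> even_clifford l y ->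
        sigma (x * y) = sigma x *m sigma y
    & forall (a : R) x y, even_clifford l x -> even_clifford l y ->
        sigma (a *: x + y) = a%:C *: sigma x + sigma y].

Definition unitary_half_spin l uF (sigma : Cl7 -> 'M[C]_(2 + 2)) : Prop :=
  half_spin l sigma /\ forall x, groupN0 l uF x -> sigma x \is unitarymx.

(* rho is the embedding of calG in Spin(7) obtained from (g1, g2) |->         *)
(* diag(g1, g2) and the identification of N^0 with SU(4) by sigma.            *)
Definition block_embedding l uF (sigma : Cl7 -> 'M[C]_(2 + 2))
    (rho : 'M[C]_2 * 'M[C]_2 -> Cl7) : Prop :=
  forall g, calG g ->
    groupN0 l uF (rho g) /\ sigma (rho g) = block_mx g.1 0 0 g.2.

(* The torus SO(2) x SO(2) of calG acts trivially on F_3, and its action on   *)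
(* F_1 _|_ F_2 is by SO(F_1) x SO(F_2), onto which it surjects.               *)
Definition torus_adapted (rho : 'M[C]_2 * 'M[C]_2 -> Cl7) u1 u2 u3 : Prop :=
  let SO2 := @special_orthogonal_group R 2 in
  (forall a b, SO2 a -> SO2 b -> let A := spin_pi (rho (torusG a b)) in
     A *m u3 = u3 /\
     exists a' b', [/\ SO2 a', SO2 b', A *m u1 = u1 *m a' & A *m u2 = u2 *m b'])
  /\
  (forall a' b', SO2 a' -> SO2 b' ->
     exists a b, [/\ SO2 a, SO2 b,
       spin_pi (rho (torusG a b)) *m u1 = u1 *m a'
     & spin_pi (rho (torusG a b)) *m u2 = u2 *m b']).

Definition groupM l u1 u2 u3 : set Cl7 :=
  [set x | [/\ groupN l x, exists a, spin_pi x *m u1 = u1 *m a,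
              exists b, spin_pi x *m u2 = u2 *m b & spin_pi x *m u3 = u3]].

(* The matrix of the action of x on F_1 _|_ F_2 = R^2 _|_ R^2 = R^4.          *)
Definition restr12 u1 u2 (x : Cl7) : 'M[R]_(2 + 2) :=
  (row_mx u1 u2)^T *m spin_pi x *m row_mx u1 u2.

End Embedding.

Inductive generated (R : realType) (n : nat) (S : set 'M[R]_n) :
    'M[R]_n -> Prop :=
| gen_one : generated S 1%:M
| gen_mem A of S A : generated S A
| gen_mul A B of generated S A & generated S B : generated S (A *m B)
| gen_inv A of generated S A : generated S (invmx A).

Section SubgroupsH.
Variable R : realType.

Definition theta : 'M[R]_(2 + 2) := block_mx 0 1%:M 1%:M 0.

Definition swap2 : 'M[R]_2 := \matrix_(i, j) (i != j)%:R.

Definition Delta : set 'M[R]_(2 + 2) :=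
  [set block_mx g 0 0 g | g in @orthogonal_group R 2].

Definition diagO4 : set 'M[R]_(2 + 2) :=
  [set A | @orthogonal_group R (2 + 2) A /\ is_diag_mx A].

Definition H1 : set 'M[R]_(2 + 2) :=
  generated ((diagO4 `&` Delta)
             `|` [set block_mx swap2 0 0 (- swap2) *m theta]).

Definition H2 : set 'M[R]_(2 + 2) := generated (Delta `|` [set theta]).

End SubgroupsH.

(* Main.v *)
From HB Require Import structures.
Require Import Defs.
From mathcomp Require Import all_boot all_order all_algebra.
From mathcomp Require Import spectral complex ring lra.
From mathcomp Require Import boolp classical_sets reals.

Set Implicit Arguments.
Unset Strict Implicit.
Unset Printing Implicit Defensive.

Import Order.TTheory GRing.Theory Num.Theory.

Local Open Scope ring_scope.

(** Write V = F_1 + F_2, e_1, ..., e_6 for the given basis of F, J_1 = e_1 e_2,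
    J_2 = e_3 e_4, J_3 = e_5 e_6 and omega = J_1 J_2 J_3.  The proof first reads
    off from the half-spin representation sigma how an element of calG acts on
    R^7 = L + V + F_3, and then argues with orthogonal matrices of V which
    preserve the pair {F_1, F_2}.

    The action.  omega is central in the even Clifford algebra of F and
    omega^2 = -1.  Averaging y over conjugation by the elements e_i e_(i+1)
    brings it into the centre without changing its trace, which gives
    tr (sigma y) = 4 s(y) - s(omega y) tr (sigma omega), where s is the scalar
    coefficient ([trace_formula]).  As tr (sigma omega) is imaginary and the
    elements of Spin have norm 1, sigma is injective on them
    ([spinE_sigma_inj]).  Hence rho is multiplicative ([rhoM]), and identities in
    Spin can be checked on matrices.  The surjectivity of the torus on
    SO(F_1) x SO(F_2) determines sigma J_1 and sigma J_2 up to signs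
    ([sigma_Js]).  So an element g of calG commutes with J_3, and it multiplies
    J_1 and J_2 by upsilon g when d(g) = 1 and exchanges them up to a common sign
    when d(g) = -1.  A bivector determines its oriented plane
    ([bivector_plane]), which gives the action on F_1 and F_2 ([rho_F12_even],
    [rho_F12_odd]).  Comparing tr (sigma y) with tr (sigma (e_5 y e_5)), which is
    its conjugate, shows that g acts on F_3 by d(g) ([rho_u3]).

    Element conjugacy.  If upsilon g = -1, then g has an eigenvalue -1 on F and
    fixes l; for a unit vector p in F with g p = - p, the element p l of Spin
    conjugates g to -g ([conj_opp]).

    Necessity.  Let x conjugate r to eta r, and X be its image in SO(7), which
    commutes with the images of all r(gamma).  When delta(gamma) = 1 and
    eta(gamma) = -1, the element r(gamma) is a reflection on each of F_1
    and F_2, so it is a multiple of p s, where p in F_1 and s in F_2 are unit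
    eigenvectors for -1.  Thus x anticommutes with p s, and X acts on the plane of
    p and s as a reflection.  The symmetrised compression Y of X to V therefore
    commutes with the group and is a reflection on each of these planes
    ([mirror_of_conj]).  A computation with blocks of size 2 then finds an element
    of O(F_1) x O(F_2) which conjugates the group into H_1 or H_2
    ([imprimitive_mirror_conj]), and such elements lift to M ([liftsM_exists]).

    Sufficiency.  For a subgroup of H_1 or of H_2, V is the sum of two stable
    planes W and W' on which the determinants are the same character chi
    ([H1_planes], [H2_planes]).  It agrees with eta on the kernel of delta, so
    that eta is chi or chi delta.  Conjugation multiplies the bivector of W by
    chi, and the product of the bivector of W' with e_5 l by chi delta; hence one
    of these two elements of Spin conjugates r to eta r ([conj_of_planes]). *)

(** * Clifford algebras and spin groups *)

Section Clifford.
Variables (R : realType) (n : nat).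
Local Notation Cl := (clifford R n).
Implicit Types (x y z : Cl) (v w : 'cV[R]_n).

Lemma cl_vec_is_linear : linear (@cl_vec R n).
Proof.
move=> a v w; apply/ffunP => A; rewrite !ffunE.
rewrite scaler_sumr -big_split /=.
by apply: eq_bigr => i _; rewrite !mxE.
Qed.

HB.instance Definition _ :=
  GRing.isLinear.Build R 'cV[R]_n Cl *:%R (@cl_vec R n) cl_vec_is_linear.

Definition cl_gen i : Cl := cl_vec (delta_mx i 0).

Lemma cl_genE i A : cl_gen i A = (A == [set i]%SET)%:R.
Proof.
rewrite ffunE; case: eqP => [->|nA].
  rewrite (bigD1 i) //= mxE !eqxx big1 ?addr0 // => j /andP[_ /negPf nj].
  by rewrite mxE nj.
rewrite big1 // => j /eqP AE; rewrite mxE; case: eqP => // ji.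
by case: nA; rewrite AE ji.
Qed.

Lemma cl_vecE v : cl_vec v = \sum_i v i 0 *: cl_gen i.
Proof.
rewrite -[in LHS](mulmx1 v) [in LHS](matrix_sum_delta v) mulmx1.
rewrite linear_sum; apply: eq_bigr => i _.
by rewrite big_ord1 linearZ.
Qed.

Lemma symdKr (A B : {set 'I_n}) : symd (symd A B) B = A.
Proof. by rewrite -symdA symdd symdC sym0d. Qed.

Lemma cl_mulE x y C : (x * y) C = \sum_A cl_sign R A (symd A C) * x A * y (symd A C).
Proof. by rewrite [LHS]ffunE. Qed.

(** Multiplying by a basis vector permutes the basis e_A up to signs, so that
    a product with it is known coefficient by coefficient; the coefficient is
    indexed by its source to avoid a sum. *)
Lemma cl_gen_mul i x A :
  (cl_gen i * x) (symd [set i]%SET A) = cl_sign R [set i]%SET A * x A.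
Proof.
rewrite cl_mulE (bigD1 [set i]%SET) //= big1 ?addr0.
  by rewrite symdK cl_genE eqxx mulr1.
by move=> B /negPf nB; rewrite cl_genE nB mulr0 mul0r.
Qed.

Lemma cl_mul_gen i x A :
  (x * cl_gen i) (symd [set i]%SET A) = cl_sign R A [set i]%SET * x A.
Proof.
rewrite cl_mulE (bigD1 A) //= big1 ?addr0.
  by rewrite (symdC [set i]%SET A) symdK cl_genE eqxx mulr1.
move=> B /negPf nB; rewrite cl_genE; case: eqP => [E|_]; last by rewrite mulr0.
move/eqP: nB; case; rewrite -(symdKr B (symd [set i]%SET A)) E.
by rewrite symdK.
Qed.

(** Moving e_i through e_A costs one sign for each index of A other than i,
    which is the parity of |A| + [i in A]. *)
Lemma cl_signC i (A : {set 'I_n}) :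
  cl_sign R A [set i]%SET * cl_sign R [set i]%SET A
  = (-1) ^+ (#|A| + (i \in A)).
Proof.
rewrite /cl_sign -exprD /ninv big_set1 -[LHS]signr_odd -[RHS]signr_odd.
congr (_ ^+ nat_of_bool _).
rewrite (eq_bigr (fun j : 'I_n => nat_of_bool (i < j)%N)); last first.
  by move=> j _; rewrite big_set1.
rewrite -big_split /= -sum1_card.
have -> : (nat_of_bool (i \in A) = \sum_(j in A) (j == i))%N.
  case: (boolP (i \in A)) => iA.
    by rewrite (bigD1 i) //= eqxx big1 // => j /andP[_ /negPf ->].
  by rewrite big1 // => j jA; case: eqP jA iA => // -> ->.
rewrite -big_split /=.
elim/big_rec2: _ => // j a b _; rewrite !oddD => ->; congr (_ (+) _).
by rewrite -(inj_eq val_inj) /=; case: ltngtP.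
Qed.

Lemma cl_sign_sqr (A B : {set 'I_n}) : cl_sign R A B * cl_sign R A B = 1 :> R.
Proof. by rewrite -expr2 sqrr_sign. Qed.

Lemma cl_gen_sqr (i : 'I_n) : cl_gen i * cl_gen i = 1.
Proof.
apply/ffunP => A; rewrite -(symdK [set i]%SET A) cl_gen_mul cl_genE.
rewrite ffunE; set B := symd _ A.
have -> : (symd [set i]%SET B == finset.set0) = (B == [set i]%SET).
  apply/eqP/eqP => [E|->]; last by rewrite symdd.
  by rewrite -(symdK [set i]%SET B) E symdC sym0d.
case: eqP => [->|_]; last by rewrite mulr0.
have := cl_signC i [set i]%SET; rewrite cards1 inE eqxx -expr2 /= => _.
by rewrite /cl_sign /ninv !big_set1 ltnn mul1r.
Qed.

Lemma cl_gen_anticomm (i j : 'I_n) : i != j -> cl_gen i * cl_gen j = - (cl_gen j * cl_gen i).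
Proof.
move=> ij; apply/ffunP => A; rewrite [RHS]ffunE -(symdK [set i]%SET A).
rewrite cl_gen_mul cl_mul_gen cl_genE; set B := symd _ A.
have [->|_] := eqVneq B [set j]%SET; last by rewrite !mulr0 oppr0.
have := cl_signC i [set j]%SET; rewrite cards1 inE (negPf ij) addn0 expr1.
move=> E; rewrite !mulr1.
rewrite -[LHS]mul1r -(cl_sign_sqr [set j]%SET [set i]%SET) -mulrA E; ring.
Qed.

Lemma cl_vec_anticomm v w :
  cl_vec v * cl_vec w + cl_vec w * cl_vec v = (2 * (v^T *m w) 0 0)%:A.
Proof.
rewrite !cl_vecE !mulr_suml.
under eq_bigr do rewrite mulr_sumr.
under [X in _ + X]eq_bigr do rewrite mulr_sumr.
rewrite [X in _ + X]exchange_big -big_split /=.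
under eq_bigr do rewrite -big_split /=.
rewrite mxE mulr_sumr scaler_suml; apply: eq_bigr => i _.
rewrite (bigD1 i) //= big1 ?addr0 => [|j ji].
  rewrite -!scalerAl -!scalerAr cl_gen_sqr !scalerA -scalerDl !mxE.
  by congr (_ *: _); ring.
rewrite -!scalerAl -!scalerAr !scalerA.
by rewrite cl_gen_anticomm 1?eq_sym // scalerN (mulrC (w j 0)) addNr.
Qed.

Lemma cl_vec_sqr v : cl_vec v * cl_vec v = ((v^T *m v) 0 0)%:A.
Proof.
apply: (@scalerI R Cl 2); first by rewrite pnatr_eq0.
by rewrite scaler_nat mulr2n cl_vec_anticomm scalerA.
Qed.

Definition even_part x : Prop := forall A : {set 'I_n}, odd #|A| -> x A = 0.

(** If |A| is even and i lies in A, then e_i anticommutes with e_A, so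
    commuting with e_i kills the coefficient at A. *)
Lemma central_even_scalar z :
    even_part z -> (forall v, z * cl_vec v = cl_vec v * z) ->
  z = (z finset.set0)%:A.
Proof.
move=> ev cz; apply/ffunP => A; rewrite !ffunE.
have [->|[i iA]] := set_0Vmem A; first by rewrite eqxx /GRing.scale /= mulr1.
have /negPf -> : A != finset.set0 by apply/set0Pn; exists i.
rewrite /GRing.scale /= mulr0.
have [/ev//|evA] := boolP (odd #|A|).
have := congr1 (fun y : Cl => y (symd [set i]%SET A)) (cz (delta_mx i 0)).
rewrite /= cl_gen_mul cl_mul_gen => E.
have := cl_signC i A; rewrite iA -signr_odd oddD (negPf evA) /= expr1 => S.
have : z A = - z A.
  rewrite -[LHS]mul1r -(cl_sign_sqr [set i]%SET A) -mulrA -E mulrA.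
  by rewrite (mulrC (cl_sign R _ A)) S mulN1r.
by move=> h; lra.
Qed.

Lemma scalar_part_mulC x y : (x * y) finset.set0 = (y * x) finset.set0.
Proof.
rewrite !cl_mulE; apply: eq_bigr => A _.
have -> : symd A finset.set0 = A by rewrite symdC sym0d.
by rewrite -!mulrA (mulrC (x A)).
Qed.

(** The inner product for which the basis e_A is orthonormal; unit vectors act
    on it by self-adjoint isometries, which bounds the coefficients of an
    element of Spin. *)
Definition cl_dot x y : R := \sum_A x A * y A.

Lemma cl_dot_is_linear x : scalar (cl_dot x).
Proof.
move=> a y z; rewrite /cl_dot mulr_sumr -big_split /=; apply: eq_bigr => A _.
by rewrite !ffunE mulrDr /GRing.scale /= mulrCA.
Qed.

HB.instance Definition _ x :=
  GRing.isLinear.Build R Cl R *%R (cl_dot x) (cl_dot_is_linear x).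

Lemma cl_dotC x y : cl_dot x y = cl_dot y x.
Proof. by apply: eq_bigr => A _; rewrite mulrC. Qed.

(** Right multiplication by e_i is a signed involution of the basis e_A, hence
    self-adjoint. *)
Lemma cl_dot_mul_gen i x y : cl_dot (x * cl_gen i) y = cl_dot x (y * cl_gen i).
Proof.
rewrite /cl_dot (reindex_inj (can_inj (symdK [set i]%SET))) /=.
apply: eq_bigr => A _; rewrite cl_mul_gen.
have := cl_mul_gen i y (symd [set i]%SET A); rewrite symdK => ->.
rewrite cl_sign_symdl.
rewrite [cl_sign R [set i] [set i]]/cl_sign /ninv !big_set1 ltnn mul1r.
by rewrite mulrA (mulrC (x A)).
Qed.

Lemma cl_dot_mul_vec v x y : cl_dot (x * cl_vec v) y = cl_dot x (y * cl_vec v).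
Proof.
rewrite !cl_vecE !mulr_sumr (cl_dotC (\sum_i _)) !linear_sum /=.
apply: eq_bigr => i _; rewrite -!scalerAr !linearZ /=.
by rewrite (cl_dotC y) cl_dot_mul_gen.
Qed.

End Clifford.

Section Spin.
Variables (R : realType) (n : nat).
Local Notation Cl := (clifford R n).
Implicit Types (x y z : Cl) (v w : 'cV[R]_n).

Lemma cl_vec_coef v i : cl_vec v [set i]%SET = v i 0.
Proof.
rewrite ffunE (bigD1 i) //= big1 ?addr0 // => j /andP[/eqP E].
by rewrite (set1_inj E) eqxx.
Qed.

Lemma cl_vec_inj : injective (@cl_vec R n).
Proof.
move=> v w E; apply/matrixP => i j; rewrite ord1.
by rewrite -cl_vec_coef E cl_vec_coef.
Qed.

Definition unit_vec v := v^T *m v = 1%:M.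

Lemma unit_vec_sqr v : unit_vec v -> cl_vec v * cl_vec v = 1.
Proof. by move=> u; rewrite cl_vec_sqr u mxE scale1r. Qed.

Lemma unit_vec_unitr v : unit_vec v -> cl_vec v \is a GRing.unit.
Proof. by move=> u; apply/unitrP; exists (cl_vec v); rewrite unit_vec_sqr. Qed.

(** The opposite of the reflection in v: this, and not the reflection, is
    conjugation by a unit vector v in the Clifford algebra. *)
Definition half_turn v : 'M[R]_n := 2 *: (v *m v^T) - 1%:M.

Lemma unit_vec_conj v w : unit_vec v ->
  cl_vec v * cl_vec w = cl_vec (half_turn v *m w) * cl_vec v.
Proof.
move=> u; have := cl_vec_anticomm v w => /eqP; rewrite -subr_eq0 => /eqP E.
apply: (mulIr (unit_vec_unitr u)); rewrite -[RHS]mulrA unit_vec_sqr // mulr1.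
have -> : half_turn v *m w = (2 * (v^T *m w) 0 0) *: v - w.
  rewrite mulmxBl mul1mx -scalemxAl -mulmxA.
  by rewrite {1}[v^T *m w]mx11_scalar mul_mx_scalar scalerA.
have -> : cl_vec v * cl_vec w = (2 * (v^T *m w) 0 0)%:A - cl_vec w * cl_vec v.
  by rewrite -cl_vec_anticomm addrK.
by rewrite mulrBl mulr_algl -mulrA unit_vec_sqr // mulr1 linearB linearZ.
Qed.

(** The two block factorisations of the matrix with rows (1, v^T) and (2 v, 1)
    give its determinant as that of 1 - 2 v v^T and as 1 - 2 v^T v. *)
Lemma det_half_turn v : unit_vec v -> \det (half_turn v) = (-1) ^+ n.+1.
Proof.
move=> u; pose B : 'M[R]_(1 + n) := block_mx 1%:M v^T (2 *: v) 1%:M.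
have d1 : \det B = \det (1%:M - 2 *: (v *m v^T)).
  have -> : B = block_mx 1%:M 0 (2 *: v) 1%:M *m
                block_mx 1%:M v^T 0 (1%:M - 2 *: (v *m v^T)).
    rewrite mulmx_block !mul1mx !mulmx1 !mul0mx ?mulmx0 !addr0.
    by rewrite -scalemxAl addrC subrK.
  by rewrite det_mulmx det_lblock det_ublock !det1 !mul1r.
have d2 : \det B = -1.
  have -> : B = block_mx (- 1%:M) v^T 0 1%:M *m block_mx 1%:M 0 (2 *: v) 1%:M.
    rewrite mulmx_block !mul1mx !mulmx1 !mul0mx ?mulmx0 ?addr0 !add0r.
    rewrite -scalemxAr u; congr block_mx.
    by rewrite scaler_nat mulr2n addKr.
  by rewrite det_mulmx det_lblock det_ublock !det1 !mulr1 det_mx11 !mxE.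
rewrite /half_turn -[_ - _]opprB -scaleN1r detZ -d1 d2 exprSr.
by [].
Qed.

Lemma half_turn_sqr v : unit_vec v -> (half_turn v)^T *m half_turn v = 1%:M.
Proof.
move=> u; have -> : (half_turn v)^T = half_turn v.
  by rewrite /half_turn linearB /= linearZ /= trmx_mul trmxK trmx1.
have : (v *m v^T) *m (v *m v^T) = v *m v^T by rewrite mulmxA -(mulmxA v) u mulmx1.
rewrite /half_turn; move: (v *m v^T) => M MM.
rewrite mulmxBl !mulmxBr !mul1mx mulmx1 -scalemxAl -scalemxAr MM.
by apply/matrixP => i j; rewrite !mxE; ring.
Qed.

Lemma prod_vec_rev (s : seq 'cV[R]_n) : (forall v, v \in s -> unit_vec v) ->
  (\prod_(v <- s) cl_vec v) * (\prod_(v <- rev s) cl_vec v) = 1.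
Proof.
elim: s => [|v s IH] us; first by rewrite !big_nil mulr1.
rewrite rev_cons -cats1 big_cat /= big_cons big_seq1 -!mulrA (mulrA (\prod_(i <- s) _)).
rewrite IH ?mul1r ?unit_vec_sqr //; first by apply: us; rewrite mem_head.
by move=> w ws; apply: us; rewrite inE ws orbT.
Qed.

Lemma prod_vec_inv (s : seq 'cV[R]_n) : (forall v, v \in s -> unit_vec v) ->
  [/\ \prod_(v <- s) cl_vec v \is a GRing.unit
    & (\prod_(v <- s) cl_vec v)^-1 = \prod_(v <- rev s) cl_vec v].
Proof.
move=> us; have e1 := prod_vec_rev us.
have e2 : (\prod_(v <- rev s) cl_vec v) * (\prod_(v <- s) cl_vec v) = 1.
  by rewrite -{2}(revK s) prod_vec_rev // => v; rewrite mem_rev; apply: us.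
have un : \prod_(v <- s) cl_vec v \is a GRing.unit by apply/unitrP; eexists; split; eauto.
by split=> //; apply: (mulrI un); rewrite mulrV.
Qed.

(** Each factor contributes a half turn, of determinant (-1)^(n+1). *)
Lemma prod_vec_conj (s : seq 'cV[R]_n) : (forall v, v \in s -> unit_vec v) ->
  exists X : 'M[R]_n, [/\ X^T *m X = 1%:M, \det X = (-1) ^+ (n.+1 * size s)
    & forall w, (\prod_(v <- s) cl_vec v) * cl_vec w
                = cl_vec (X *m w) * \prod_(v <- s) cl_vec v].
Proof.
elim: s => [|v s IH] us.
  exists 1%:M; rewrite trmx1 mulmx1 det1 muln0; split=> // w.
  by rewrite big_nil mul1mx mulr1 mul1r.
have [|X [oX dX cX]] := IH.
  by move=> w ws; apply: us; rewrite inE ws orbT.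
have uv : unit_vec v by apply: us; rewrite mem_head.
exists (half_turn v *m X); split.
- by rewrite trmx_mul mulmxA -(mulmxA X^T) half_turn_sqr // mulmx1.
- by rewrite det_mulmx det_half_turn // dX -exprD mulnS.
move=> w; rewrite !big_cons -mulrA cX mulrA unit_vec_conj //.
by rewrite !mulrA mulmxA.
Qed.

Lemma spin_unit x : spin x -> x \is a GRing.unit.
Proof. by move=> [s [_ us ->]]; have [] := prod_vec_inv us. Qed.

Lemma spinV x : spin x -> spin x^-1.
Proof.
move=> [s [ev us ->]]; have [_ ->] := prod_vec_inv us.
by exists (rev s); rewrite size_rev; split=> // v; rewrite mem_rev; apply: us.
Qed.

Lemma spinM x y : spin x -> spin y -> spin (x * y).
Proof.
move=> [s [es us ->]] [t [et ut ->]]; exists (s ++ t); split.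
- by rewrite size_cat oddD (negPf es) (negPf et).
- by move=> v; rewrite mem_cat => /orP[/us|/ut].
- by rewrite big_cat.
Qed.

Lemma spin1 : spin (1 : Cl).
Proof. by exists [::]; rewrite big_nil. Qed.

Lemma spin2 v w : unit_vec v -> unit_vec w -> spin (cl_vec v * cl_vec w).
Proof.
move=> uv uw; exists [:: v; w]; split=> //.
  by move=> z; rewrite !inE => /orP[]/eqP ->.
by rewrite !big_cons big_nil mulr1.
Qed.

Lemma unit_vecN v : unit_vec v -> unit_vec (- v).
Proof. by move=> u; rewrite /unit_vec mulmxN [in (- v)^T]linearN /= mulNmx opprK. Qed.

Lemma spin_pi_eq x (X : 'M[R]_n) : x \is a GRing.unit ->
  (forall w, x * cl_vec w = cl_vec (X *m w) * x) -> spin_pi x = X.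
Proof.
move=> ux cX; apply/matrixP => i k; rewrite mxE cX mulrK // cl_vec_coef.
by rewrite -colE mxE.
Qed.

Lemma spin_piP x : spin x -> [/\ (spin_pi x)^T *m spin_pi x = 1%:M,
    \det (spin_pi x) = 1
  & forall w, x * cl_vec w = cl_vec (spin_pi x *m w) * x].
Proof.
move=> sx; have ux := spin_unit sx; case: sx => s [es us E].
have [X [oX dX cX]] := prod_vec_conj us; rewrite -E in cX.
have -> : spin_pi x = X by apply: spin_pi_eq.
by split=> //; rewrite dX -signr_odd oddM (negPf es) andbF.
Qed.

Lemma spin_pi_conj x w : spin x -> x * cl_vec w = cl_vec (spin_pi x *m w) * x.
Proof. by move=> /spin_piP[]. Qed.

Lemma spin_piM x y : spin x -> spin y -> spin_pi (x * y) = spin_pi x *m spin_pi y.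
Proof.
move=> sx sy; apply: spin_pi_eq => [|w]; first exact/spin_unit/spinM.
by rewrite -mulrA spin_pi_conj // mulrA spin_pi_conj // mulrA mulmxA.
Qed.

Lemma spin_piV x : spin x -> spin_pi x^-1 = (spin_pi x)^T.
Proof.
move=> sx; have [o _ _] := spin_piP sx; apply: spin_pi_eq => [|w].
  exact/spin_unit/spinV.
have ux := spin_unit sx.
apply: (mulrI ux); rewrite mulVKr // mulrA spin_pi_conj //.
by rewrite mulmxA (mulmx1C o) mul1mx mulrK.
Qed.

(** Right multiplication by a unit vector is self-adjoint of square 1, so it
    is an isometry. *)
Lemma spin_norm x : spin x -> cl_dot x x = 1.
Proof.
move=> [s [_ us ->]] {x}; elim/last_ind: s us => [|s v IH] us.
  rewrite big_nil /cl_dot (bigD1 finset.set0) //= big1 ?addr0 => [|A /negPf nA].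
    by rewrite !ffunE eqxx mulr1.
  by rewrite !ffunE nA mulr0.
rewrite -cats1 big_cat /= big_seq1 cl_dot_mul_vec -mulrA unit_vec_sqr ?mulr1.
  by apply: IH => w ws; apply: us; rewrite mem_rcons inE ws orbT.
by apply: us; rewrite mem_rcons mem_head.
Qed.

(** The norm of x is 1, which leaves no room for another coefficient. *)
Lemma spin_scalar_part1 x : spin x -> x finset.set0 = 1 -> x = 1.
Proof.
move=> /spin_norm N x1; apply/ffunP => A; rewrite [RHS]ffunE.
case: eqP => [->//|/eqP nA].
move: N; rewrite /cl_dot (bigD1 finset.set0) //= x1 mulr1.
move/(canRL (addKr _)); rewrite addNr => /eqP.
rewrite psumr_eq0 => [|B _]; last by rewrite -expr2 sqr_ge0.
by move=> /allP /(_ A (mem_index_enum _)); rewrite nA /= mulf_eq0 orbb => /eqP.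
Qed.

Lemma orth_anticomm v w : v^T *m w = 0 ->
  cl_vec v * cl_vec w = - (cl_vec w * cl_vec v).
Proof.
by move=> o; apply/eqP; rewrite -addr_eq0 cl_vec_anticomm o mxE mulr0 scale0r.
Qed.

Lemma vec_eq0 v w : unit_vec w -> cl_vec v * cl_vec w = 0 -> v = 0.
Proof.
move=> uw /(congr1 (fun t => t * cl_vec w)); rewrite -mulrA unit_vec_sqr //.
by rewrite mulr1 mul0r => E; apply: cl_vec_inj; rewrite E linear0.
Qed.

(** The part of u orthogonal to p and q commutes with p q, whereas the part in
    their plane anticommutes with it; so the former vanishes. *)
Lemma bivector_anticomm p q u : unit_vec p -> unit_vec q -> p^T *m q = 0 ->
    (cl_vec p * cl_vec q) * cl_vec u = - (cl_vec u * (cl_vec p * cl_vec q)) ->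
  u = (p^T *m u) 0 0 *: p + (q^T *m u) 0 0 *: q.
Proof.
move=> up uq pq ac; set al := (p^T *m u) 0 0; set be := (q^T *m u) 0 0.
have qp : q^T *m p = 0 by rewrite -[LHS]trmxK trmx_mul trmxK pq trmx0.
apply/eqP; rewrite -subr_eq0; apply/eqP; set u' := u - _.
have pu' : p^T *m u' = 0.
  rewrite mulmxBr mulmxDr -!scalemxAr up pq scaler0 addr0.
  by rewrite [p^T *m u]mx11_scalar -/al scalemx1 subrr.
have qu' : q^T *m u' = 0.
  rewrite mulmxBr mulmxDr -!scalemxAr uq qp scaler0 add0r.
  by rewrite [q^T *m u]mx11_scalar -/be scalemx1 subrr.
have eu : u = al *: p + be *: q + u' by rewrite addrC subrK.
clearbody u'.
have cpq : cl_vec p * cl_vec q * cl_vec u' = cl_vec u' * (cl_vec p * cl_vec q).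
  rewrite -mulrA (orth_anticomm qu') mulrN [cl_vec p * (cl_vec u' * _)]mulrA.
  by rewrite (orth_anticomm pu') mulNr opprK mulrA.
have cp : cl_vec p * cl_vec q * cl_vec p = - (cl_vec p * (cl_vec p * cl_vec q)).
  by rewrite -mulrA (orth_anticomm qp) mulrN.
have cq : cl_vec p * cl_vec q * cl_vec q = - (cl_vec q * (cl_vec p * cl_vec q)).
  by rewrite {1}(orth_anticomm pq) mulNr -mulrA.
apply: (vec_eq0 up); apply: (mulIr (unit_vec_unitr uq)); rewrite mul0r -mulrA.
have : cl_vec u' * (cl_vec p * cl_vec q) *+ 2 = 0.
  have /eqP := ac; rewrite -addr_eq0 eu !linearD !linearZ /=.
  rewrite !mulrDr !mulrDl -!scalerAr -!scalerAl cpq cp cq !scalerN.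
  set a := al *: _; set b := be *: _; set c := cl_vec u' * _.
  by rewrite -opprD addrACA addNr add0r -mulr2n => /eqP.
by rewrite -scaler_nat => /eqP; rewrite scaler_eq0 pnatr_eq0 /= => /eqP.
Qed.

(** A bivector determines its plane: u and v anticommute with u v, hence with
    p q. The number c is the determinant of (u, v) on (p, q). *)
Lemma bivector_plane p q u v (c : R) : unit_vec p -> unit_vec q -> p^T *m q = 0 ->
    unit_vec u -> unit_vec v -> u^T *m v = 0 ->
    cl_vec u * cl_vec v = c *: (cl_vec p * cl_vec q) ->
  exists al be ga de : R, [/\ u = al *: p + be *: q, v = ga *: p + de *: q
     & al * de - be * ga = c].
Proof.
move=> up uq pq uu uv o E.
have vu : v^T *m u = 0 by rewrite -[LHS]trmxK trmx_mul trmxK o trmx0.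
(* u v = 0 is impossible for unit vectors. *)
have c0 : c != 0.
  apply/eqP => c0; move: uu E; rewrite c0 scale0r => uu /(vec_eq0 uv) u0; move: uu.
  rewrite /unit_vec u0 mulmx0 => /matrixP /(_ 0 0); rewrite !mxE => /eqP.
  by rewrite eq_sym oner_eq0.
have cE : cl_vec p * cl_vec q = c^-1 *: (cl_vec u * cl_vec v).
  by rewrite E scalerA mulVf ?scale1r.
have eu : u = (p^T *m u) 0 0 *: p + (q^T *m u) 0 0 *: q.
  apply: bivector_anticomm => //; rewrite cE -scalerAl -scalerAr -scalerN.
  by congr (_ *: _); rewrite -mulrA (orth_anticomm vu) mulrN.
have ev : v = (p^T *m v) 0 0 *: p + (q^T *m v) 0 0 *: q.
  apply: bivector_anticomm => //; rewrite cE -scalerAl -scalerAr -scalerN.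
  by congr (_ *: _); rewrite {1}(orth_anticomm o) mulNr -mulrA.
move: eu ev.
set al := (p^T *m u) 0 0; set be := (q^T *m u) 0 0.
set ga := (p^T *m v) 0 0; set de := (q^T *m v) 0 0.
move=> eu ev; exists al, be, ga, de; split=> //.
have qp : q^T *m p = 0 by rewrite -[LHS]trmxK trmx_mul trmxK pq trmx0.
(* The scalar part of u v, which vanishes because u and v are orthogonal. *)
have oo : al * ga + be * de = 0.
  have := congr1 (fun M : 'M[R]_1 => M 0 0) o.
  rewrite eu ev [in (_ + _)^T]linearD /= ![in (_ *: _)^T]linearZ /= mulmxDl !mulmxDr.
  rewrite -!scalemxAl -!scalemxAr up uq pq qp !mxE !mulr0 !mulr1 addr0 add0r.
  by [].
move: E; rewrite eu ev !linearD !linearZ /= mulrDl !mulrDr.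
rewrite -!scalerAl -!scalerAr !unit_vec_sqr // (orth_anticomm qp) !scalerN !scalerA.
set w := cl_vec p * _.
have -> : (al * ga) *: 1 + (al * de) *: w + (- ((be * ga) *: w) + (be * de) *: 1)
   = (al * ga + be * de) *: 1 + (al * de - be * ga) *: w :> Cl.
  by rewrite scalerDl scalerBl (addrC (- _)) addrACA.
rewrite oo scale0r add0r => /eqP; rewrite -subr_eq0 -scalerBl scaler_eq0.
case/orP => [|/eqP w0]; first by rewrite subr_eq0 => /eqP.
have p0 := vec_eq0 uq w0.
by move/matrixP/(_ 0 0): up; rewrite p0 mulmx0 !mxE => /eqP; rewrite eq_sym oner_eq0.
Qed.

End Spin.

(** * Matrices of size 2 and the group of pairs *)

Section Mx2.
Variable R : comNzRingType.

(** Explicit entries: with [mx2E], identities between matrices of size 2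
    reduce to polynomial identities between entries. *)
Definition mx2 (a b c d : R) : 'M[R]_2 :=
  \matrix_(i, j) if i == 0 then (if j == 0 then a else b)
                 else (if j == 0 then c else d).

(** Case analysis on an index which leaves the two values in the form 0 and 1,
    so that the conditionals of [mx2] compute. *)
Lemma forall_ord2 (P : 'I_2 -> Prop) : P 0 -> P 1 -> forall i, P i.
Proof.
by move=> P0 P1 [[|[|//]] lt2]; [move: P0 | move: P1];
  congr P; apply: val_inj.
Qed.

Lemma mx2_eta (A : 'M[R]_2) : A = mx2 (A 0 0) (A 0 1) (A 1 0) (A 1 1).
Proof. by apply/matrixP; apply: forall_ord2; apply: forall_ord2; rewrite !mxE. Qed.

Lemma mx2_inj a b c d a' b' c' d' : mx2 a b c d = mx2 a' b' c' d' ->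
  [/\ a = a', b = b', c = c' & d = d'].
Proof.
move=> /matrixP E; move: (E 0 0) (E 0 1) (E 1 0) (E 1 1).
by rewrite !mxE.
Qed.

Lemma mx2M a b c d a' b' c' d' : mx2 a b c d *m mx2 a' b' c' d' =
  mx2 (a * a' + b * c') (a * b' + b * d') (c * a' + d * c') (c * b' + d * d').
Proof.
by apply/matrixP; apply: forall_ord2; apply: forall_ord2;
  rewrite !mxE !big_ord_recl big_ord0 !mxE /= addr0.
Qed.

Lemma mx2D a b c d a' b' c' d' : mx2 a b c d + mx2 a' b' c' d' =
  mx2 (a + a') (b + b') (c + c') (d + d').
Proof. by apply/matrixP; apply: forall_ord2; apply: forall_ord2; rewrite !mxE. Qed.

Lemma mx2N a b c d : - mx2 a b c d = mx2 (- a) (- b) (- c) (- d).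
Proof. by apply/matrixP; apply: forall_ord2; apply: forall_ord2; rewrite !mxE. Qed.

Lemma mx2Z k a b c d : k *: mx2 a b c d = mx2 (k * a) (k * b) (k * c) (k * d).
Proof. by apply/matrixP; apply: forall_ord2; apply: forall_ord2; rewrite !mxE. Qed.

Lemma mx2T a b c d : (mx2 a b c d)^T = mx2 a c b d.
Proof. by apply/matrixP; apply: forall_ord2; apply: forall_ord2; rewrite !mxE. Qed.

Lemma mx2S a : a%:M = mx2 a 0 0 a.
Proof. by apply/matrixP; apply: forall_ord2; apply: forall_ord2; rewrite !mxE. Qed.

Lemma mx2_0 : 0 = mx2 0 0 0 0.
Proof. by apply/matrixP; apply: forall_ord2; apply: forall_ord2; rewrite !mxE. Qed.

Lemma mx2_det a b c d : \det (mx2 a b c d) = a * d - b * c.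
Proof.
rewrite (expand_det_row _ 0) !big_ord_recl big_ord0 /cofactor !det_mx11 !mxE /=.
by rewrite addr0 expr0 expr1; ring.
Qed.

Lemma diag_block_mul (A B A' B' : 'M[R]_2) :
  block_mx A 0 0 B *m block_mx A' 0 0 B' = block_mx (A *m A') 0 0 (B *m B').
Proof. by rewrite mulmx_block !mulmx0 !mul0mx !addr0 !add0r. Qed.

Lemma mx2_tr a b c d : \tr (mx2 a b c d) = a + d.
Proof. by rewrite /mxtrace !big_ord_recl big_ord0 !mxE addr0. Qed.

End Mx2.

Definition mx2E := (mx2M, mx2D, mx2N, mx2Z, mx2T, mx2S, mx2_det, mx2_tr).

Section Orth2.
Variable R : realType.

Definition rot (x y : R) := mx2 x (- y) y x.
Definition refl (x y : R) := mx2 x y y (- x).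

Lemma orth2P (h : 'M[R]_2) : orthogonal_group h ->
  exists x y, x ^+ 2 + y ^+ 2 = 1 /\
   ((h = rot x y /\ \det h = 1) \/ (h = refl x y /\ \det h = -1)).
Proof.
rewrite /orthogonal_group /= [h]mx2_eta.
move: (h 0 0) (h 0 1) (h 1 0) (h 1 1) => a b c d {h}; rewrite !mx2E.
case/mx2_inj => e1 e2 e3 e4; exists a, c; split; first by rewrite -e1; ring.
(* Lagrange's identity for the two columns. *)
have dd : (a * d - b * c) ^+ 2 = 1.
  have -> : (a * d - b * c) ^+ 2
     = (a * a + c * c) * (b * b + d * d) - (a * b + c * d) ^+ 2 by ring.
  by rewrite e1 e2 e4; ring.
have db : d * (a * a + c * c) - c * (a * b + c * d) = a * (a * d - b * c) by ring.
have bb : b * (a * a + c * c) - a * (a * b + c * d) = - c * (a * d - b * c) by ring.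
move: db bb; rewrite e1 e2 !mulr0 !subr0 !mulr1 => db bb.
have /eqP := dd; rewrite sqrf_eq1 => /orP[]/eqP D; rewrite !D in db bb *;
  [left|right]; split=> //; rewrite /rot /refl; congr mx2; move: db bb; lra.
Qed.

Lemma orthM n (g h : 'M[R]_n) : orthogonal_group g -> orthogonal_group h ->
  orthogonal_group (g *m h).
Proof.
rewrite /orthogonal_group /= => og oh.
by rewrite trmx_mul mulmxA -(mulmxA h^T) og mulmx1.
Qed.

Lemma orth1 n : @orthogonal_group R n 1%:M.
Proof. by rewrite /orthogonal_group /= trmx1 mulmx1. Qed.

Lemma orthT n (a : 'M[R]_n) : orthogonal_group a -> orthogonal_group a^T.
Proof. by rewrite /orthogonal_group /= trmxK => /mulmx1C. Qed.

Lemma orth_det (h : 'M[R]_2) : orthogonal_group h -> \det h = 1 \/ \det h = -1.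
Proof. by move=> /orth2P [x [y [_ [[_ ->]|[_ ->]]]]]; [left|right]. Qed.

Lemma orth_det_sqr (h : 'M[R]_2) : orthogonal_group h -> \det h ^+ 2 = 1.
Proof. by move=> /orth_det [] ->; rewrite ?sqrrN expr1n. Qed.

Lemma swap2E : swap2 R = mx2 0 1 1 0.
Proof. by apply/matrixP; apply: forall_ord2; apply: forall_ord2; rewrite !mxE. Qed.

Lemma swap2_orth : orthogonal_group (swap2 R) /\ \det (swap2 R) = -1.
Proof.
by rewrite swap2E /orthogonal_group /= !mx2E; split; [congr mx2|]; ring.
Qed.

End Orth2.

Section CalG.
Variable R : realType.
Local Notation C := R[i].
Local Open Scope complex_scope.

Definition cmx (h : 'M[R]_2) : 'M[C]_2 := map_mx (real_complex R) h.

Lemma conjC_conjc (z : C) : Num.conj z = conjc z.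
Proof. by []. Qed.

Lemma cmx_mx2 a b c d : cmx (mx2 a b c d) = mx2 a%:C b%:C c%:C d%:C.
Proof. by apply/matrixP; apply: forall_ord2; apply: forall_ord2; rewrite !mxE. Qed.

Lemma cmxM (g h : 'M[R]_2) : cmx (g *m h) = cmx g *m cmx h.
Proof. exact: map_mxM. Qed.

Definition cv2 (a b : C) : 'cV[C]_2 := \col_i if i == 0 then a else b.

Lemma cv2_eta (v : 'cV[C]_2) : v = cv2 (v 0 0) (v 1 0).
Proof.
apply/matrixP; apply: forall_ord2 => j; rewrite ord1 !mxE //.
Qed.

Lemma cv2_inj a b a' b' : cv2 a b = cv2 a' b' -> a = a' /\ b = b'.
Proof. by move=> /matrixP E; move: (E 0 0) (E 1 0); rewrite !mxE. Qed.

Lemma mx2_cv2 a b c d x y :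
  mx2 a b c d *m cv2 x y = cv2 (a * x + b * y) (c * x + d * y).
Proof.
by apply/matrixP; apply: forall_ord2 => j;
  rewrite !mxE !big_ord_recl big_ord0 !mxE /= addr0.
Qed.

Lemma cv2Z k a b : k *: cv2 a b = cv2 (k * a) (k * b).
Proof. by apply/matrixP; apply: forall_ord2 => j; rewrite !mxE. Qed.

Lemma qform_cv2 a b : qform (cv2 a b) = a ^+ 2 + b ^+ 2.
Proof. by rewrite /qform !mxE. Qed.

Lemma delta_cv2 : delta_mx 0 0 = cv2 1 0.
Proof. by apply/matrixP; apply: forall_ord2 => j; rewrite !mxE ord1. Qed.

Lemma qform_orth h z v : orthogonal_group h ->
  qform ((z *: cmx h) *m v) = z ^+ 2 * qform v.
Proof.
move=> /orth2P [x [y [e H]]]; rewrite [v]cv2_eta.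
move: (v 0 0) (v 1 0) => a b {v}.
have eC : x%:C ^+ 2 + y%:C ^+ 2 = 1 by rewrite -!rmorphXn -rmorphD e.
have -> : z ^+ 2 * qform (cv2 a b) =
  z ^+ 2 * ((x%:C ^+ 2 + y%:C ^+ 2) * qform (cv2 a b)) by rewrite eC mul1r.
case: H => [[-> _]|[-> _]]; rewrite /rot /refl cmx_mx2 mx2Z mx2_cv2 !qform_cv2;
  rewrite ?rmorphN /=; ring.
Qed.

Lemma simil_orth h z : orthogonal_group h -> simil (z *: cmx h) = z ^+ 2.
Proof.
by move=> oh; rewrite /simil qform_orth // delta_cv2 qform_cv2; ring.
Qed.

(** The isotropic lines of q are spanned by (1, i) and (1, -i): rotations fix
    both, and a reflection moves the first. *)
Lemma eps_orth h z : orthogonal_group h -> z != 0 -> eps (z *: cmx h) = \det h.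
Proof.
move=> /orth2P [x [y [e H]]] z0; rewrite /eps.
have ii : 'i * 'i = -1 :> C by rewrite -expr2 sqr_i.
case: H => [[-> ->]|[-> ->]]; case: asboolP => // H.
  exfalso; apply: H => v; rewrite [v]cv2_eta qform_cv2.
  move: (v 0 0) (v 1 0) => a b {v} q.
  have /eqP : (b - 'i * a) * (b + 'i * a) = 0.
    by rewrite -{1}q; have -> : (b - 'i * a) * (b + 'i * a)
       = b ^+ 2 - ('i * 'i) * a ^+ 2 by [ring]; rewrite ii; ring.
  rewrite mulf_eq0 => /orP[].
    rewrite subr_eq0 => /eqP ->; exists (z * (x%:C - 'i * y%:C)).
    rewrite /rot cmx_mx2 mx2Z mx2_cv2 cv2Z rmorphN /=; congr cv2; first by ring.
    have -> : z * (x%:C - 'i * y%:C) * ('i * a)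
      = z * ('i * x%:C - ('i * 'i) * y%:C) * a by ring.
    by rewrite ii; ring.
  rewrite addr_eq0 => /eqP ->; exists (z * (x%:C + 'i * y%:C)).
  rewrite /rot cmx_mx2 mx2Z mx2_cv2 cv2Z rmorphN /=; congr cv2; first by ring.
  have -> : z * (x%:C + 'i * y%:C) * (- ('i * a))
    = z * (- 'i * x%:C - ('i * 'i) * y%:C) * a by ring.
  by rewrite ii; ring.
exfalso.
have [|c] := H (cv2 1 'i); first by rewrite qform_cv2 sqr_i; ring.
rewrite /refl cmx_mx2 mx2Z mx2_cv2 cv2Z rmorphN /= => /cv2_inj [e1 e2].
have : z * (y%:C - 'i * x%:C) = 0.
  have : z * y%:C * 1 + z * - x%:C * 'i - c * 'i = 0 by rewrite e2 subrr.
  have -> : c = z * x%:C * 1 + z * y%:C * 'i by rewrite e1 mulr1.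
  have -> : z * y%:C * 1 + z * - x%:C * 'i - (z * x%:C * 1 + z * y%:C * 'i) * 'i
   = z * (y%:C - 2 * 'i * x%:C - y%:C * ('i * 'i)) by ring.
  rewrite ii => /(congr1 (fun t => 2^-1 * t)); rewrite mulr0 => <-.
  by field.
move/eqP; rewrite mulf_eq0 (negPf z0) /= subr_eq0 => /eqP /eqP.
rewrite eq_complex /= => /andP[/eqP]; simpc => y0 /eqP x0.
by move: e y0 x0; rewrite !expr2; nra.
Qed.

Lemma pow4_cases (z : C) : z ^+ 4 = 1 -> z ^+ 2 = 1 \/ z ^+ 2 = -1.
Proof.
move=> e; have /eqP : (z ^+ 2) ^+ 2 = 1 by rewrite -exprM.
by rewrite sqrf_eq1 => /orP[]/eqP ->; [left|right].
Qed.

Lemma pow4_neq0 (z : C) : z ^+ 4 = 1 -> z != 0.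
Proof.
move=> e; apply/eqP => z0; move: e; rewrite z0 expr0n => /eqP.
by rewrite eq_sym oner_eq0.
Qed.

Lemma sqr1_conj (z : C) : z ^+ 2 = 1 -> conjc z = z.
Proof. by move/eqP; rewrite sqrf_eq1 => /orP[]/eqP ->;
  apply/eqP; rewrite eq_complex /= ?oppr0 ?eqxx. Qed.

Lemma sqrN1_cases (z : C) : z ^+ 2 = -1 -> z = 'i \/ z = - 'i.
Proof.
by rewrite -sqr_i => /eqP; rewrite eqf_sqr => /orP[]/eqP ->; [left|right].
Qed.

Lemma sqrN1_conj (z : C) : z ^+ 2 = -1 -> conjc z = - z.
Proof. by move/sqrN1_cases => [] ->; apply/eqP; rewrite eq_complex /= ?opprK ?oppr0 ?eqxx. Qed.

Lemma pow4_conj (z : C) : z ^+ 4 = 1 -> z * conjc z = 1.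
Proof.
move=> /pow4_cases []e; rewrite ?(sqr1_conj e) ?(sqrN1_conj e) ?mulrN -expr2 e //.
by rewrite opprK.
Qed.

Lemma O2pm_form h z : orthogonal_group h -> z ^+ 4 = 1 -> O2pm (z *: cmx h).
Proof.
move=> oh e; have z0 := pow4_neq0 e; split.
- split; last by move=> v; rewrite simil_orth // qform_orth.
  rewrite unitmxE detZ unitfE mulf_neq0 ?expf_neq0 // det_map_mx /=.
  have [x [y [_ []]]] := orth2P oh => -[_ ->];
    by rewrite ?rmorphN1 ?rmorph1 ?oppr_eq0 oner_eq0.
- apply/unitarymxP; rewrite linearZ /= map_mxZ /= -scalemxAl -scalemxAr scalerA.
  rewrite conjC_conjc pow4_conj // scale1r -map_trmx -map_mx_comp.
  have -> : map_mx (Num.conj \o real_complex R) h = cmx h.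
    by apply/matrixP => i j; rewrite !mxE /= conjC_conjc conjc_real.
  by rewrite map_trmx -map_mxM /= (mulmx1C oh) map_mx1.
- by rewrite simil_orth //; apply: pow4_cases.
Qed.

(** Polarisation of the similitude relation, on the vectors (0, 1) and (1, 1).
    *)
Lemma GO2C_gram (g : 'M[C]_2) : GO2C g -> g^T *m g = (simil g)%:M.
Proof.
move=> [_]; rewrite /simil [g]mx2_eta.
move: (g 0 0) (g 0 1) (g 1 0) (g 1 1) => a b c d H.
have := H (cv2 0 1); have := H (cv2 1 1).
rewrite delta_cv2 !mx2_cv2 !qform_cv2 !mx2E => h1 h2.
have e2 : b ^+ 2 + d ^+ 2 = a ^+ 2 + c ^+ 2.
  transitivity ((a * 0 + b * 1) ^+ 2 + (c * 0 + d * 1) ^+ 2); first by ring.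
  by rewrite h2; ring.
have /eqP e3 : 2 * (a * b + c * d) = 0.
  transitivity ((a * 1 + b * 1) ^+ 2 + (c * 1 + d * 1) ^+ 2
     - (a ^+ 2 + c ^+ 2) - (b ^+ 2 + d ^+ 2)); first by ring.
  by rewrite h1 e2; ring.
move: e3; rewrite mulf_eq0 pnatr_eq0 /= => /eqP e3.
congr mx2; [ring|by rewrite -e3; ring|by rewrite -e3; ring|].
by transitivity (b ^+ 2 + d ^+ 2); [ring|rewrite e2; ring].
Qed.

(** As g is unitary and g^T g = +1 or -1, g is equal to its conjugate or to
    the opposite of its conjugate; so it is real, or i times a real matrix. *)
Lemma O2pmP (g : 'M[C]_2) : O2pm g -> exists h z, [/\ orthogonal_group h, z ^+ 4 = 1,
  g = z *: cmx h, eps g = \det h & simil g = z ^+ 2].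
Proof.
move=> [Gg ug sg]; have gram := GO2C_gram Gg.
have uni : map_mx Num.conj g^T *m g = 1%:M by apply: mulmx1C; apply/unitarymxP.
suff [h [z [e4 gE]]] : exists h (z : C), z ^+ 4 = 1 /\ g = z *: cmx h.
  have oh : orthogonal_group h.
    have gu : g^T *m g = z ^+ 2 *: map_mx (real_complex R) (h^T *m h).
      by rewrite gE -scalemxAr [(_ *: _)^T]linearZ /= -scalemxAl scalerA map_mxM map_trmx.
    have se : simil g = z ^+ 2 \/ simil g = - z ^+ 2.
      by case: sg (pow4_cases e4) => -> []->; rewrite ?opprK; auto.
    have z20 : z ^+ 2 != 0 by rewrite expf_neq0 // pow4_neq0.
    move: gu; rewrite gram.
    case: se => -> E; rewrite /orthogonal_group /=.
      apply: (@map_mx_inj _ _ (real_complex R)); apply: (scalerI z20).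
      by rewrite -E map_mx1 scalemx1.
    exfalso; have : map_mx (real_complex R) (h^T *m h) = (-1)%:M.
      by apply: (scalerI z20); rewrite -E scale_scalar_mx mulrN1.
    move/matrixP/(_ 0 0); rewrite !mxE !big_ord_recl big_ord0 !mxE /= => /eqP.
    rewrite eq_complex /= => /andP[/eqP E1 _].
    have : 0 <= -1 :> R by rewrite -E1 addr0 addr_ge0 // -expr2 sqr_ge0.
    by rewrite oppr_ge0 ler10.
  by exists h, z; rewrite gE eps_orth ?simil_orth ?pow4_neq0.
(* Both g^T / mu(g) and the conjugate transpose are inverses of g. *)
have key : g = simil g *: map_mx Num.conj g.
  have -> : map_mx Num.conj g = (map_mx Num.conj g^T)^T by rewrite map_trmx trmxK.
  have e : (simil g *: map_mx Num.conj g^T) *m g = g^T *m g.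
    by rewrite -scalemxAl uni gram scalemx1.
  have ug' : g \in unitmx by have [] := Gg.
  have := congr1 (fun M => M *m invmx g) e; rewrite !mulmxK // => E.
  by have := congr1 trmx E; rewrite linearZ /= trmxK => ->.
case: sg => sE; rewrite sE in key.
  exists (map_mx (@complex.Re R) g), 1; split; first by rewrite expr1n.
  rewrite scale1r; apply/matrixP => i j; rewrite !mxE.
  move/matrixP/(_ i j): key; rewrite !mxE mul1r conjC_conjc.
  case: (g i j) => a b /eqP; rewrite eq_complex /= eqxx /= => /eqP b0.
  by congr Complex; lra.
exists (map_mx (@complex.Im R) g), 'i; split.
  by rewrite (exprM _ 2 2) sqr_i sqrrN expr1n.
apply/matrixP => i j; rewrite !mxE.
move/matrixP/(_ i j): key; rewrite !mxE mulN1r conjC_conjc.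
case: (g i j) => a b /eqP; rewrite eq_complex /= opprK eqxx andbT => /eqP a0.
by simpc; congr Complex; lra.
Qed.

Definition pairG (h1 h2 : 'M[R]_2) (z1 z2 : C) : 'M[C]_2 * 'M[C]_2 :=
  (z1 *: cmx h1, z2 *: cmx h2).

(** The conditions defining calG, for the pair (z1 h1, z2 h2) with h1 and h2
    in O(2): the signature of z h is det h, its similitude factor is z^2 and
    its determinant is z^2 det h. *)
Definition calG_data (h1 h2 : 'M[R]_2) (z1 z2 : C) : Prop :=
  [/\ orthogonal_group h1, orthogonal_group h2,
      z1 ^+ 2 = (\det h2)%:C & z2 ^+ 2 = (\det h1)%:C].

Lemma calG_dataP h1 h2 z1 z2 : calG_data h1 h2 z1 z2 ->
  [/\ calG (pairG h1 h2 z1 z2), upsilon (pairG h1 h2 z1 z2) = \det h1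
    & dchar (pairG h1 h2 z1 z2) = \det h1 * \det h2].
Proof.
move=> [o1 o2 e1 e2].
have f1 : z1 ^+ 4 = 1 by rewrite (exprM _ 2 2) e1 -rmorphXn orth_det_sqr.
have f2 : z2 ^+ 4 = 1 by rewrite (exprM _ 2 2) e2 -rmorphXn orth_det_sqr.
have eE : eps (z1 *: cmx h1) = \det h1 by rewrite eps_orth // pow4_neq0.
have dE (h : 'M[R]_2) z : \det (z *: cmx h) = z ^+ 2 * (\det h)%:C.
  by rewrite detZ det_map_mx.
split=> //.
  split=> /=; [exact: O2pm_form|exact: O2pm_form| |].
    by rewrite !dE e1 e2 mulrC.
  by rewrite simil_orth // e2 eE.
by rewrite /dchar /= dE e1 -rmorphM mulrC.
Qed.

Lemma calG_datum (g : 'M[C]_2 * 'M[C]_2) : calG g ->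
  exists h1 h2 z1 z2, calG_data h1 h2 z1 z2 /\ g = pairG h1 h2 z1 z2.
Proof.
case: g => g1 g2 [/= /O2pmP [h1 [z1 [o1 e1 -> -> _]]] /O2pmP [h2 [z2 [o2 e2 -> _ ->]]]].
rewrite !detZ !det_map_mx /= => d m; exists h1, h2, z1, z2; split=> //; split=> //.
have h10 : (\det h1)%:C != 0.
  by case: (orth_det o1) => ->; rewrite ?rmorphN ?rmorph1 ?oppr_eq0 oner_eq0.
by apply: (mulIf h10); rewrite d m mulrC.
Qed.

Lemma calG_data_mul h1 h2 z1 z2 h1' h2' z1' z2' :
  calG_data h1 h2 z1 z2 -> calG_data h1' h2' z1' z2' ->
  calG_data (h1 *m h1') (h2 *m h2') (z1 * z1') (z2 * z2').
Proof.
move=> [o1 o2 e1 e2] [o1' o2' e1' e2']; split; try exact: orthM.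
  by rewrite exprMn e1 e1' -rmorphM det_mulmx.
by rewrite exprMn e2 e2' -rmorphM det_mulmx.
Qed.

Lemma pairG_mul h1 h2 z1 z2 h1' h2' z1' z2' :
  pairG h1 h2 z1 z2 * pairG h1' h2' z1' z2'
  = pairG (h1 *m h1') (h2 *m h2') (z1 * z1') (z2 * z2').
Proof.
rewrite /pairG /=; congr pair;
  by rewrite -[LHS]/(_ *m _) -scalemxAl -scalemxAr scalerA cmxM.
Qed.

Lemma calG_mul (g g' : 'M[C]_2 * 'M[C]_2) : calG g -> calG g' ->
  [/\ calG (g * g'), upsilon (g * g') = upsilon g * upsilon g'
    & dchar (g * g') = dchar g * dchar g'].
Proof.
move=> /calG_datum [h1 [h2 [z1 [z2 [D ->]]]]].
move=> /calG_datum [h1' [h2' [z1' [z2' [D' ->]]]]].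
have [_ u d] := calG_dataP D; have [_ u' d'] := calG_dataP D'.
have [DD u'' d''] := calG_dataP (calG_data_mul D D').
rewrite pairG_mul; split=> //; rewrite ?u'' ?d'' ?u ?u' ?d ?d' !det_mulmx //.
by ring.
Qed.

Lemma calG_signs (g : 'M[C]_2 * 'M[C]_2) : calG g ->
  (upsilon g = 1 \/ upsilon g = -1) /\ (dchar g = 1 \/ dchar g = -1).
Proof.
move=> /calG_datum [h1 [h2 [z1 [z2 [D ->]]]]].
have [_ -> ->] := calG_dataP D; case: D => o1 o2 _ _.
split; first exact: orth_det.
by case: (orth_det o1) (orth_det o2) => -> []->; rewrite ?mulr1 ?mul1r ?mulrNN ?mulr1; auto.
Qed.

End CalG.

(** * Orthonormal frames and the even Clifford algebra of F *)

Section Parity.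
Variables (R : realType) (n : nat).
Local Notation Cl := (clifford R n).
Implicit Types (x y : Cl).

Definition has_parity (e : bool) x :=
  forall A : {set 'I_n}, odd #|A| != e -> x A = 0.

Lemma odd_card_symd (A B : {set 'I_n}) : odd #|symd A B| = odd #|A| (+) odd #|B|.
Proof. by rewrite -!sum1_card odd_sum_symd. Qed.

Lemma parityM e e' x y : has_parity e x -> has_parity e' y ->
  has_parity (e (+) e') (x * y).
Proof.
move=> px py C nC; rewrite cl_mulE big1 // => A _.
have [oA|nA] := eqVneq (odd #|A|) e; last by rewrite px // mulr0 mul0r.
rewrite py ?mulr0 // odd_card_symd oA; apply: contra nC => /eqP E.
by rewrite -E addKb.
Qed.

Lemma parityD e a x y : has_parity e x -> has_parity e y -> has_parity e (a *: x + y).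
Proof. by move=> px py A nA; rewrite !ffunE px // py // scaler0 addr0. Qed.

Lemma parity1 : has_parity false (1 : Cl).
Proof.
move=> A nA; rewrite ffunE; have [A0|//] := eqVneq A finset.set0.
by rewrite A0 cards0 in nA.
Qed.

Lemma parity_vec (v : 'cV[R]_n) : has_parity true (cl_vec v).
Proof.
move=> A nA; rewrite ffunE big1 // => i /eqP E.
by rewrite E cards1 in nA.
Qed.

End Parity.

Section Acomm.
Variables (R : realType) (n : nat).
Local Notation Cl := (clifford R n).
Implicit Types (x y z : Cl).

(** Commutation up to a sign, with the sign kept as a boolean, so that the
    signs of factors simply add up in a product. *)
Definition acomm (e : bool) x y := x * y = (-1) ^+ e *: (y * x).

Lemma acommMr e e' x y z : acomm e x y -> acomm e' x z -> acomm (e (+) e') x (y * z).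
Proof.
rewrite /acomm signr_addb => h h'.
by rewrite mulrA h -scalerAl -[y * x * z]mulrA h' -scalerAr scalerA mulrA.
Qed.

Lemma acommMl e e' x y z : acomm e x z -> acomm e' y z -> acomm (e (+) e') (x * y) z.
Proof.
rewrite /acomm signr_addb mulrC => h h'.
by rewrite -mulrA h' -scalerAr [x * (z * y)]mulrA h -scalerAl scalerA mulrA.
Qed.

Lemma acomm1l y : acomm false 1 y. Proof. by rewrite /acomm scale1r mul1r mulr1. Qed.
Lemma acomm1r y : acomm false y 1. Proof. by rewrite /acomm scale1r mul1r mulr1. Qed.

Lemma acomm0P x y : acomm false x y <-> x * y = y * x.
Proof. by rewrite /acomm scale1r. Qed.

Lemma acomm1P x y : acomm true x y <-> x * y = - (y * x).
Proof. by rewrite /acomm expr1 scaleN1r. Qed.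

Lemma acommC e x y : acomm e x y -> acomm e y x.
Proof. by rewrite /acomm => ->; rewrite scalerA -expr2 sqrr_sign scale1r. Qed.

End Acomm.

Section Frame.
Variables (R : realType) (l : 'cV[R]_7) (u1 u2 u3 : 'M[R]_(7, 2)).
Hypothesis dec : orthogonal_decomposition l u1 u2 u3.
Local Notation Cl := (clifford R 7).
Implicit Types (x y z : Cl) (v w : 'cV[R]_7).

(** The orthonormal basis l, e_1, ..., e_6 of R^7, numbered from 0 so that e_i
    is the vector of index i. The indices are natural numbers in order that
    products of basis vectors be described by closed lists; the default value
    0 occurs only for indices larger than 6. *)
Definition frame (i : nat) : 'cV[R]_7 :=
  nth 0 [:: l; col 0 u1; col 1 u1; col 0 u2; col 1 u2; col 0 u3; col 1 u3] i.

Lemma dec_gram :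
  [/\ l^T *m l = 1%:M, l^T *m u1 = 0, l^T *m u2 = 0 & l^T *m u3 = 0] /\
  [/\ u1^T *m u1 = 1%:M, u1^T *m u2 = 0 & u1^T *m u3 = 0] /\
  [/\ u2^T *m u2 = 1%:M, u2^T *m u3 = 0 & u3^T *m u3 = 1%:M].
Proof.
move: dec; rewrite /orthogonal_decomposition.
rewrite !tr_row_mx !mul_col_row !mul_mx_row !(scalar_mx_block 1 (2 + (2 + 2))).
rewrite !(scalar_mx_block 2 (2 + 2)) !(scalar_mx_block 2 2).
case/eq_block_mx => -> e1 _; rewrite -[X in row_mx X _]/(_ : 'M_(_, _)).
rewrite -!row_mx0 in e1; case/eq_row_mx: e1 => -> /eq_row_mx [-> ->].
case/eq_block_mx => -> e2 _; rewrite -!row_mx0 in e2.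
by case/eq_row_mx: e2 => -> ->; case/eq_block_mx => -> -> _ ->.
Qed.

Lemma col_mulmx m n p (A : 'M[R]_(m, n)) (B : 'M[R]_(n, p)) j :
  col j (A *m B) = A *m col j B.
Proof. by rewrite !colE mulmxA. Qed.

Lemma frame_gram i j : (i < 7)%N -> (j < 7)%N ->
  (frame i)^T *m frame j = (i == j)%:R%:M.
Proof.
have [[ll l1 l2 l3] [[g11 g12 g13] [g22 g23 g33]]] := dec_gram.
have cc (A B : 'M[R]_(7, 2)) M a b : A^T *m B = M -> (col a A)^T *m col b B = (M a b)%:M.
  by move=> <-; rewrite [LHS]mx11_scalar tr_col -col_mulmx -row_mul !mxE.
have lc (B : 'M[R]_(7, 2)) b : l^T *m B = 0 -> l^T *m col b B = 0.
  by move=> e; rewrite -col_mulmx e col0.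
have tr0 v w : v^T *m w = 0 -> w^T *m v = 0.
  by move=> e; rewrite -[LHS]trmxK trmx_mul trmxK e trmx0.
have tr m k (A : 'M[R]_(7, m)) (B : 'M[R]_(7, k)) : A^T *m B = 0 -> B^T *m A = 0.
  by move=> e; rewrite -[LHS]trmxK trmx_mul trmxK e trmx0.
by case: i => [|[|[|[|[|[|[|//]]]]]]] _; case: j => [|[|[|[|[|[|[|//]]]]]]] _;
  rewrite /frame /= ?ll ?(cc _ _ _ _ _ g11) ?(cc _ _ _ _ _ g12) ?(cc _ _ _ _ _ g13)
   ?(cc _ _ _ _ _ g22) ?(cc _ _ _ _ _ g23) ?(cc _ _ _ _ _ g33)
   ?(cc _ _ _ _ _ (tr _ _ _ _ g12)) ?(cc _ _ _ _ _ (tr _ _ _ _ g13))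
   ?(cc _ _ _ _ _ (tr _ _ _ _ g23)) ?lc ?(tr0 _ _ (lc _ _ _)) ?mxE ?raddf0 //.
Qed.

Lemma frame_unit i : (i < 7)%N -> unit_vec (frame i).
Proof. by move=> i7; rewrite /unit_vec frame_gram // eqxx. Qed.

Lemma frame_span v : v = \sum_(i < 7) ((frame i)^T *m v) 0 0 *: frame i.
Proof.
have PP := mulmx1C dec; move: PP.
rewrite !tr_row_mx !mul_row_col => PP.
rewrite -[LHS]mul1mx -PP !mulmxDl.
have part (A : 'M[R]_(7, 2)) : A *m A^T *m v
   = ((col 0 A)^T *m v) 0 0 *: col 0 A + ((col 1 A)^T *m v) 0 0 *: col 1 A.
  have key k : ((col k A)^T *m v) 0 0 = (A^T *m v) k 0.
    by rewrite tr_col -row_mul mxE.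
  rewrite -mulmxA; apply/matrixP => i j; rewrite ord1 !key.
  move: (A^T *m v) => w {key}; rewrite [LHS]mxE !big_ord_recl big_ord0 addr0 !mxE mulrC [X in _ + X]mulrC.
  by congr (_ * _ + _ * _); first [congr (w _ _)|congr (A _ _)]; apply: val_inj.
have partl : l *m l^T *m v = (l^T *m v) 0 0 *: l.
  by rewrite -mulmxA {1}[l^T *m v]mx11_scalar mul_mx_scalar.
rewrite !big_ord_recl big_ord0 /= addr0 partl !part.
by rewrite !addrA.
Qed.

Definition fvec i : Cl := cl_vec (frame i).

Lemma fvec_sqr i : (i < 7)%N -> fvec i * fvec i = 1.
Proof. by move=> i7; rewrite unit_vec_sqr //; apply: frame_unit. Qed.

Lemma fvec_acomm i j : (i < 7)%N -> (j < 7)%N -> acomm (i != j) (fvec i) (fvec j).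
Proof.
move=> i7 j7; case: eqVneq => [->|ij]; first by apply/acomm0P.
by apply/acomm1P/orth_anticomm; rewrite frame_gram // (negPf ij) raddf0.
Qed.

Definition mon (s : seq nat) : Cl := foldr (fun i x => fvec i * x) 1 s.

(** Whether two monomials anticommute. It computes on closed lists, which
    settles all the signs needed below. *)
Definition mon_sgn (s t : seq nat) : bool :=
  foldr (fun i e => foldr (fun j e' => (i != j) (+) e') false t (+) e) false s.

Lemma mon_acomm s t : all (fun i => i < 7)%N s -> all (fun i => i < 7)%N t ->
  acomm (mon_sgn s t) (mon s) (mon t).
Proof.
move=> + t7; elim: s => [|i s IH] /= => [_|/andP[i7 s7]]; first exact: acomm1l.
apply: acommMl (IH s7); elim: t t7 {IH} => [|j t IH] /= => [_|/andP[j7 t7]].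
  exact: acomm1r.
by apply: acommMr; [exact: fvec_acomm|exact: IH].
Qed.

Lemma mon1 i : mon [:: i] = fvec i. Proof. by rewrite /mon /= mulr1. Qed.
Lemma mon2 i j : mon [:: i; j] = fvec i * fvec j. Proof. by rewrite /mon /= mulr1. Qed.
Lemma mon_cat s t : mon (s ++ t) = mon s * mon t.
Proof. by elim: s => [|i s IH] /=; rewrite ?mul1r // IH mulrA. Qed.

Lemma fvec_commute_all z : (forall i, (i < 7)%N -> z * fvec i = fvec i * z) ->
  forall v, z * cl_vec v = cl_vec v * z.
Proof.
move=> cz v; rewrite (frame_span v) linear_sum mulr_suml mulr_sumr.
by apply: eq_bigr => i _; rewrite linearZ /= -scalerAl -scalerAr cz.
Qed.

Local Notation E := (even_clifford l).

Lemma even0 : E 0.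
Proof. by have := even_lin (-1) (even_one l) (even_one l); rewrite scaleN1r addNr. Qed.
Lemma evenZ a x : E x -> E (a *: x).
Proof. by move=> Ex; rewrite -[_ *: _]addr0; apply: even_lin => //; apply: even0. Qed.
Lemma evenD x y : E x -> E y -> E (x + y).
Proof. by move=> Ex Ey; rewrite -[x]scale1r; apply: even_lin. Qed.
Lemma evenN x : E x -> E (- x). Proof. by rewrite -scaleN1r; apply: evenZ. Qed.
Lemma evenB x y : E x -> E y -> E (x - y).
Proof. by move=> Ex Ey; apply: evenD => //; apply: evenN. Qed.

Lemma l_unit : unit_vec l. Proof. by have := frame_unit (isT : (0 < 7)%N). Qed.

Lemma l_frame i : (0 < i < 7)%N -> l^T *m frame i = 0.
Proof.
case/andP => i0 i7; have := frame_gram (isT : (0 < 7)%N) i7.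
by rewrite eq_sym (gtn_eqF i0) raddf0.
Qed.

Lemma even_fvec2 i j : (0 < i < 7)%N -> (0 < j < 7)%N -> E (fvec i * fvec j).
Proof. by move=> hi hj; apply: even_vec2; apply: l_frame. Qed.

Lemma even_comm_l x : E x -> x * cl_vec l = cl_vec l * x.
Proof.
elim=> [|v w lv lw|x' y' _ IHx _ IHy|a x' y' _ IHx _ IHy].
- by rewrite mulr1 mul1r.
- have h u : l^T *m u = 0 -> acomm true (cl_vec u) (cl_vec l).
    by move=> lu; apply/acommC/acomm1P/orth_anticomm.
  by apply/acomm0P; apply: (acommMl (h _ lv) (h _ lw)).
- by rewrite -mulrA IHy mulrA IHx mulrA.
- by rewrite mulrDl mulrDr -scalerAl -scalerAr IHx IHy.
Qed.

Lemma even_parity x : E x -> has_parity false x.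
Proof.
elim=> [|v w _ _|x' y' _ IHx _ IHy|a x' y' _ IHx _ IHy].
- exact: parity1.
- by apply: (@parityM _ _ true true); apply: parity_vec.
- exact: (@parityM _ _ false false).
- exact: parityD.
Qed.

Lemma even_central_scalar_frame z : E z -> (forall i, (i < 7)%N -> z * fvec i = fvec i * z) ->
  z = (z finset.set0)%:A.
Proof.
move=> Ez cz; apply: central_even_scalar; last exact: fvec_commute_all.
by move=> A oA; apply: (even_parity Ez); rewrite oA.
Qed.

(** Conjugation by v maps the vectors orthogonal to l to such vectors, and it
    is an algebra automorphism. *)
Lemma even_conj_vec v z : unit_vec v -> l^T *m v = 0 -> E z ->
  E (cl_vec v * z * cl_vec v).
Proof.
move=> uv lv; elim=> [|u w lu lw|x' y' _ IHx _ IHy|a x' y' _ IHx _ IHy].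
- by rewrite mulr1 unit_vec_sqr //; apply: even_one.
- rewrite (mulrA (cl_vec v)) unit_vec_conj // -mulrA -mulrA.
  rewrite (mulrA (cl_vec v)) unit_vec_conj // -mulrA unit_vec_sqr // mulr1.
  have lh t : l^T *m t = 0 -> l^T *m (half_turn v *m t) = 0.
    move=> lt; rewrite /half_turn mulmxBl mul1mx mulmxBr lt subr0.
    by rewrite -scalemxAl -scalemxAr !mulmxA lv !mul0mx scaler0.
  by apply: even_vec2; apply: lh.
- have -> : cl_vec v * (x' * y') * cl_vec v
    = (cl_vec v * x' * cl_vec v) * (cl_vec v * y' * cl_vec v).
    rewrite -!mulrA; congr (_ * (_ * _)); rewrite [cl_vec v * (cl_vec v * _)]mulrA.
    by rewrite unit_vec_sqr // mul1r.
  exact: even_mul.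
- have -> : cl_vec v * (a *: x' + y') * cl_vec v
    = a *: (cl_vec v * x' * cl_vec v) + cl_vec v * y' * cl_vec v.
    by rewrite mulrDr mulrDl -scalerAr -scalerAl.
  exact: even_lin.
Qed.

Lemma even_conj_fvec i z : (0 < i < 7)%N -> E z -> E (fvec i * z * fvec i).
Proof.
move=> i7; apply: even_conj_vec; last exact: l_frame.
by apply: frame_unit; case/andP: i7.
Qed.

(** Any product of an even number of vectors is y + z e_1 l with y and z even
    in F, since l can be moved to the right. Commuting with l, which
    anticommutes with e_1 l, forces z = 0. *)
Lemma spin_comm_l_even x : spin x -> x * cl_vec l = cl_vec l * x -> E x.
Proof.
pose f := fvec 1; pose c := fvec 1 * fvec 0.
have ff : f * f = 1 by apply: fvec_sqr.
have fl : fvec 0 * f = - (f * fvec 0).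
  by apply/acomm1P; apply: (fvec_acomm (isT : (0 < 7)%N) (isT : (1 < 7)%N)).
have ll : fvec 0 * fvec 0 = 1 by apply: fvec_sqr.
have cz z : E z -> c * z = (f * z * f) * c.
  move=> Ez; rewrite /c -/f -!mulrA [f * (f * _)]mulrA ff mul1r.
  by congr (_ * _); rewrite (even_comm_l Ez).
have cc : c * c = -1.
  by rewrite /c -/f mulrA -(mulrA f) fl mulrN mulNr mulrA ff mul1r ll.
(* S will be seen to contain every product of an even number of vectors. *)
pose S x := exists y z, [/\ E y, E z & x = y + z * c].
have SM x1 x2 : S x1 -> S x2 -> S (x1 * x2).
  move=> [y [z [Ey Ez ->]]] [y' [z' [Ey' Ez' ->]]].
  exists (y * y' - z * (f * z' * f)), (y * z' + z * (f * y' * f)); split.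
  - by apply: evenB; apply: even_mul => //; apply: even_conj_fvec.
  - by apply: evenD; apply: even_mul => //; apply: even_conj_fvec.
  have e1 : z * c * y' = z * (f * y' * f) * c by rewrite -(mulrA z) cz // mulrA.
  have e2 : z * c * (z' * c) = - (z * (f * z' * f)).
    by rewrite -(mulrA z) (mulrA c) cz // -(mulrA _ c c) cc mulrN1 mulrN.
  rewrite !mulrDl !mulrDr e1 e2 [y * (z' * c)]mulrA -!addrA; congr (_ + _).
  by rewrite addrA addrC.
have SE y : E y -> S y.
  by move=> Ey; exists y, 0; rewrite mul0r addr0; split=> //; apply: even0.
have Sf v : S (f * cl_vec v) /\ S (cl_vec v * f).
  have [v0 [a [lv0 ->]]] : exists v0 a, l^T *m v0 = 0 /\ v = v0 + a *: l.
    exists (v - (l^T *m v) 0 0 *: l), ((l^T *m v) 0 0); split; last by rewrite subrK.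
    by rewrite mulmxBr -scalemxAr l_unit {1}[l^T *m v]mx11_scalar scalemx1 subrr.
  have l1 : l^T *m frame 1 = 0 by apply: l_frame.
  rewrite linearD linearZ /= mulrDl mulrDr -scalerAl -scalerAr.
  rewrite -[cl_vec l]/(fvec 0) fl -[f * fvec 0]/c.
  split.
    by exists (f * cl_vec v0), a%:A; rewrite mulr_algl; split=> //;
      [apply: even_vec2|apply: evenZ; exact: even_one].
  exists (cl_vec v0 * f), (- a)%:A; split;
    [exact: even_vec2|apply: evenZ; exact: even_one|by rewrite mulr_algl scaleNr scalerN].
(* A product of an odd number of vectors enters S after multiplication by e_1.
   *)
have Sprod s : S ((if odd (size s) then f else 1) * \prod_(v <- s) cl_vec v).
  elim: s => [|v s IH] /=; first by rewrite big_nil mul1r; apply: SE; exact: even_one.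
  rewrite big_cons mulrA; case: (odd _) IH => /= IH.
    have -> : 1 * cl_vec v * \prod_(j <- s) cl_vec j
            = (cl_vec v * f) * (f * \prod_(j <- s) cl_vec j).
      by rewrite mul1r -!mulrA [f * (f * _)]mulrA ff mul1r.
    by apply: SM => //; have [] := Sf v.
  by rewrite mul1r in IH; apply: SM => //; have [] := Sf v.
move=> [s [es _ xE]] xl.
have := Sprod s; rewrite (negPf es) mul1r -xE => -[y [z [Ey Ez xyz]]].
move: xl; rewrite xyz mulrDl mulrDr (even_comm_l Ey) => /addrI.
rewrite -[cl_vec l]/(fvec 0) -!mulrA ll mulr1 -/f.
have -> : fvec 0 * (z * (f * fvec 0)) = - (z * f).
  rewrite !mulrA -[fvec 0]/(cl_vec l) -(even_comm_l Ez) -[cl_vec l]/(fvec 0).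
  by rewrite -(mulrA z) fl mulrN mulNr -!mulrA ll mulr1.
move=> zf; suff z0 : z = 0 by rewrite z0 mul0r addr0.
have : (z * f) *+ 2 = 0 by rewrite mulr2n {1}zf addNr.
rewrite -scaler_nat => /eqP; rewrite scaler_eq0 pnatr_eq0 /= => /eqP zf0.
by rewrite -[z]mulr1 -ff mulrA zf0 mul0r.
Qed.

Definition omega : Cl := mon [:: 1; 2; 3; 4; 5; 6]%N.
Definition J1 : Cl := mon [:: 1; 2]%N.
Definition J2 : Cl := mon [:: 3; 4]%N.
Definition J3 : Cl := mon [:: 5; 6]%N.

Lemma omegaE : omega = J1 * J2 * J3.
Proof. by rewrite /J1 /J2 /J3 -!mon_cat. Qed.

Lemma mon2_sqr i j : (i < 7)%N -> (j < 7)%N -> i != j ->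
  mon [:: i; j] * mon [:: i; j] = -1.
Proof.
move=> i7 j7 ij; rewrite !mon2.
have := fvec_acomm j7 i7; rewrite eq_sym ij => /acomm1P ji.
by rewrite mulrA -(mulrA (fvec i)) ji mulrN mulrA fvec_sqr // mul1r mulNr fvec_sqr.
Qed.

Lemma even_mon2 i j : (0 < i < 7)%N -> (0 < j < 7)%N -> E (mon [:: i; j]).
Proof. by move=> hi hj; rewrite mon2; apply: even_fvec2. Qed.

Lemma even_J1 : E J1. Proof. exact: even_mon2. Qed.
Lemma even_J2 : E J2. Proof. exact: even_mon2. Qed.
Lemma even_J3 : E J3. Proof. exact: even_mon2. Qed.
Lemma even_omega : E omega.
Proof. by rewrite omegaE; apply: even_mul even_J3; apply: even_mul even_J1 even_J2. Qed.

Lemma mon_comm0 s t : all (fun i => i < 7)%N s -> all (fun i => i < 7)%N t ->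
  mon_sgn s t = false -> mon s * mon t = mon t * mon s.
Proof. by move=> hs ht e; apply/acomm0P; rewrite -e; apply: mon_acomm. Qed.

Lemma mon_comm1 s t : all (fun i => i < 7)%N s -> all (fun i => i < 7)%N t ->
  mon_sgn s t = true -> mon s * mon t = - (mon t * mon s).
Proof. by move=> hs ht e; apply/acomm1P; rewrite -e; apply: mon_acomm. Qed.

Lemma J12_comm : J1 * J2 = J2 * J1. Proof. exact: mon_comm0. Qed.

Lemma J12_sqr : (J1 * J2) * (J1 * J2) = 1.
Proof.
rewrite {1}J12_comm mulrA -(mulrA J2) mon2_sqr // mulrN1 mulNr.
by rewrite mon2_sqr // opprK.
Qed.

Lemma omega_sqr : omega * omega = -1.
Proof.
have c : J1 * J2 * J3 = J3 * (J1 * J2).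
  by rewrite -[J1 * J2]/(mon [:: 1; 2]%N * mon [:: 3; 4]%N) -mon_cat; apply: mon_comm0.
by rewrite omegaE {2}c -mulrA (mulrA J3) mon2_sqr // mulN1r mulrN J12_sqr.
Qed.

Lemma omega_anti i : (0 < i < 7)%N -> omega * fvec i = - (fvec i * omega).
Proof.
move=> hi; rewrite -mon1; apply: mon_comm1 => //=.
  by case/andP: hi => _ ->.
by case: i hi => [|[|[|[|[|[|[|]]]]]]].
Qed.

(** omega anticommutes with each e_i, hence commutes with products of two
    vectors of F. *)
Lemma omega_comm_even x : E x -> omega * x = x * omega.
Proof.
have av v : l^T *m v = 0 -> acomm true omega (cl_vec v).
  move=> lv; rewrite (frame_span v) linear_sum; apply/acomm1P.
  rewrite mulr_suml mulr_sumr -sumrN; apply: eq_bigr => i _.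
  rewrite linearZ /= -scalerAl -scalerAr -scalerN.
  case: i => [[|i] i7] /=; last by rewrite -[cl_vec _]/(fvec i.+1) omega_anti.
  by rewrite -[frame 0]/l lv mxE !scale0r.
elim=> [|v w lv lw|x' y' _ IHx _ IHy|a x' y' _ IHx _ IHy].
- by rewrite mulr1 mul1r.
- by apply/acomm0P; apply: (acommMr (av _ lv) (av _ lw)).
- by rewrite mulrA IHx -mulrA IHy mulrA.
- by rewrite mulrDl mulrDr -scalerAl -scalerAr IHx IHy.
Qed.

Lemma scalar_part_anti0 i x : (i < 7)%N -> x * fvec i = - (fvec i * x) -> x finset.set0 = 0.
Proof.
move=> i7 ac; have : x finset.set0 = - x finset.set0.
  rewrite -{1}[x]mulr1 -(fvec_sqr i7) mulrA ac mulNr [LHS]ffunE -scalar_part_mulC mulrA fvec_sqr //.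
  by rewrite mul1r.
by move=> e; lra.
Qed.

(** The elements e_i e_(i+1) generate the even algebra, and any two of them
    commute or anticommute. *)
Definition fpair i : Cl := mon [:: i; i.+1].

Lemma fpair_acomm i j : (i < 6)%N -> (j < 6)%N -> exists e, acomm e (fpair i) (fpair j).
Proof.
by move=> hi hj; eexists; apply: mon_acomm; rewrite /= ?andbT !ltnS ?hi ?hj ?(ltnW hi) ?(ltnW hj).
Qed.

(** If z commutes with all e_i e_(i+1), then e_i z e_i does not depend on i.
    Calling it z', the element z + z' commutes with every e_i, and z - z'
    anticommutes with every e_i, so that omega (z - z') commutes with every
    e_i; both are therefore scalars. *)
Lemma even_center z : E z -> (forall i, (0 < i < 6)%N -> z * fpair i = fpair i * z) ->
  exists t, z = (z finset.set0)%:A + t *: omega.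
Proof.
move=> Ez cz.
have Bq y i : (0 < i < 6)%N -> y * fpair i = fpair i * y ->
    fvec i.+1 * y * fvec i.+1 = fvec i * y * fvec i.
  case/andP=> i0 i6; rewrite /fpair mon2 => e.
  have := congr1 (fun t => fvec i * t * fvec i.+1) e.
  have i7 : (i < 7)%N by apply: leqW.
  rewrite -[fvec i * (fvec i * _ * y) * _]mulrA !mulrA fvec_sqr // mul1r => <-.
  by rewrite -!mulrA fvec_sqr // mulr1.
pose zt := fvec 1 * z * fvec 1.
have czt i : (0 < i < 6)%N -> zt * fpair i = fpair i * zt.
  move=> hi; have hi6 : (i < 6)%N by case/andP: hi.
  have q7 : all (fun j => j < 7)%N [:: i; i.+1] by rewrite /= andbT (leqW hi6).
  have := mon_acomm (isT : all (fun j => j < 7)%N [:: 1%N]) q7.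
  rewrite mon1 -/(fpair i); move: (mon_sgn _ _) => e ae.
  apply/acomm0P; have -> : false = e (+) false (+) e by case: (e).
  by apply: (acommMl (acommMl ae _) ae); apply/acomm0P/cz.
have allB y : (forall i, (0 < i < 6)%N -> y * fpair i = fpair i * y) ->
    forall i, (0 < i < 7)%N -> fvec i * y * fvec i = fvec 1 * y * fvec 1.
  move=> cy; elim=> // -[//|i] IH hi; rewrite Bq ?cy //; apply: IH.
  by case/andP: hi => _ h; rewrite (ltn_trans _ h).
have E1 : E zt by apply: even_conj_fvec.
have ztt i : (0 < i < 7)%N -> fvec i * zt * fvec i = z.
  move=> hi; rewrite (allB _ czt) // /zt !mulrA fvec_sqr // mul1r -mulrA fvec_sqr //.
  by rewrite mulr1.
have zti i : (0 < i < 7)%N -> fvec i * z * fvec i = zt by move=> hi; rewrite (allB _ cz).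
have cb i : (0 < i < 7)%N -> z * fvec i = fvec i * zt /\ zt * fvec i = fvec i * z.
  move=> hi; have i7 : (i < 7)%N by case/andP: hi.
  split; first by rewrite -(zti i hi) !mulrA fvec_sqr // mul1r.
  by rewrite -[in RHS](ztt i hi) !mulrA fvec_sqr // mul1r.
pose zp := 2^-1 *: (z + zt); pose zm := 2^-1 *: (z - zt).
have zE : z = zp + zm.
  rewrite -scalerDr addrACA subrr addr0 -mulr2n -scaler_nat scalerA mulVf ?scale1r //.
  by rewrite pnatr_eq0.
have Ezp : E zp by apply: evenZ; apply: evenD. have Ezm : E zm by apply: evenZ; apply: evenB.
have czp : zp = (zp finset.set0)%:A.
  apply: even_central_scalar_frame => // -[|i] i7; first exact: even_comm_l.
  have [e1 e2] := cb i.+1 i7.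
  by rewrite -scalerAl -scalerAr mulrDl mulrDr e1 e2 addrC.
have [a czm] : exists a, omega * zm = a%:A.
  exists ((omega * zm) finset.set0).
  apply: even_central_scalar_frame => [|[|i] i7]; first exact: even_mul even_omega Ezm.
    by apply: even_comm_l; apply: even_mul even_omega Ezm.
  have [e1 e2] := cb i.+1 i7.
  have e : zm * fvec i.+1 = - (fvec i.+1 * zm).
    by rewrite -scalerAl -scalerAr -scalerN mulrBl mulrBr e1 e2 opprB.
  rewrite -mulrA e mulrN [omega * (fvec _ * zm)]mulrA omega_anti //.
  by rewrite mulNr opprK mulrA.
have zmE : zm = - a *: omega.
  have : omega * (omega * zm) = - zm by rewrite mulrA omega_sqr mulN1r.
  by rewrite czm mulr_algr scaleNr => ->; rewrite opprK.
exists (- a).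
have o0 : omega finset.set0 = 0 by apply: (@scalar_part_anti0 1) => //; apply: omega_anti.
have -> : z finset.set0 = zp finset.set0.
  transitivity ((zp + zm) finset.set0); first by rewrite -zE.
  by rewrite zmE [LHS]ffunE [X in _ + X]ffunE o0 scaler0 addr0.
by rewrite -czp -zmE.
Qed.

End Frame.

(** * The half-spin representation and the action on F *)

Section HalfSpin.
Local Open Scope complex_scope.
Variables (R : realType) (l : 'cV[R]_7) (u1 u2 u3 : 'M[R]_(7, 2)).
Variable (sigma : clifford R 7 -> 'M[R[i]]_(2 + 2)).
Hypothesis dec : orthogonal_decomposition l u1 u2 u3.
Hypothesis hs : half_spin l sigma.
Local Notation C := R[i].
Local Notation Cl := (clifford R 7).
Local Notation E := (even_clifford l).
Local Notation fvec := (fvec l u1 u2 u3).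
Local Notation mon := (mon l u1 u2 u3).
Local Notation fpair := (fpair l u1 u2 u3).
Local Notation omega := (omega l u1 u2 u3).
Local Notation J1 := (J1 l u1 u2 u3).
Local Notation J2 := (J2 l u1 u2 u3).
Local Notation J3 := (J3 l u1 u2 u3).
Implicit Types (x y z : Cl) (v w : 'cV[R]_7).

Lemma sigma1 : sigma 1 = 1%:M. Proof. by case: hs. Qed.
Lemma sigmaM x y : E x -> E y -> sigma (x * y) = sigma x *m sigma y.
Proof. by case: hs => _ + _; apply. Qed.
Lemma sigma_lin a x y : E x -> E y -> sigma (a *: x + y) = a%:C *: sigma x + sigma y.
Proof. by case: hs => _ _; apply. Qed.
Lemma sigma0 : sigma 0 = 0.
Proof.
have := sigma_lin (-1) (even_one l) (even_one l).
by rewrite !scaleN1r addNr => ->; rewrite rmorphN1 scaleN1r addNr.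
Qed.
Lemma sigmaZ a x : E x -> sigma (a *: x) = a%:C *: sigma x.
Proof. by move=> Ex; have := sigma_lin a Ex (even0 l); rewrite sigma0 !addr0. Qed.
Lemma sigmaD x y : E x -> E y -> sigma (x + y) = sigma x + sigma y.
Proof. by move=> Ex Ey; have := sigma_lin 1 Ex Ey; rewrite !scale1r. Qed.
Lemma sigmaN x : E x -> sigma (- x) = - sigma x.
Proof. by move=> Ex; rewrite -scaleN1r sigmaZ // rmorphN1 scaleN1r. Qed.

Lemma fpair_sqr i : (i < 6)%N -> fpair i * fpair i = -1.
Proof. by move=> i6; apply: mon2_sqr; rewrite ?(leqW i6) // neq_ltn ltnSn. Qed.

Lemma even_fpair i : (0 < i < 6)%N -> E (fpair i).
Proof.
move=> /andP[i0 i6]; apply: even_mon2 => //=; first by rewrite i0 (leqW i6).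
Qed.

(** The trace is cyclic and p^2 = -1. *)
Lemma tr_conj_sqrN1 p x : E p -> E x -> p * p = -1 ->
  \tr (sigma (p * x * p)) = - \tr (sigma x).
Proof.
move=> Ep Ex pp; rewrite (sigmaM (even_mul Ep Ex) Ep) (sigmaM Ep Ex) mxtrace_mulC mulmxA -(sigmaM Ep Ep).
by rewrite pp (sigmaN (even_one l)) sigma1 mulNmx mul1mx linearN.
Qed.

Lemma tr_anti0 p x : E p -> E x -> p * p = -1 -> p * x = - (x * p) ->
  \tr (sigma x) = 0.
Proof.
move=> Ep Ex pp px; have := tr_conj_sqrN1 Ep Ex pp.
rewrite px mulNr -mulrA pp mulrN1 opprK => /eqP.
by rewrite -addr_eq0 -mulr2n mulrn_eq0 /= => /eqP.
Qed.

(** Since (e_i e_(i+1))^2 = -1, this is half the sum of y and of its conjugate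
    by e_i e_(i+1): the projection onto the commutant of that element. *)
Definition avg i y : Cl := 2^-1 *: (y - fpair i * y * fpair i).

Lemma even_avg i y : (0 < i < 6)%N -> E y -> E (avg i y).
Proof.
move=> hi Ey; apply: evenZ; apply: evenB => //; apply: even_mul (even_fpair hi).
exact: even_mul (even_fpair hi) Ey.
Qed.

Lemma avg_comm i y : (i < 6)%N -> avg i y * fpair i = fpair i * avg i y.
Proof.
move=> hi; rewrite /avg -scalerAl -scalerAr mulrBl mulrBr; congr (_ *: _).
have := fpair_sqr hi; move: (fpair i) => p pp.
have -> : p * y * p * p = - (p * y) by rewrite -(mulrA _ p p) pp mulrN1.
have -> : p * (p * y * p) = - (y * p) by rewrite !mulrA pp mulN1r mulNr.
by rewrite !opprK addrC.
Qed.

(** e_i e_(i+1) and e_j e_(j+1) commute up to sign, so averaging over the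
    former preserves the commutant of the latter. *)
Lemma avg_comm_keep i j y : (i < 6)%N -> (j < 6)%N -> y * fpair j = fpair j * y ->
  avg i y * fpair j = fpair j * avg i y.
Proof.
move=> hi hj yj; have [e ae] := fpair_acomm dec hi hj.
have c : acomm (e (+) false (+) e) (fpair i * y * fpair i) (fpair j).
  by apply: (acommMl (acommMl ae _) ae); apply/acomm0P.
have {}c : fpair i * y * fpair i * fpair j = fpair j * (fpair i * y * fpair i).
  by apply/acomm0P; move: c; case: (e).
by rewrite /avg -scalerAl -scalerAr mulrBl mulrBr yj c.
Qed.

Lemma avg_scalar_part i y : (i < 6)%N -> (avg i y) finset.set0 = y finset.set0.
Proof.
move=> hi; have qyq : (fpair i * y * fpair i) finset.set0 = - y finset.set0.
  by rewrite scalar_part_mulC mulrA fpair_sqr // mulN1r [LHS]ffunE.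
rewrite /avg; move: (fpair i * y * fpair i) qyq => z zE.
by rewrite !ffunE zE /GRing.scale /= opprK; field.
Qed.

Lemma avg_omega i y : (0 < i < 6)%N -> omega * avg i y = avg i (omega * y).
Proof.
move=> hi; rewrite /avg; have := omega_comm_even dec (even_fpair hi).
by move: omega (fpair i) => o p op; rewrite -scalerAr mulrBr !mulrA op.
Qed.

Lemma avg_tr i y : (0 < i < 6)%N -> E y -> \tr (sigma (avg i y)) = \tr (sigma y).
Proof.
move=> hi Ey; have Eq := even_fpair hi; have hi6 : (i < 6)%N by case/andP: hi.
have EQ : E (fpair i * y * fpair i) := even_mul (even_mul Eq Ey) Eq.
rewrite sigmaZ; last exact: evenB.
rewrite sigmaD //; last exact: evenN.
rewrite sigmaN // mxtraceZ linearB /= tr_conj_sqrN1 ?fpair_sqr // opprK.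
by rewrite fmorphV rmorph_nat; field.
Qed.

Lemma foldr_avg y s : E y -> all (fun i => 0 < i < 6)%N s ->
  E (foldr avg y s) /\ \tr (sigma (foldr avg y s)) = \tr (sigma y).
Proof.
move=> Ey; elim: s => [//|i s IH] /= /andP[hi /IH [Ez tz]].
by split; [exact: even_avg|rewrite avg_tr].
Qed.

(** Averaging successively over e_1 e_2, ..., e_5 e_6 changes neither the
    trace nor the scalar coefficients of y and omega y, and the result is
    central, that is a combination of 1 and omega. *)
Lemma trace_formula y : E y -> \tr (sigma y) =
  4 * (y finset.set0)%:C - ((omega * y) finset.set0)%:C * \tr (sigma omega).
Proof.
move=> Ey; pose z := foldr avg y [:: 5; 4; 3; 2; 1]%N.
have [Ez tz] : E z /\ \tr (sigma z) = \tr (sigma y) by apply: foldr_avg.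
have cz i : (0 < i < 6)%N -> z * fpair i = fpair i * z.
  case: i => [|[|[|[|[|[|i]]]]]] // _; rewrite /z /=;
  do ?[by apply: avg_comm|apply: avg_comm_keep => //].
have [t zE] := even_center dec Ez cz.
have sz : z finset.set0 = y finset.set0 by rewrite /z /= !avg_scalar_part.
have oz : (omega * z) finset.set0 = (omega * y) finset.set0.
  by rewrite /z /= !avg_omega // !avg_scalar_part.
have tE : (omega * y) finset.set0 = - t.
  rewrite -oz zE mulrDr mulr_algr -scalerAr omega_sqr // [LHS]ffunE [X in X + _]ffunE.
  have -> : omega finset.set0 = 0.
    by apply: (@scalar_part_anti0 _ _ _ _ _ dec 1) => //; apply: omega_anti.
  by rewrite scaler0 add0r !ffunE eqxx /GRing.scale /= mulrN1.
rewrite -tz zE sz tE sigmaD ?sigmaZ ?sigma1 //; [|exact: even_one|exact: even_omega|apply: evenZ; exact: even_one|apply: evenZ; exact: even_omega].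
by rewrite mxtraceD !mxtraceZ mxtrace1 natrD rmorphN /=; ring.
Qed.

Variable rho : 'M[R[i]]_2 * 'M[R[i]]_2 -> Cl.
Hypothesis emb : block_embedding l (basisF u1 u2 u3) sigma rho.
Hypothesis tor : torus_adapted rho u1 u2 u3.
Local Notation frame := (frame l u1 u2 u3).

(** x acts on l by a scalar, which is 1 because x has determinant 1 on R^7 and
    on F. *)
Lemma groupN0_comm_l x : groupN0 l (basisF u1 u2 u3) x ->
  spin x /\ x * cl_vec l = cl_vec l * x.
Proof.
move=> [[sx [c xl]] dF]; split=> //; have [oX dX cX] := spin_piP sx.
suff c1 : c = 1 by rewrite cX xl c1 scale1r.
have [[ll l1 l2 l3] _] := dec_gram dec.
pose uF := basisF u1 u2 u3; pose P : 'M[R]_7 := row_mx l uF.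
have dP : \det P^T * \det P = 1 by rewrite -det_mulmx dec det1.
have : \det ((row_mx l uF)^T *m spin_pi x *m row_mx l uF) = 1.
  change (\det (P^T *m spin_pi x *m P) = 1).
  by rewrite !det_mulmx dX mulr1 dP.
rewrite tr_row_mx mul_col_mx mul_col_row -[l^T *m _ *m l]mulmxA xl.
rewrite -[uF^T *m _ *m l]mulmxA xl -!scalemxAr ll.
have -> : uF^T *m l = 0.
  rewrite -[LHS]trmxK trmx_mul trmxK /uF /basisF !mul_mx_row l1 l2 l3 !row_mx0.
  by rewrite trmx0.
rewrite scaler0 det_ublock det_mx11 -[\det (_ *m uF)]/(detF uF x) dF mulr1.
by rewrite !mxE mulr1.
Qed.

Lemma spinE_inv x : spin x -> x * cl_vec l = cl_vec l * x ->
  x^-1 * cl_vec l = cl_vec l * x^-1.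
Proof.
move=> /spin_unit ux xl; apply: (mulrI ux); rewrite mulVKr // mulrA xl.
by rewrite -mulrA mulrV // mulr1.
Qed.

Lemma rhoP g : calG g -> [/\ spin (rho g), E (rho g)
  & sigma (rho g) = block_mx g.1 0 0 g.2].
Proof.
move=> Gg; have [N0g ->] := emb Gg.
by have [sx xl] := groupN0_comm_l N0g; split=> //; apply: (spin_comm_l_even dec).
Qed.

Definition rotJ : 'M[C]_2 := mx2 0 (-1) 1 0.
Definition diagJ (k k' : C) : 'M[C]_(2 + 2) := block_mx (k *: rotJ) 0 0 (k' *: rotJ).

Lemma torusG_pairG (a a' : 'M[R]_2) : torusG a a' = pairG a a' 1 1.
Proof. by rewrite /torusG /pairG !scale1r. Qed.

Lemma torusG_calG (a a' : 'M[R]_2) :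
  special_orthogonal_group a -> special_orthogonal_group a' -> calG (torusG a a').
Proof.
move=> [oa da] [oa' da']; rewrite torusG_pairG.
have [|//] := @calG_dataP _ a a' 1 1; split=> //; by rewrite ?da ?da' expr1n rmorph1.
Qed.

(** x J commutes with all vectors, so it is a scalar. *)
Lemma torus_scalar (x J : Cl) : spin x -> E x -> E J -> J * J = -1 ->
  (forall i, (i < 7)%N -> exists e, acomm e x (fvec i) /\ acomm e J (fvec i)) ->
  exists c : R, x = c *: J.
Proof.
move=> sx Ex EJ JJ xJ; have EE := even_mul Ex EJ.
have : x * J = ((x * J) finset.set0)%:A.
  apply: (even_central_scalar_frame dec EE) => i i7; have [e [xb Jb]] := xJ i i7.
  apply/acomm0P; have -> : false = e (+) e by case: (e).
  exact: acommMl.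
set c := _ finset.set0 => xJc; exists (- c).
have := congr1 (fun t => t * J) xJc.
by rewrite /= -mulrA JJ mulrN1 mulr_algl scaleNr => <-; rewrite opprK.
Qed.

Lemma N1_neq1 : (-1 : R) <> 1.
Proof. by move=> h; lra. Qed.

(** A rotation whose square is a scalar at most 0 is a quarter turn. *)
Lemma sqr_rotation_neg (a : 'M[R]_2) (c : R) : special_orthogonal_group a ->
  a *m a = - (c ^+ 2)%:M -> c ^+ 2 = 1 /\ exists2 k, k ^+ 2 = 1 & cmx a = k%:C *: rotJ.
Proof.
move=> [oa da]; have [x [y [e [[-> _]|[_ d]]]]] := orth2P oa; last first.
  by case: N1_neq1; rewrite -d.
rewrite /rot !mx2E => /mx2_inj [e1 _ e2 _].
have x0 : x = 0.
  have /eqP : x * y = 0 by lra.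
  rewrite mulf_eq0 => /orP[/eqP //|/eqP y0].
  have := sqr_ge0 c; move: e1 e; rewrite y0 !expr2 => h1 h2 h3; nra.
have y1 : y ^+ 2 = 1 by rewrite -e x0 expr0n add0r.
split; first by move: e1 y1; rewrite x0 expr2 => h1 h2; lra.
exists y => //; rewrite x0 cmx_mx2 /rotJ !mx2E rmorph0 rmorphN /=.
by congr mx2; ring.
Qed.

(** The element of the torus acting by -1 on one of the planes and by 1 on the
    other is a multiple of the bivector J of that plane. Its square is a
    negative scalar, so each of its two blocks is a quarter turn. *)
Lemma sigma_J_of_torus (x J : Cl) (a a' : 'M[R]_2) : E x -> E J -> J * J = -1 ->
  special_orthogonal_group a -> special_orthogonal_group a' ->
  sigma x = block_mx (cmx a) 0 0 (cmx a') -> (exists c : R, x = c *: J) ->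
  exists k k', [/\ k ^+ 2 = 1, k' ^+ 2 = 1 & sigma J = diagJ k%:C k'%:C].
Proof.
move=> Ex EJ JJ sa sa' sx [c xJ].
have xx : x * x = (- c ^+ 2)%:A.
  by rewrite xJ -scalerAl -scalerAr JJ scalerA scalerN scaleNr expr2.
have := sigmaM Ex Ex; rewrite xx sigmaZ ?sigma1; last exact: even_one.
rewrite sx mulmx_block !mulmx0 !mul0mx !addr0 !add0r scalemx1 (scalar_mx_block 2 2).
case/eq_block_mx => h _ _ h'.
have back (d : 'M[R]_2) : ((- c ^+ 2)%:C)%:M = cmx d *m cmx d -> d *m d = - (c ^+ 2)%:M.
  rewrite -cmxM => hd; apply: (@map_mx_inj _ _ (real_complex R)).
  by rewrite -[LHS]hd -raddfN /= map_scalar_mx.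
have [c1 [k k1 kE]] := sqr_rotation_neg sa (back _ h).
have [_ [k' k1' kE']] := sqr_rotation_neg sa' (back _ h').
exists (c * k), (c * k'); rewrite !exprMn c1 k1 k1' mulr1; split=> //.
have -> : J = c *: x by rewrite xJ scalerA -expr2 c1 scale1r.
rewrite sigmaZ // sx kE kE' scale_block_mx !scaler0 !scalerA.
by rewrite /diagJ -!rmorphM.
Qed.

Lemma SO2_N1 : @special_orthogonal_group R 2 (- 1%:M).
Proof.
split; first by rewrite mulmxN [in (- _)^T]linearN /= trmx1 mulNmx opprK mulmx1.
by rewrite !mx2E; ring.
Qed.

Lemma SO2_1 : @special_orthogonal_group R 2 1%:M.
Proof. by split; rewrite ?det1 // trmx1 mulmx1. Qed.

(** The list of signs follows the order of the frame: l, F_1, F_2, F_3. *)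
Lemma torus_acomm a a' (e1 e2 : bool) :
    special_orthogonal_group a -> special_orthogonal_group a' ->
    spin_pi (rho (torusG a a')) *m u1 = u1 *m (if e1 then - 1%:M else 1%:M) ->
    spin_pi (rho (torusG a a')) *m u2 = u2 *m (if e2 then - 1%:M else 1%:M) ->
  forall i, (i < 7)%N -> acomm (nth false [:: false; e1; e1; e2; e2; false; false] i)
     (rho (torusG a a')) (fvec i).
Proof.
move=> sa sa'; set x := rho _ => x1 x2.
have Gx := torusG_calG sa sa'; have [sx Ex _] := rhoP Gx.
have [x3 _] := tor.1 _ _ sa sa'.
have xl := even_comm_l Ex.
have h (u : 'M[R]_(7, 2)) (e : bool) j :
    spin_pi x *m u = u *m (if e then - 1%:M else 1%:M) -> acomm e x (cl_vec (col j u)).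
  rewrite /acomm => xu; rewrite spin_pi_conj // -col_mulmx xu.
  case: e {xu}; rewrite ?mulmxN mulmx1 ?expr1 ?expr0 ?scaleN1r ?scale1r //.
  have -> : col j (- u) = - col j u by apply/matrixP => k m; rewrite !mxE.
  by rewrite linearN /= mulNr.
case=> [|[|[|[|[|[|[|//]]]]]]] _ /=; try exact: h; first exact/acomm0P.
all: by apply: h; rewrite mulmx1.
Qed.

Lemma sigma_J1 : exists k k', [/\ k ^+ 2 = 1, k' ^+ 2 = 1 & sigma J1 = diagJ k%:C k'%:C].
Proof.
have [a [a' [sa sa' x1 x2]]] := tor.2 _ _ SO2_N1 SO2_1.
have [sx Ex sgx] := rhoP (torusG_calG sa sa').
have JJ : J1 * J1 = -1 by exact: mon2_sqr.
apply: (sigma_J_of_torus Ex (even_J1 _) JJ sa sa' sgx) => //.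
apply: (torus_scalar sx Ex (even_J1 _) JJ) => // i i7.
have xb := torus_acomm (e1 := true) (e2 := false) sa sa' x1 x2 i7.
eexists; split; first exact: xb.
have : acomm (mon_sgn [:: 1; 2]%N [:: i]) J1 (mon [:: i]) by apply: mon_acomm; rewrite //= i7.
by rewrite mon1; case: i i7 {xb} => [|[|[|[|[|[|[|//]]]]]]].
Qed.

Lemma sigma_J2 : exists k k', [/\ k ^+ 2 = 1, k' ^+ 2 = 1 & sigma J2 = diagJ k%:C k'%:C].
Proof.
have [a [a' [sa sa' x1 x2]]] := tor.2 _ _ SO2_1 SO2_N1.
have [sx Ex sgx] := rhoP (torusG_calG sa sa').
have JJ : J2 * J2 = -1 by exact: mon2_sqr.
apply: (sigma_J_of_torus Ex (even_J2 _) JJ sa sa' sgx) => //.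
apply: (torus_scalar sx Ex (even_J2 _) JJ) => // i i7.
have xb := torus_acomm (e1 := false) (e2 := true) sa sa' x1 x2 i7.
eexists; split; first exact: xb.
have : acomm (mon_sgn [:: 3; 4]%N [:: i]) J2 (mon [:: i]) by apply: mon_acomm; rewrite //= i7.
by rewrite mon1; case: i i7 {xb} => [|[|[|[|[|[|[|//]]]]]]].
Qed.

Lemma rotJ_sqr : rotJ *m rotJ = - 1%:M.
Proof. by rewrite /rotJ !mx2E; congr mx2; ring. Qed.

Lemma diagJ_mul k1 k2 k3 k4 :
  diagJ k1 k2 *m diagJ k3 k4 = block_mx (- (k1 * k3))%:M 0 0 (- (k2 * k4))%:M.
Proof.
have h (k k' : C) : (k *: rotJ) *m (k' *: rotJ) = (- (k * k'))%:M.
  by rewrite -scalemxAl -scalemxAr scalerA rotJ_sqr scalerN scalemx1 raddfN.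
by rewrite diag_block_mul !h.
Qed.

(** The relation between the signs says that sigma (J_1 J_2) has trace zero,
    which holds because J_1 J_2 anticommutes with e_4 e_5. *)
Lemma sigma_Js : exists k1 k2 k3 k4 : R,
  [/\ [/\ k1 ^+ 2 = 1, k2 ^+ 2 = 1, k3 ^+ 2 = 1 & k4 ^+ 2 = 1],
      sigma J1 = diagJ k1%:C k2%:C, sigma J2 = diagJ k3%:C k4%:C
    & k1 * k3 = - (k2 * k4)].
Proof.
have [k1 [k2 [h1 h2 s1]]] := sigma_J1; have [k3 [k4 [h3 h4 s2]]] := sigma_J2.
exists k1, k2, k3, k4; split=> //.
have E12 : E (J1 * J2) := even_mul (even_J1 dec) (even_J2 dec).
have q4 : fpair 4 * fpair 4 = -1 by apply: fpair_sqr.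
have an : fpair 4 * (J1 * J2) = - (J1 * J2 * fpair 4).
  by rewrite -[J1 * J2]mon_cat; apply: mon_comm1.
have := tr_anti0 (even_fpair (isT : (0 < 4 < 6)%N)) E12 q4 an.
rewrite (sigmaM (even_J1 dec) (even_J2 dec)) s1 s2 diagJ_mul mxtrace_block !mxtrace_scalar.
rewrite -mulrnDl => /eqP; rewrite mulrn_eq0 /= -opprD oppr_eq0 -!rmorphM -rmorphD.
by rewrite fmorph_eq0 addr_eq0 => /eqP.
Qed.

Lemma diag_comm_scalar (M : 'M[C]_(2 + 2)) (k : C) : k != 0 ->
  M *m block_mx k%:M 0 0 (- k)%:M = block_mx k%:M 0 0 (- k)%:M *m M ->
  exists A B, M = block_mx A 0 0 B.
Proof.
move=> k0; rewrite -[M]submxK !mulmx_block !mulmx0 !mul0mx !addr0 !add0r.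
rewrite !mul_scalar_mx !mul_mx_scalar => /eq_block_mx [_ e1 e2 _].
have z (A : 'M[C]_2) : k *: A = - k *: A -> A = 0.
  rewrite scaleNr => /eqP; rewrite -addr_eq0 -mulr2n -scaler_nat !scaler_eq0.
  by rewrite pnatr_eq0 (negPf k0) /= => /eqP.
exists (ulsubmx M), (drsubmx M); congr block_mx; last exact: z.
by apply: z.
Qed.

(** The quarter turn and a reflection generate the algebra of all matrices of
    size 2. *)
Lemma comm_rotJ_swap2 (A : 'M[C]_2) (w : C) : w != 0 ->
  A *m (w *: rotJ) = (w *: rotJ) *m A -> A *m cmx (swap2 R) = cmx (swap2 R) *m A ->
  exists a, A = a%:M.
Proof.
move=> w0; rewrite -scalemxAl -scalemxAr => /(scalerI w0).
rewrite swap2E cmx_mx2 [A]mx2_eta /rotJ.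
move: (A 0 0) (A 0 1) (A 1 0) (A 1 1) => a b' c d {A}.
rewrite !mx2E rmorph0 rmorph1 => /mx2_inj [e1 e2 e3 e4] /mx2_inj [f1 f2 f3 f4].
have eb : b' = c by transitivity (a * 0 + b' * 1); [ring|rewrite f1; ring].
have ea : a = d by transitivity (a * 1 + b' * 0); [ring|rewrite f2; ring].
have ec : b' = - c by transitivity (a * 0 + b' * 1); [ring|rewrite e1; ring].
have c0 : c = 0.
  have /eqP := etrans (esym eb) ec; rewrite -addr_eq0 -mulr2n mulrn_eq0 /=.
  by move/eqP.
by exists a; rewrite mx2S eb ea c0.
Qed.

(** Together with its mirror image (i, s), the pair (s, i) provides elements
    of calG which, with J_1, act irreducibly on each of the two blocks. *)
Lemma calG_data_s1 : calG_data (swap2 R) 1%:M 1 'i.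
Proof.
have [os ds] := swap2_orth R; split=> //; first exact: orth1.
  by rewrite det1 expr1n rmorph1.
by rewrite ds sqr_i rmorphN1.
Qed.

Lemma calG_data_1s : calG_data 1%:M (swap2 R) 'i 1.
Proof.
have [os ds] := swap2_orth R; split=> //; first exact: orth1.
  by rewrite ds sqr_i rmorphN1.
by rewrite det1 expr1n rmorph1.
Qed.

Lemma sqr1_realC_neq0 (k : R) : k ^+ 2 = 1 -> k%:C != 0 :> C.
Proof.
move=> k1; rewrite fmorph_eq0; apply/eqP => k0.
by move/eqP: k1; rewrite k0 expr0n eq_sym oner_eq0.
Qed.

(** sigma omega commutes with the image of the even algebra. It is block
    diagonal because sigma (J_1 J_2) is k on one block and -k on the other,
    and each block is scalar because it commutes with a quarter turn and with
    a reflection. *)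
Lemma sigma_omega : exists w1 w2 : C,
  [/\ w1 ^+ 2 = -1, w2 ^+ 2 = -1 & sigma omega = block_mx w1%:M 0 0 w2%:M].
Proof.
have [k1 [k2 [k3 [k4 [[h1 h2 h3 h4] s1 s2 kk]]]]] := sigma_Js.
have Eo := even_omega dec.
have cE x : E x -> sigma omega *m sigma x = sigma x *m sigma omega.
  by move=> Ex; rewrite -!sigmaM // (omega_comm_even dec Ex).
have E12 : E (J1 * J2) := even_mul (even_J1 dec) (even_J2 dec).
have s12 : sigma (J1 * J2) =
    block_mx (- (k1 * k3))%:C%:M 0 0 (- - (k1 * k3)%:C)%:M.
  rewrite (sigmaM (even_J1 dec) (even_J2 dec)) s1 s2 diagJ_mul opprK [in RHS]rmorphN /= !rmorphM.
  by congr block_mx; rewrite -!rmorphM -rmorphN kk.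
have kn : (- (k1 * k3))%:C != 0 :> C.
  by apply: sqr1_realC_neq0; rewrite sqrrN exprMn h1 h3 mulr1.
have := cE _ E12; rewrite s12 -rmorphN => /(diag_comm_scalar kn) [A [B oE]].
have := cE _ (even_J1 dec); rewrite s1 oE !diag_block_mul => /eq_block_mx [cA _ _ cB].
have [G1 _ _] := calG_dataP calG_data_s1; have [_ E1 r1] := rhoP G1.
have [G2 _ _] := calG_dataP calG_data_1s; have [_ E2 r2] := rhoP G2.
have := cE _ E1; rewrite r1 oE !diag_block_mul => /eq_block_mx [dA _ _ _].
have := cE _ E2; rewrite r2 oE !diag_block_mul => /eq_block_mx [_ _ _ dB].
rewrite /= !scale1r in dA dB.
have [w1 A1] := comm_rotJ_swap2 (sqr1_realC_neq0 h1) cA dA.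
have [w2 B1] := comm_rotJ_swap2 (sqr1_realC_neq0 h2) cB dB.
rewrite A1 B1 in oE; exists w1, w2.
have := sigmaM Eo Eo; rewrite (omega_sqr dec) (sigmaN (even_one l)) sigma1 oE diag_block_mul.
rewrite -!scalar_mxM (scalar_mx_block 2 2) opp_block_mx => /eq_block_mx [e _ _ e'].
split=> //.
  by move/matrixP/(_ 0 0): e; rewrite !mxE eqxx /= ?mulr1n expr2 => <-.
by move/matrixP/(_ 0 0): e'; rewrite !mxE eqxx /= ?mulr1n expr2 => <-.
by rewrite A1 B1.
Qed.

(** The two scalars of [sigma_omega] have square -1. *)
Lemma tr_omega_imaginary : conjc (\tr (sigma omega)) = - \tr (sigma omega).
Proof.
have [w1 [w2 [h1 h2 ->]]] := sigma_omega.
rewrite mxtrace_block !mxtrace_scalar rmorphD !rmorphMn /=.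
by rewrite !sqrN1_conj //; ring.
Qed.

(** For z = x^-1 y with sigma z = 1, the real part of the trace formula says
    that the scalar coefficient of z is 1, and z has norm 1. *)
Lemma spinE_sigma_inj x y : spin x -> spin y -> E x -> E y ->
  sigma x = sigma y -> x = y.
Proof.
move=> sx sy Ex Ey xy; have ux := spin_unit sx.
have sz : spin (x^-1 * y) by apply: spinM => //; apply: spinV.
have EV : E x^-1.
  by apply: (spin_comm_l_even dec); [exact: spinV|apply: spinE_inv => //; exact: even_comm_l].
have s1 : sigma (x^-1 * y) = 1%:M.
  by rewrite sigmaM // -xy -sigmaM // mulVr // sigma1.
suff z1 : x^-1 * y = 1 by rewrite -[y](mulVKr ux) z1 mulr1.
apply: spin_scalar_part1 => //; have := trace_formula (even_mul EV Ey).
rewrite s1 mxtrace1; set s := _ finset.set0; set t := (omega * _) _.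
have := tr_omega_imaginary; case: (\tr _) => w0 w [wE].
have -> : w0 = 0 by lra.
move=> e; have : (4 - 4 * s)%:C = 0 +i* (- (t * w)).
  rewrite rmorphB rmorphM !rmorph_nat.
  have -> : 4 - 4 * s%:C = - (t%:C * (0 +i* w)) :> C.
    have e4 : 4 = 4 * s%:C - t%:C * (0 +i* w) by exact: e.
    by rewrite {1}e4; ring.
  by simpc.
by case=> h _; lra.
Qed.

Lemma rhoM g g' : calG g -> calG g' -> rho (g * g') = rho g * rho g'.
Proof.
move=> G G'; have [GG _ _] := calG_mul G G'.
have [s1 E1 r1] := rhoP G; have [s2 E2 r2] := rhoP G'; have [s3 E3 r3] := rhoP GG.
apply: spinE_sigma_inj => //; [exact: spinM|exact: even_mul|].
by rewrite r3 sigmaM // r1 r2 diag_block_mul.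
Qed.

Lemma spinZ (c : R) x : c ^+ 2 = 1 -> spin x -> spin (c *: x).
Proof.
move=> /eqP; rewrite sqrf_eq1 => /orP[]/eqP -> sx; rewrite ?scale1r // scaleN1r.
have ul : unit_vec l by exact: l_unit dec.
(* -1 is the product of the unit vectors l and -l. *)
have -> : - x = x * (cl_vec l * cl_vec (- l)).
  by rewrite linearN /= mulrN unit_vec_sqr // mulrN1.
by apply: spinM => //; apply: spin2 => //; apply: unit_vecN.
Qed.

Lemma spin_mon2 i j : (i < 7)%N -> (j < 7)%N -> spin (mon [:: i; j]).
Proof. by move=> hi hj; rewrite mon2; apply: spin2; apply: (frame_unit dec). Qed.

(** Conjugation by a matrix of O(2) fixes or inverts rotations, according to
    its determinant. *)
Lemma rotJ_comm (h : 'M[R]_2) (z : C) : orthogonal_group h ->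
  (z *: cmx h) *m rotJ = (\det h)%:C *: rotJ *m (z *: cmx h).
Proof.
move=> /orth2P [p [s [_ [[-> ->]|[-> ->]]]]];
  rewrite /rot /refl cmx_mx2 /rotJ !mx2E ?rmorphN /=; congr mx2; ring.
Qed.

(** By injectivity of sigma, the conjugation relation between y and y' can be
    checked on each block, where (h1, h2) multiplies the quarter turns by det
    h1 and det h2. *)
Lemma diagJ_transport (h1 h2 : 'M[R]_2) (z1 z2 : C) y y' (k k' : R) : calG_data h1 h2 z1 z2 ->
    spin y -> spin y' -> E y -> E y' -> sigma y = diagJ k%:C k'%:C ->
    sigma y' = diagJ (\det h1 * k)%:C (\det h2 * k')%:C ->
  rho (pairG h1 h2 z1 z2) * y = y' * rho (pairG h1 h2 z1 z2).
Proof.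
move=> D sy sy' Ey Ey' hy hy'; have [G _ _] := calG_dataP D; case: D => o1 o2 _ _.
have [sx Ex hx] := rhoP G.
have conj (h : 'M[R]_2) (z : C) (c : R) : orthogonal_group h ->
    (z *: cmx h) *m (c%:C *: rotJ) = ((\det h * c)%:C *: rotJ) *m (z *: cmx h).
  move=> oh; rewrite -scalemxAr (rotJ_comm z oh) -!scalemxAl scalerA.
  by rewrite -(rmorphM (real_complex R)) mulrC.
apply: (spinE_sigma_inj (spinM sx sy) (spinM sy' sx) (even_mul Ex Ey) (even_mul Ey' Ex)).
rewrite (sigmaM Ex Ey) (sigmaM Ey' Ex) hx hy hy'; move: (conj) => cj.
by rewrite /diagJ !diag_block_mul [(pairG _ _ _ _).1]/= [(pairG _ _ _ _).2]/= !cj.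
Qed.

Lemma sigma_scaleJ (c k k' : R) y : E y -> sigma y = diagJ k%:C k'%:C ->
  sigma (c *: y) = diagJ (c * k)%:C (c * k')%:C.
Proof.
move=> Ey hy; rewrite (sigmaZ c Ey) hy; have cM (t : R) : (c * t)%:C = c%:C * t%:C by rewrite rmorphM.
rewrite (cM k) (cM k') scale_block_mx !scaler0.
rewrite [c%:C *: (k%:C *: _)]scalerA [c%:C *: (k'%:C *: _)]scalerA.
reflexivity.
Qed.

Lemma J_conj_even (h1 h2 : 'M[R]_2) (z1 z2 : C) (x := rho (pairG h1 h2 z1 z2)) :
  calG_data h1 h2 z1 z2 -> \det h1 = \det h2 ->
  x * J1 = (\det h1 *: J1) * x /\ x * J2 = (\det h1 *: J2) * x.
Proof.
move=> D e; have [k1 [k2 [k3 [k4 [_ s1 s2 _]]]]] := sigma_Js.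
have [o1 _ _ _] := D; have d1 := orth_det_sqr o1.
split; [apply: (diagJ_transport D _ _ _ _ s1)|apply: (diagJ_transport D _ _ _ _ s2)].
- exact: spin_mon2.
- by apply: spinZ => //; apply: spin_mon2.
- exact: even_J1.
- by apply: evenZ; apply: even_J1.
- by rewrite -e; apply: sigma_scaleJ => //; apply: even_J1.
- exact: spin_mon2.
- by apply: spinZ => //; apply: spin_mon2.
- exact: even_J2.
- by apply: evenZ; apply: even_J2.
- by rewrite -e; apply: sigma_scaleJ => //; apply: even_J2.
Qed.

(** On the two blocks, the signs of J_1 and J_2 agree in one and differ in the
    other; so changing the sign of J_1 on one block only turns it into J_2 up
    to a global sign. *)
Lemma J_conj_odd (h1 h2 : 'M[R]_2) (z1 z2 : C) (x := rho (pairG h1 h2 z1 z2)) :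
  calG_data h1 h2 z1 z2 -> \det h1 = - \det h2 ->
  exists c : R, [/\ c ^+ 2 = 1, x * J1 = (c *: J2) * x & x * J2 = (c *: J1) * x].
Proof.
move=> D e; have [k1 [k2 [k3 [k4 [[q1 q2 q3 q4] s1 s2 kk]]]]] := sigma_Js.
have [o1 _ _ _] := D; have d1 := orth_det_sqr o1.
have e2 : \det h2 = - \det h1 by rewrite e opprK.
have c1 : (\det h1 * k1 * k3) ^+ 2 = 1 by rewrite !exprMn d1 q1 q3 !mulr1.
exists (\det h1 * k1 * k3); split=> //.
  apply: (diagJ_transport D _ _ _ _ s1).
  - exact: spin_mon2.
  - by apply: spinZ => //; apply: spin_mon2.
  - exact: even_J1.
  - by apply: evenZ; apply: even_J2.
  apply: etrans (sigma_scaleJ (\det h1 * k1 * k3) (even_J2 dec) s2) _.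
  have -> : \det h1 * k1 * k3 * k3 = \det h1 * k1 by rewrite -!mulrA -expr2 q3 mulr1.
  have -> : \det h1 * k1 * k3 * k4 = \det h2 * k2.
    rewrite -(mulrA (\det h1)) kk e2.
    by transitivity (- \det h1 * k2 * k4 ^+ 2); [ring|rewrite q4 mulr1].
  reflexivity.
apply: (diagJ_transport D _ _ _ _ s2).
- exact: spin_mon2.
- by apply: spinZ => //; apply: spin_mon2.
- exact: even_J2.
- by apply: evenZ; apply: even_J1.
apply: etrans (sigma_scaleJ (\det h1 * k1 * k3) (even_J1 dec) s1) _.
have -> : \det h1 * k1 * k3 * k1 = \det h1 * k3.
  by transitivity (\det h1 * k3 * k1 ^+ 2); [ring|rewrite q1 mulr1].
have -> : \det h1 * k1 * k3 * k2 = \det h2 * k4.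
  rewrite -(mulrA (\det h1)) kk e2.
  by transitivity (- \det h1 * k4 * k2 ^+ 2); [ring|rewrite q2 mulr1].
reflexivity.
Qed.

(** The images of the vectors i and j span the plane of the bivector p s. *)
Lemma plane_of_J i j p s (c : R) x : i != j -> p != s ->
    all (fun t => t < 7)%N [:: i; j; p; s] -> spin x ->
    x * mon [:: i; j] = (c *: mon [:: p; s]) * x ->
  exists al be ga de : R,
    [/\ spin_pi x *m frame i = al *: frame p + be *: frame s,
        spin_pi x *m frame j = ga *: frame p + de *: frame s
      & al * de - be * ga = c].
Proof.
move=> ij ps /and5P[i7 j7 p7 s7 _] sx xJ; have [oX _ cX] := spin_piP sx.
have iso v w : (spin_pi x *m v)^T *m (spin_pi x *m w) = v^T *m w.
  by rewrite trmx_mul mulmxA -(mulmxA v^T) oX mulmx1.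
apply: bivector_plane.
- exact: (frame_unit dec).
- exact: (frame_unit dec).
- by rewrite (frame_gram dec) // (negPf ps) raddf0.
- by rewrite /unit_vec iso; apply: (frame_unit dec).
- by rewrite /unit_vec iso; apply: (frame_unit dec).
- by rewrite iso (frame_gram dec) // (negPf ij) raddf0.
apply: (mulIr (spin_unit sx)).
by rewrite -mon2 -xJ mon2 mulrA cX -!mulrA cX.
Qed.

Lemma cols_mx2 (A u : 'M[R]_(7, 2)) al be ga de :
  col 0 A = al *: col 0 u + be *: col 1 u ->
  col 1 A = ga *: col 0 u + de *: col 1 u -> A = u *m mx2 al ga be de.
Proof.
move=> c0 c1; apply/matrixP => i j; move: j i; apply: forall_ord2 => i.
  move/matrixP/(_ i 0): c0; rewrite !mxE !big_ord_recl big_ord0 !mxE /= addr0 => ->.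
  by rewrite mulrC (mulrC be); congr (_ * _ + u _ _ * _); apply: val_inj.
move/matrixP/(_ i 0): c1; rewrite !mxE !big_ord_recl big_ord0 !mxE /= addr0 => ->.
by rewrite mulrC (mulrC de); congr (_ * _ + u _ _ * _); apply: val_inj.
Qed.

Lemma orth_block (X : 'M[R]_7) (u u' : 'M[R]_(7, 2)) a : X^T *m X = 1%:M ->
  u^T *m u = 1%:M -> u'^T *m u' = 1%:M -> X *m u = u' *m a -> orthogonal_group a.
Proof.
move=> oX ou ou' e; rewrite /orthogonal_group /=.
have -> : a^T *m a = (u' *m a)^T *m (u' *m a).
  by rewrite trmx_mul mulmxA -(mulmxA a^T) ou' mulmx1.
by rewrite -e trmx_mul mulmxA -(mulmxA u^T) oX mulmx1.
Qed.

(** Conjugation by e_5 preserves the scalar coefficient and changes the sign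
    of that of omega; as tr (sigma omega) is imaginary, the trace formula
    becomes its conjugate. *)
Lemma tr_conj_b5 z : E z -> \tr (sigma (fvec 5 * z * fvec 5)) = conjc (\tr (sigma z)).
Proof.
move=> Ez; have Eb : E (fvec 5 * z * fvec 5) by apply: (even_conj_fvec dec).
have s1 : (fvec 5 * z * fvec 5) finset.set0 = z finset.set0.
  by rewrite scalar_part_mulC mulrA fvec_sqr // mul1r.
have s2 : (omega * (fvec 5 * z * fvec 5)) finset.set0 = - (omega * z) finset.set0.
  have oa : omega * fvec 5 = - (fvec 5 * omega) by apply: (omega_anti dec).
  have pp : fvec 5 * fvec 5 = 1 by apply: (fvec_sqr dec).
  move: omega (fvec 5) oa pp => o p oa pp.
  rewrite !mulrA oa !mulNr [LHS]ffunE; congr (- _).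
  by rewrite [LHS]scalar_part_mulC !mulrA pp mul1r.
rewrite (trace_formula Eb) (trace_formula Ez) s1 s2.
set s := _ finset.set0; set t := (omega * _) _.
have := tr_omega_imaginary; case: (\tr (sigma omega)) => w0 w [wE].
have -> : w0 = 0 by lra.
rewrite -(rmorph_nat (real_complex R)) -rmorphM /=.
by simpc; congr (_ +i* _); ring.
Qed.

Lemma sigma_J3 : exists t1 t2 k : C, [/\ t1 ^+ 2 = -1, t2 ^+ 2 = -1, k ^+ 2 = 1,
  sigma J3 = block_mx t1%:M 0 0 t2%:M & sigma (J1 * J2) = block_mx k%:M 0 0 (- k)%:M].
Proof.
have [k1 [k2 [k3 [k4 [[h1 h2 h3 h4] s1 s2 kk]]]]] := sigma_Js.
have [w1 [w2 [q1 q2 so]]] := sigma_omega.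
have s12 : sigma (J1 * J2) = block_mx (- (k1 * k3)%:C)%:M 0 0 (- - (k1 * k3)%:C)%:M.
  rewrite (sigmaM (even_J1 dec) (even_J2 dec)) s1 s2 diagJ_mul opprK -!rmorphM.
  by congr block_mx; rewrite kk (rmorphN (real_complex R)).
have E12 : E (J1 * J2) := even_mul (even_J1 dec) (even_J2 dec).
have J3E : J3 = J1 * J2 * omega by rewrite omegaE mulrA J12_sqr // mul1r.
have kq : ((k1 * k3)%:C : C) ^+ 2 = 1 by rewrite -rmorphXn exprMn h1 h3 mulr1 rmorph1.
exists (- (k1 * k3)%:C * w1), (- - (k1 * k3)%:C * w2), (- (k1 * k3)%:C); split=> //.
- by rewrite exprMn sqrrN kq q1 mul1r.
- by rewrite exprMn opprK kq q2 mul1r.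
- by rewrite sqrrN.
by rewrite J3E (sigmaM E12 (even_omega dec)) s12 so diag_block_mul -!scalar_mxM.
Qed.

Lemma rho_J12_comm g : calG g -> rho g * (J1 * J2) = J1 * J2 * rho g.
Proof.
move=> G; have [sx Ex hx] := rhoP G.
have E12 : E (J1 * J2) := even_mul (even_J1 dec) (even_J2 dec).
have s12 : spin (J1 * J2) by apply: spinM; apply: spin_mon2.
have [t1 [t2 [k [_ _ _ _ hk]]]] := sigma_J3.
apply: spinE_sigma_inj; try exact: spinM; try exact: even_mul.
rewrite (sigmaM Ex E12) (sigmaM E12 Ex) hx hk !diag_block_mul.
by rewrite !mul_scalar_mx !mul_mx_scalar.
Qed.

Lemma rho_J3_comm g : calG g -> rho g * J3 = J3 * rho g.
Proof.
move=> G; have [sx Ex hx] := rhoP G.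
have -> : J3 = J1 * J2 * omega by rewrite omegaE mulrA J12_sqr // mul1r.
by rewrite mulrA rho_J12_comm // -mulrA -(omega_comm_even dec Ex) mulrA.
Qed.

(** Since y commutes with e_5 and x e_5 = (al e_5 + be e_6) x, one finds e_5
    (y x) e_5 = al y x + be y J_3 x. Taking traces relates the sum of the
    traces over the two blocks with its conjugate, and J_3 acts on the blocks
    by scalars t1 and t2. The same relation for y J_1 J_2, which changes the
    sign of one block, separates the blocks. *)
Lemma rho_F3_trace g (al be : R) (x := rho g) : calG g ->
    spin_pi x *m frame 5 = al *: frame 5 + be *: frame 6 ->
  exists t1 t2 : C, [/\ t1 ^+ 2 = -1, t2 ^+ 2 = -1 &
    forall (y : Cl) (Y1 Y2 : 'M[C]_2), E y -> y * fvec 5 = fvec 5 * y ->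
      y * J1 * J2 = J1 * J2 * y ->
      sigma y = block_mx Y1 0 0 Y2 ->
    conjc (\tr (Y1 *m g.1)) = (al%:C + be%:C * t1) * \tr (Y1 *m g.1) /\
    conjc (\tr (Y2 *m g.2)) = (al%:C + be%:C * t2) * \tr (Y2 *m g.2)].
Proof.
move=> G x5; have [sx Ex hx] := rhoP G.
have [t1 [t2 [k [q1 q2 qk h3 h12]]]] := sigma_J3; exists t1, t2; split=> //.
have E12 : E (J1 * J2) := even_mul (even_J1 dec) (even_J2 dec).
have c12 : (J1 * J2) * fvec 5 = fvec 5 * (J1 * J2).
  by rewrite -[J1 * J2]mon_cat -mon1; apply: mon_comm0.
have b55 : fvec 5 * fvec 5 = 1 by apply: fvec_sqr.
have key y Y1 Y2 : E y -> y * fvec 5 = fvec 5 * y -> sigma y = block_mx Y1 0 0 Y2 ->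
  conjc (\tr (Y1 *m g.1)) + conjc (\tr (Y2 *m g.2))
  = (al%:C + be%:C * t1) * \tr (Y1 *m g.1) + (al%:C + be%:C * t2) * \tr (Y2 *m g.2).
  move=> Ey y5 hy; have Eyx := even_mul Ey Ex.
  have e : fvec 5 * (y * x) * fvec 5 = al *: (y * x) + be *: (y * (J3 * x)).
    rewrite -[J3]/(mon [:: 5; 6]%N) mon2 -mulrA -(mulrA y) spin_pi_conj // x5.
    rewrite -/(frame 5) linearD !linearZ /= -[cl_vec (frame 5)]/(fvec 5) -[cl_vec (frame 6)]/(fvec 6).
    rewrite mulrA -y5 mulrDl mulrDr -!scalerAl -!scalerAr -!mulrA.
    by rewrite (mulrA (fvec 5) (fvec 5)) b55 mul1r.
  have := tr_conj_b5 Eyx; rewrite e.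
  have EJx : E (J3 * x) := even_mul (even_J3 dec) Ex.
  rewrite sigma_lin //; last by apply: evenZ; apply: even_mul.
  rewrite sigmaZ; last exact: even_mul.
  rewrite (sigmaM Ey Ex) (sigmaM Ey EJx) (sigmaM (even_J3 dec) Ex) h3 hy hx !diag_block_mul.
  rewrite mxtraceD !mxtraceZ !mxtrace_block !mul_scalar_mx -!scalemxAr !mxtraceZ rmorphD /=.
  by move=> <-; ring.
move=> y Y1 Y2 Ey y5 y12 hy; have e1 := key _ _ _ Ey y5 hy.
have k0 : k != 0 by apply/eqP => k0; move: qk; rewrite k0 expr0n => /eqP; rewrite eq_sym oner_eq0.
have y5' : (y * (J1 * J2)) * fvec 5 = fvec 5 * (y * (J1 * J2)).
  by move: c12 y5; move: (J1 * J2) (fvec 5) => J p Jp yp; rewrite -mulrA Jp !mulrA yp.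
have hy' : sigma (y * (J1 * J2)) = block_mx (k *: Y1) 0 0 (- k *: Y2).
  by rewrite (sigmaM Ey E12) hy h12 diag_block_mul !mul_mx_scalar.
have := key _ _ _ (even_mul Ey E12) y5' hy'.
rewrite -!scalemxAl !mxtraceZ !rmorphM rmorphN /=.
have kr : conjc k = k by apply: sqr1_conj.
rewrite kr => e2.
have e3 : conjc (\tr (Y1 *m g.1)) - conjc (\tr (Y2 *m g.2))
  = (al%:C + be%:C * t1) * \tr (Y1 *m g.1) - (al%:C + be%:C * t2) * \tr (Y2 *m g.2).
  apply: (mulfI k0); transitivity (k * (\tr (Y1 *m g.1))^* + - k * (\tr (Y2 *m g.2))^*).
    by ring.
  by rewrite e2; ring.
move: e1 e3; set P := conjc _; set Q := conjc _; set S := _ * _; set T := _ * \tr (Y2 *m _).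
move=> e1 e3; split.
  apply: (@mulfI _ (2 : C)); first by rewrite pnatr_eq0.
  by transitivity (P + Q + (P - Q)); [ring|rewrite e1 e3; ring].
apply: (@mulfI _ (2 : C)); first by rewrite pnatr_eq0.
by transitivity (P + Q - (P - Q)); [ring|rewrite e1 e3; ring].
Qed.

(** A rotation has a nonzero trace against 1 or against the quarter turn, so
    the factor al + be t is conj(z) / z, that is d since z^2 = d. As t is i or
    -i, this determines al and be. *)
Lemma rotation_phase (h : 'M[R]_2) (z t k : C) (al be d : R) :
    orthogonal_group h -> \det h = 1 -> z ^+ 2 = d%:C -> d ^+ 2 = 1 -> t ^+ 2 = -1 ->
    k != 0 ->
    conjc (\tr (1%:M *m (z *: cmx h))) = (al%:C + be%:C * t) * \tr (1%:M *m (z *: cmx h)) ->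
    conjc (\tr ((k *: rotJ) *m (z *: cmx h)))
       = (al%:C + be%:C * t) * \tr ((k *: rotJ) *m (z *: cmx h)) ->
    conjc k = k ->
  al = d /\ be = 0.
Proof.
move=> oh dh zd dd tt k0 + + kr.
have [x [y [e [[-> _]|[_ d1]]]]] := orth2P oh; last first.
  by case: N1_neq1; rewrite -d1 dh.
rewrite /rot cmx_mx2 rmorphN /= mul1mx /rotJ !mx2E.
set ph := al%:C + _ => e1 e2.
have cD (a b : C) : conjc (a + b) = conjc a + conjc b by apply: rmorphD.
have cM (a b : C) : conjc (a * b) = conjc a * conjc b by apply: rmorphM.
have cm2 : conjc (-2 : C) = -2 by rewrite rmorphN rmorph_nat.
have xr : conjc x%:C = x%:C by rewrite conjc_real.
have yr : conjc y%:C = y%:C by rewrite conjc_real.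
have {}e1 : conjc z * x%:C = ph * (z * x%:C).
  apply: (@mulfI _ (2 : C)); first by rewrite pnatr_eq0.
  transitivity (conjc (z * x%:C + z * x%:C)); last by rewrite e1; ring.
  by rewrite cD cM xr; ring.
have {}e2 : conjc z * y%:C = ph * (z * y%:C).
  apply: (@mulfI _ (-2 * k)); first by rewrite mulf_neq0 // oppr_eq0 pnatr_eq0.
  transitivity (conjc (-2 * k * (z * y%:C))).
    by rewrite !cM cm2 yr kr; ring.
  transitivity (ph * (-2 * k * (z * y%:C))); last by ring.
  transitivity (conjc (k * 0 * (z * x%:C) + k * -1 * (z * y%:C)
     + (k * 1 * (z * - y%:C) + k * 0 * (z * x%:C)))); first by congr conjc; ring.
  by rewrite e2; ring.
have z0 : z != 0.
  apply/eqP => z0; move: zd; rewrite z0 expr0n /= => /esym/eqP.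
  rewrite fmorph_eq0 => /eqP d0; move: dd; rewrite d0 expr0n => /eqP.
  by rewrite eq_sym oner_eq0.
have zc : conjc z = d%:C * z.
  have /eqP := dd; rewrite sqrf_eq1 => /orP[]/eqP dE; rewrite dE in zd *.
    by rewrite rmorph1 mul1r sqr1_conj // zd rmorph1.
  by rewrite rmorphN1 mulN1r sqrN1_conj // zd rmorphN1.
have : ph = d%:C.
  apply: (mulIf z0); rewrite -zc.
  have eC : x%:C ^+ 2 + y%:C ^+ 2 = 1 :> C by rewrite -!rmorphXn -rmorphD e rmorph1.
  transitivity (ph * z * (x%:C ^+ 2 + y%:C ^+ 2)); first by rewrite eC mulr1.
  transitivity (ph * (z * x%:C) * x%:C + ph * (z * y%:C) * y%:C); first by ring.
  rewrite -e1 -e2; transitivity (conjc z * (x%:C ^+ 2 + y%:C ^+ 2)); first by ring.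
  by rewrite eC mulr1.
rewrite /ph; case: (sqrN1_cases tt) => ->; simpc => -[-> b0]; split=> //.
by move/eqP: b0; rewrite oppr_eq0 => /eqP.
Qed.

Lemma rho_frame5_rotation (h1 h2 : 'M[R]_2) (z1 z2 : C)
    (x := rho (pairG h1 h2 z1 z2)) : calG_data h1 h2 z1 z2 ->
  \det h1 = 1 \/ \det h2 = 1 ->
  spin_pi x *m frame 5 = (\det h1 * \det h2) *: frame 5.
Proof.
move=> D rr; have [G _ _] := calG_dataP D; case: D => o1 o2 q1 q2.
have [sx Ex hx] := rhoP G.
have xJ : x * J3 = (1 *: J3) * x by rewrite scale1r; apply: rho_J3_comm.
have [al [be [_ [_ [x5 _ _]]]]] := plane_of_J (i := 5) (j := 6) (p := 5) (s := 6) isT isT isT sx xJ.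
have [t1 [t2 [tt1 tt2 H]]] := rho_F3_trace G x5.
have c15 : J1 * fvec 5 = fvec 5 * J1 by rewrite -mon1; apply: mon_comm0.
have c1 : J1 * J1 * J2 = J1 * J2 * J1 by move: (J12_comm dec); move: J1 J2 => o p op; rewrite -mulrA [in LHS]op mulrA.
have [k1 [k2 [k3 [k4 [[kk1 kk2 _ _] s1 _ _]]]]] := sigma_Js.
have Hone := H 1 1%:M 1%:M (even_one l).
have [||| a1 a2] := Hone; rewrite ?mul1r ?mulr1 //.
  by rewrite sigma1 (scalar_mx_block 2 2).
have [b1 b2] := H J1 _ _ (even_J1 dec) c15 c1 s1.
rewrite x5; case: rr => dh.
  have d2 : \det h2 ^+ 2 = 1 by apply: orth_det_sqr.
  have [-> ->] := rotation_phase o1 dh q1 d2 tt1 (sqr1_realC_neq0 kk1) a1 b1 (conjc_real _).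
  by rewrite dh mul1r scale0r addr0.
have d1 : \det h1 ^+ 2 = 1 by apply: orth_det_sqr.
have [-> ->] := rotation_phase o2 dh q2 d1 tt2 (sqr1_realC_neq0 kk2) a2 b2 (conjc_real _).
by rewrite dh mulr1 scale0r addr0.
Qed.

(** If h1 and h2 are both reflections, multiplying by (s, i) turns the first
    one into a rotation. *)
Lemma rho_frame5 g : calG g -> spin_pi (rho g) *m frame 5 = dchar g *: frame 5.
Proof.
move=> /calG_datum [h1 [h2 [z1 [z2 [D ->]]]]].
have [G _ ->] := calG_dataP D.
have [[o1 o2 _ _] [os ds]] := (D, swap2_orth R).
case: (orth_det o1) => d1; first by apply: rho_frame5_rotation => //; left.
case: (orth_det o2) => d2; first by apply: rho_frame5_rotation => //; right.
have Ds := calG_data_s1; have [Gs _ _] := calG_dataP Ds.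
have DD := calG_data_mul D Ds.
have := @rho_frame5_rotation _ _ _ _ DD; rewrite -pairG_mul (rhoM G Gs).
have [sx _ _] := rhoP G; have [sy _ _] := rhoP Gs.
rewrite (spin_piM sx sy) -[_ *m _ *m frame 5]mulmxA.
have := rho_frame5_rotation Ds (or_intror (det1 _ _)).
move: (spin_pi (rho (pairG (swap2 R) _ _ _))) => Xs ->.
rewrite !det_mulmx d1 d2 ds det1 !mulr1 mulrNN mulr1 mul1r => /(_ (or_introl erefl)).
by rewrite -scalemxAr !scaleN1r scale1r => /oppr_inj.
Qed.

Lemma rho_u3 g : calG g -> spin_pi (rho g) *m u3 = dchar g *: u3.
Proof.
move=> G; have [sx Ex _] := rhoP G; have [_ dd] := calG_signs G.
have x5 := rho_frame5 G.
have xb5 : rho g * fvec 5 = dchar g *: fvec 5 * rho g.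
  by rewrite spin_pi_conj // x5 linearZ.
have d2 : dchar g * dchar g = 1 by case: dd => ->; rewrite ?mulr1 ?mulrNN ?mulr1.
have b55 : fvec 5 * fvec 5 = 1 by apply: (fvec_sqr dec).
have xb6 : rho g * fvec 6 = dchar g *: fvec 6 * rho g.
  have := rho_J3_comm G; rewrite -[J3]/(mon [:: 5; 6]%N) mon2 mulrA xb5.
  move: (rho g) (fvec 5) (fvec 6) (dchar g) d2 b55 => x p s d d2 pp h.
  have e : p * x * s = d *: (p * s * x) by rewrite -h -!scalerAl scalerA d2 scale1r.
  by rewrite -[LHS]mul1r -pp -mulrA [p * (x * s)]mulrA e -scalerAr -scalerAl !mulrA pp mul1r.
have x6 : spin_pi (rho g) *m frame 6 = dchar g *: frame 6.
  apply: cl_vec_inj; apply: (mulIr (spin_unit sx)).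
  by rewrite -spin_pi_conj // linearZ /= -/(fvec 6) xb6.
apply/matrixP => i j; move: j i; apply: forall_ord2 => i.
  by move/matrixP/(_ i 0): x5; rewrite -[frame 5]/(col 0 u3) -col_mulmx !mxE.
move/matrixP/(_ i 0): x6; rewrite -[frame 6]/(col 1 u3) -col_mulmx !mxE.
by [].
Qed.

Lemma rho_l g : calG g -> spin_pi (rho g) *m l = l.
Proof.
move=> G; have [sx Ex _] := rhoP G; apply: cl_vec_inj.
by apply: (mulIr (spin_unit sx)); rewrite -spin_pi_conj // even_comm_l.
Qed.

Lemma rho_F12_even g : calG g -> dchar g = 1 -> exists a a',
  [/\ orthogonal_group a, orthogonal_group a', \det a = upsilon g, \det a' = upsilon g
    & spin_pi (rho g) *m u1 = u1 *m a /\ spin_pi (rho g) *m u2 = u2 *m a'].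
Proof.
move=> /calG_datum [h1 [h2 [z1 [z2 [D ->]]]]].
have [G -> ->] := calG_dataP D; have [o1 o2 _ _] := D => d12.
have e : \det h1 = \det h2.
  have := orth_det_sqr o2; rewrite expr2 => q2.
  by rewrite -[LHS]mulr1 -q2 mulrA d12 mul1r.
have [xJ1 xJ2] := J_conj_even D e.
have [sx _ _] := rhoP G; have [oX _ _] := spin_piP sx.
have [_ [[g11 _ _] [g22 _ _]]] := dec_gram dec.
have [al [be [ga [de [x1 x2 dt]]]]] := plane_of_J (i := 1) (j := 2) (p := 1) (s := 2) isT isT isT sx xJ1.
have [al' [be' [ga' [de' [x3 x4 dt']]]]] := plane_of_J (i := 3) (j := 4) (p := 3) (s := 4) isT isT isT sx xJ2.
have m1 : spin_pi (rho (pairG h1 h2 z1 z2)) *m u1 = u1 *m mx2 al ga be de.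
  by apply: cols_mx2; rewrite col_mulmx.
have m2 : spin_pi (rho (pairG h1 h2 z1 z2)) *m u2 = u2 *m mx2 al' ga' be' de'.
  by apply: cols_mx2; rewrite col_mulmx.
exists (mx2 al ga be de), (mx2 al' ga' be' de'); split=> //.
- exact: orth_block m1.
- exact: orth_block m2.
- by rewrite mx2_det mulrC -dt; ring.
- by rewrite mx2_det -dt'; ring.
Qed.

Lemma rho_F12_odd g : calG g -> dchar g = -1 -> exists a a',
  [/\ orthogonal_group a, orthogonal_group a', \det a = \det a'
    & spin_pi (rho g) *m u1 = u2 *m a /\ spin_pi (rho g) *m u2 = u1 *m a'].
Proof.
move=> /calG_datum [h1 [h2 [z1 [z2 [D ->]]]]].
have [G _ ->] := calG_dataP D; have [o1 o2 _ _] := D => d12.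
have e : \det h1 = - \det h2.
  have := orth_det_sqr o2; rewrite expr2 => q2.
  by rewrite -[LHS]mulr1 -q2 mulrA d12 mulN1r.
have [c [_ xJ1 xJ2]] := J_conj_odd D e.
have [sx _ _] := rhoP G; have [oX _ _] := spin_piP sx.
have [_ [[g11 _ _] [g22 _ _]]] := dec_gram dec.
have [al [be [ga [de [x1 x2 dt]]]]] := plane_of_J (i := 1) (j := 2) (p := 3) (s := 4) isT isT isT sx xJ1.
have [al' [be' [ga' [de' [x3 x4 dt']]]]] := plane_of_J (i := 3) (j := 4) (p := 1) (s := 2) isT isT isT sx xJ2.
have m1 : spin_pi (rho (pairG h1 h2 z1 z2)) *m u1 = u2 *m mx2 al ga be de.
  by apply: cols_mx2; rewrite col_mulmx.
have m2 : spin_pi (rho (pairG h1 h2 z1 z2)) *m u2 = u1 *m mx2 al' ga' be' de'.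
  by apply: cols_mx2; rewrite col_mulmx.
exists (mx2 al ga be de), (mx2 al' ga' be' de'); split=> //.
- exact: orth_block m1.
- exact: orth_block m2.
- by rewrite !mx2_det (mulrC ga) dt (mulrC ga') dt'.
Qed.

End HalfSpin.

(** * Imprimitive groups of orthogonal matrices of size 4 *)

Section SubgroupsH.
Variable R : realType.
Local Notation dg A B := (block_mx A 0 0 B : 'M[R]_(2 + 2)).
Local Notation ad A B := (block_mx 0 A B 0 : 'M[R]_(2 + 2)).
Implicit Types (a b c : 'M[R]_2).

Lemma dg_ad (a a' b b' : 'M[R]_2) : dg a b *m ad a' b' = ad (a *m a') (b *m b').
Proof. by rewrite mulmx_block !mulmx0 !mul0mx !addr0 !add0r. Qed.

Lemma ad_dg (a a' b b' : 'M[R]_2) : ad a b *m dg a' b' = ad (a *m b') (b *m a').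
Proof. by rewrite mulmx_block !mulmx0 !mul0mx !addr0 !add0r. Qed.

Lemma ad_ad (a a' b b' : 'M[R]_2) : ad a b *m ad a' b' = dg (a *m b') (b *m a').
Proof. by rewrite mulmx_block !mulmx0 !mul0mx !addr0 !add0r. Qed.

Lemma dg_tr a b : (dg a b)^T = dg a^T b^T.
Proof. by rewrite tr_block_mx !trmx0. Qed.

Lemma ad_tr a b : (ad a b)^T = ad b^T a^T.
Proof. by rewrite tr_block_mx !trmx0. Qed.

Lemma dg1 : 1%:M = dg 1%:M 1%:M.
Proof. by rewrite (scalar_mx_block 2 2). Qed.

Lemma dg_orth a b : orthogonal_group a -> orthogonal_group b ->
  orthogonal_group (dg a b).
Proof.
rewrite /orthogonal_group /= => oa ob.
by rewrite dg_tr diag_block_mul oa ob -dg1.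
Qed.

Lemma orth_invmx n (a : 'M[R]_n) : orthogonal_group a -> invmx a = a^T.
Proof.
move=> oa; have ua : a \in unitmx by case/mulmx1_unit: oa.
by rewrite -[RHS]mulmx1 -(mulmxV ua) mulmxA oa mul1mx.
Qed.

Lemma theta_ad : theta R = ad 1%:M 1%:M. Proof. by []. Qed.

Lemma swap2_theta : block_mx (swap2 R) 0 0 (- swap2 R) *m theta R
  = ad (swap2 R) (- swap2 R).
Proof. by rewrite theta_ad dg_ad !mulmx1. Qed.

Lemma orthN n (a : 'M[R]_n) : orthogonal_group a -> orthogonal_group (- a).
Proof. by rewrite /orthogonal_group /= => oa; rewrite mulmxN [(- a)^T]linearN /= mulNmx opprK. Qed.

Lemma H2_dg a : orthogonal_group a -> H2 (dg a a).
Proof. by move=> oa; apply: gen_mem; left; exists a. Qed.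

Lemma H2_ad a : orthogonal_group a -> H2 (ad a a).
Proof.
move=> oa; have -> : ad a a = dg a a *m theta R by rewrite theta_ad dg_ad !mulmx1.
by apply: gen_mul; [exact: H2_dg|apply: gen_mem; right].
Qed.

(** The elements listed here are closed under products and inverses. *)
Lemma H2_inv A : H2 A -> exists2 a : 'M[R]_2, orthogonal_group a & A = dg a a \/ A = ad a a.
Proof.
elim=> [|B [[a oa <-]|->]|B B' _ [a oa hB] _ [a' oa' hB']|B _ [a oa hB]].
- by exists 1%:M; [exact: orth1|left; exact: dg1].
- by exists a => //; left.
- by exists 1%:M; [exact: orth1|right].
- exists (a *m a'); first exact: orthM.
  by case: hB hB' => -> [] ->; rewrite ?diag_block_mul ?dg_ad ?ad_dg ?ad_ad; auto.
exists a^T; first exact: orthT.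
have oB : orthogonal_group B.
  case: hB => ->; rewrite /orthogonal_group /= ?dg_tr ?ad_tr ?diag_block_mul ?ad_ad.
    by rewrite oa -dg1.
  by rewrite oa -dg1.
by rewrite orth_invmx //; case: hB => ->; rewrite ?dg_tr ?ad_tr; auto.
Qed.

Lemma mx2_diag k1 k2 : @orthogonal_group R 2 (mx2 k1 0 0 k2) <-> k1 ^+ 2 = 1 /\ k2 ^+ 2 = 1.
Proof.
rewrite /orthogonal_group /= !mx2E; split.
  by move=> /mx2_inj [e1 _ _ e2]; split; [rewrite -e1|rewrite -e2]; ring.
by move=> [e1 e2]; congr mx2; [rewrite -e1| | |rewrite -e2]; ring.
Qed.

Lemma diagO4_dg a : (diagO4 (dg a a) : Prop) <->
  exists k1 k2, [/\ k1 ^+ 2 = 1, k2 ^+ 2 = 1 & a = mx2 k1 0 0 k2].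
Proof.
split.
  move=> [od /is_diag_mxP dd].
  have a01 : a 0 1 = 0.
    have := dd (lshift 2 0) (lshift 2 1) isT.
    by rewrite block_mxEul.
  have a10 : a 1 0 = 0.
    have := dd (lshift 2 1) (lshift 2 0) isT.
    by rewrite block_mxEul.
  exists (a 0 0), (a 1 1).
  have oa : orthogonal_group a.
    move: od; rewrite /orthogonal_group /= dg_tr diag_block_mul dg1.
    by case/eq_block_mx.
  have aE : a = mx2 (a 0 0) 0 0 (a 1 1) by rewrite {1}[a]mx2_eta a01 a10.
  by have := oa; rewrite {1}aE => /mx2_diag [e1 e2].
move=> [k1 [k2 [e1 e2 ->]]]; split.
  by apply: dg_orth; apply/mx2_diag.
apply/is_diag_mxP => i j; rewrite -(splitK i) -(splitK j).
case: (split i) => i'; case: (split j) => j' /=;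
  rewrite ?block_mxEul ?block_mxEur ?block_mxEdl ?block_mxEdr ?mxE //.
all: by move: i' j'; apply: forall_ord2; apply: forall_ord2.
Qed.

Lemma H1_dg k1 k2 : k1 ^+ 2 = 1 -> k2 ^+ 2 = 1 ->
  H1 (dg (mx2 k1 0 0 k2) (mx2 k1 0 0 k2)).
Proof.
move=> e1 e2; apply: gen_mem; left; split.
  by apply/diagO4_dg; exists k1, k2.
by exists (mx2 k1 0 0 k2) => //; apply/mx2_diag.
Qed.

Lemma H1_ad (b1 b2 : R) : b1 ^+ 2 = 1 -> b2 ^+ 2 = 1 ->
  H1 (ad (mx2 0 b1 b2 0) (- mx2 0 b1 b2 0)).
Proof.
move=> e1 e2.
have -> : ad (mx2 0 b1 b2 0) (- mx2 0 b1 b2 0)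
   = dg (mx2 b1 0 0 b2) (mx2 b1 0 0 b2) *m (block_mx (swap2 R) 0 0 (- swap2 R) *m theta R).
  rewrite swap2_theta dg_ad swap2E !mx2E.
  by congr block_mx; congr mx2; ring.
by apply: gen_mul; [exact: H1_dg|apply: gen_mem; right].
Qed.

(** The elements listed here are closed under products and inverses. *)
Lemma H1_inv A : H1 A -> exists k1 k2 : R, [/\ k1 ^+ 2 = 1, k2 ^+ 2 = 1 &
  A = dg (mx2 k1 0 0 k2) (mx2 k1 0 0 k2) \/ A = ad (mx2 0 k1 k2 0) (- mx2 0 k1 k2 0)].
Proof.
elim=> [|B [[dB [a oa aB]]|->]|B B' _ [k1 [k2 [e1 e2 hB]]] _ [k1' [k2' [e1' e2' hB']]]|B _ [k1 [k2 [e1 e2 hB]]]].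
- by exists 1, 1; rewrite !expr1n; split=> //; left; rewrite -mx2S -dg1.
- move: dB; rewrite -aB => /diagO4_dg [k1 [k2 [e1 e2 aE]]].
  by exists k1, k2; split=> //; left; rewrite aE.
- by exists 1, 1; rewrite !expr1n; split=> //; right; rewrite swap2_theta swap2E.
- have eM x y : x ^+ 2 = 1 -> y ^+ 2 = 1 -> (x * y) ^+ 2 = 1 :> R.
    by move=> hx hy; rewrite exprMn hx hy mulr1.
  have eN x : x ^+ 2 = 1 -> (- x) ^+ 2 = 1 :> R by rewrite sqrrN.
  case: hB hB' => -> [] ->; rewrite ?diag_block_mul ?dg_ad ?ad_dg ?ad_ad !mx2E.
  + exists (k1 * k1'), (k2 * k2'); split; [exact: eM|exact: eM|left].
    by rewrite ?mx2E; congr block_mx; congr mx2; ring.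
  + exists (k1 * k1'), (k2 * k2'); split; [exact: eM|exact: eM|right].
    by rewrite ?mx2E; congr block_mx; congr mx2; ring.
  + exists (k1 * k2'), (k2 * k1'); split; [exact: eM|exact: eM|right].
    by rewrite ?mx2E; congr block_mx; congr mx2; ring.
  + exists (- (k1 * k2')), (- (k2 * k1')); split; [exact/eN/eM|exact/eN/eM|left].
    by rewrite ?mx2E; congr block_mx; congr mx2; ring.
have oB : orthogonal_group B.
  case: hB => ->; first by apply: dg_orth; apply/mx2_diag.
  rewrite /orthogonal_group /= ad_tr ad_ad !mx2E dg1 mx2S.
  by congr block_mx; congr mx2; first [ring|rewrite -e1; ring|rewrite -e2; ring].
rewrite orth_invmx //; case: hB => ->; rewrite ?dg_tr ?ad_tr !mx2E.
  by exists k1, k2; split=> //; left.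
exists (- k2), (- k1); rewrite !sqrrN; split=> //; right.
by rewrite !mx2E; congr block_mx; congr mx2; ring.
Qed.

(** The conjugating matrix is the rotation by minus half the angle of (x, y):
    by the half-angle formulas its first row is proportional to (1 + x, y), a
    vector of norm the square root of 2 (1 + x). The case x = -1 is the swap.
    *)
Lemma reflection_diag a : orthogonal_group a -> \det a = -1 ->
  exists2 n, orthogonal_group n & n *m a *m n^T = mx2 1 0 0 (-1).
Proof.
move=> oa da; have [x [y [e [[_ d1]|[-> _]]]]] := orth2P oa.
  have /eqP := etrans (esym da) d1; rewrite -subr_eq0 -opprD oppr_eq0.
  by rewrite -[1 + 1]/(2%:R) pnatr_eq0.
rewrite /refl; have [x1|x1] := eqVneq x (-1).
  have y0 : y = 0.
    by apply/eqP; rewrite -sqrf_eq0; apply/eqP; move: e; rewrite x1 sqrrN expr1n; lra.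
  exists (mx2 0 1 1 0); rewrite /orthogonal_group /= !mx2E ?x1 ?y0.
    by congr mx2; ring.
  by congr mx2; ring.
have p0 : 0 < 2 * (1 + x).
  have xm : -1 <= x by have := sqr_ge0 y; move: e {da oa}; nra.
  have : -1 < x by rewrite lt_neqAle eq_sym x1.
  by lra.
pose t := (Num.sqrt (2 * (1 + x)))^-1.
have T : t ^+ 2 * (2 * (1 + x)) = 1.
  by rewrite exprVn sqr_sqrtr ?ltW // mulVf // gt_eqF.
have s0 : x ^+ 2 + y ^+ 2 - 1 = 0 by rewrite e subrr.
exists (t *: mx2 (1 + x) y (- y) (1 + x)).
  rewrite /orthogonal_group /= !mx2E; congr mx2; last 1 first.
  - by transitivity (t ^+ 2 * (2 * (1 + x)) + t ^+ 2 * (x ^+ 2 + y ^+ 2 - 1));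
      [ring|rewrite s0 mulr0 addr0].
  - by transitivity (t ^+ 2 * (2 * (1 + x)) + t ^+ 2 * (x ^+ 2 + y ^+ 2 - 1));
      [ring|rewrite s0 mulr0 addr0].
  - by ring.
  - by ring.
rewrite !mx2E; congr mx2.
- by transitivity (t ^+ 2 * (2 * (1 + x)) + t ^+ 2 * (2 + x) * (x ^+ 2 + y ^+ 2 - 1));
    [ring|rewrite s0 mulr0 addr0].
- by transitivity (- t ^+ 2 * y * (x ^+ 2 + y ^+ 2 - 1)); [ring|rewrite s0 mulr0].
- by transitivity (- t ^+ 2 * y * (x ^+ 2 + y ^+ 2 - 1)); [ring|rewrite s0 mulr0].
by transitivity (- (t ^+ 2 * (2 * (1 + x))) - t ^+ 2 * (2 + x) * (x ^+ 2 + y ^+ 2 - 1));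
    [ring|rewrite s0 mulr0 subr0 T].
Qed.

(** A reflection or rotation is determined by its first column (x, y). The
    diagonal entries of the relation give equal x, hence y' = y or y' = -y;
    the second case with y nonzero would require r = -q. *)
Lemma orth_intertwine_eq a a' (r q : R) : orthogonal_group a -> orthogonal_group a' ->
  \det a = \det a' -> q != 0 -> 0 <= r * q ->
  a *m mx2 r 0 0 q = mx2 r 0 0 q *m a' -> a = a'.
Proof.
move=> oa oa' dd q0 rq.
have [x [y [e Ha]]] := orth2P oa; have [x' [y' [e' Ha']]] := orth2P oa'.
have core : y * q = r * y' -> y * r = q * y' -> x = x' -> y = y'.
  move=> h1 h2 xx; have y2 : y ^+ 2 = y' ^+ 2.
    by apply: (addrI (x ^+ 2)); rewrite e xx e'.
  have /eqP := y2; rewrite eqf_sqr => /orP[]/eqP // yy.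
  have /eqP : (r + q) * y' = 0 by move: h1; rewrite yy => h1; rewrite mulrDl -h1; ring.
  rewrite mulf_eq0 => /orP[|/eqP y'0]; last by rewrite yy y'0 oppr0.
  rewrite addr_eq0 => /eqP rE; exfalso; move: rq; rewrite rE mulNr -expr2 oppr_ge0.
  by rewrite leNgt lt_neqAle sqr_ge0 eq_sym sqrf_eq0 q0.
case: Ha Ha' => -[aE da] [] [aE' da']; rewrite da da' in dd; rewrite aE aE'.
- rewrite /rot !mx2E => /mx2_inj [_ h1 h2 h3].
  have xx : x = x' by apply: (mulIf q0); move: h3; lra.
  by rewrite xx core //; [move: h1|move: h2]; lra.
- exfalso; have /eqP := dd; rewrite -addr_eq0 -[1 + 1]/(2%:R) pnatr_eq0 //.
- exfalso; have /eqP := esym dd; rewrite -addr_eq0 -[1 + 1]/(2%:R) pnatr_eq0 //.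
rewrite /refl !mx2E => /mx2_inj [_ h1 h2 h3].
have xx : x = x' by apply: (mulIf q0); move: h3; lra.
by rewrite xx core //; [move: h1|move: h2]; lra.
Qed.

Lemma orth_antidiag a : orthogonal_group a -> a 0 0 = 0 -> a 1 1 = 0 ->
  exists b1 b2 : R, [/\ b1 ^+ 2 = 1, b2 ^+ 2 = 1 & a = mx2 0 b1 b2 0].
Proof.
move=> oa a0 a1; have aE : a = mx2 0 (a 0 1) (a 1 0) 0.
  by rewrite {1}[a]mx2_eta a0 a1.
exists (a 0 1), (a 1 0); split=> //; move: oa; rewrite {1}aE /orthogonal_group /= !mx2E;
  by move=> /mx2_inj [h1 _ _ h2]; move: h1 h2; rewrite !expr2; lra.
Qed.

Lemma orth_diag a : orthogonal_group a -> a 0 1 = 0 -> a 1 0 = 0 ->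
  exists b1 b2 : R, [/\ b1 ^+ 2 = 1, b2 ^+ 2 = 1 & a = mx2 b1 0 0 b2].
Proof.
move=> oa a0 a1; have aE : a = mx2 (a 0 0) 0 0 (a 1 1).
  by rewrite {1}[a]mx2_eta a0 a1.
exists (a 0 0), (a 1 1); have := oa; rewrite {1}aE => /mx2_diag [e1 e2].
by split.
Qed.

End SubgroupsH.

Section Imprimitive.
Variables (R : realType) (Gamma : groupType).
Local Notation dg A B := (block_mx A 0 0 B : 'M[R]_(2 + 2)).
Local Notation ad A B := (block_mx 0 A B 0 : 'M[R]_(2 + 2)).

(** The action on F_1 + F_2 of a subgroup of calG. The character delta is the
    signature on the pair {F_1, F_2}; eta is the determinant on F_1 and on F_2
    where both are stable, and it is an independent datum on the elements
    exchanging them. *)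
Record imprimitive (A : Gamma -> 'M[R]_(2 + 2)) (eta delta : Gamma -> R) : Prop := {
  imprM : forall g h, A (g * h)%g = A g *m A h;
  impr_etaM : forall g h, eta (g * h)%g = eta g * eta h;
  impr_deltaM : forall g h, delta (g * h)%g = delta g * delta h;
  impr_eta : forall g, eta g = 1 \/ eta g = -1;
  impr_delta : forall g, delta g = 1 \/ delta g = -1;
  impr_even : forall g, delta g = 1 -> exists a a', [/\ orthogonal_group a,
    orthogonal_group a', \det a = eta g, \det a' = eta g & A g = dg a a'];
  impr_odd : forall g, delta g = -1 -> exists a a', [/\ orthogonal_group a,
    orthogonal_group a', \det a = \det a' & A g = ad a' a] }.

(** The symmetrised compression to F_1 + F_2 of an element conjugating r to
    eta r. In the last field v and w are the eigenvectors for -1 of a pair of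
    reflections; the matrix of Y on the plane of (v, 0) and (0, w) is
    symmetric with trace 0 and determinant -1, which is how being a reflection
    on this plane is expressed. *)
Record mirror (A : Gamma -> 'M[R]_(2 + 2)) (eta delta : Gamma -> R)
    (Y : 'M[R]_(2 + 2)) : Prop := {
  mirror_sym : Y^T = Y;
  mirror_comm : forall g, Y *m A g = A g *m Y;
  mirror_refl : forall g a a' (v w : 'cV[R]_2), delta g = 1 -> eta g = -1 ->
    A g = dg a a' -> v^T *m v = 1%:M -> w^T *m w = 1%:M ->
    a *m v = - v -> a' *m w = - w ->
    (v^T *m ulsubmx Y *m v) 0 0 + (w^T *m drsubmx Y *m w) 0 0 = 0 /\
    (v^T *m ulsubmx Y *m v) 0 0 ^+ 2 + (v^T *m ursubmx Y *m w) 0 0 ^+ 2 = 1 }.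

Definition conj_dg (n n' : 'M[R]_2) (M : 'M[R]_(2 + 2)) : 'M[R]_(2 + 2) :=
  dg n n' *m M *m (dg n n')^T.

Lemma conj_dgM n n' M M' : orthogonal_group n -> orthogonal_group n' ->
  conj_dg n n' (M *m M') = conj_dg n n' M *m conj_dg n n' M'.
Proof.
move=> on on'; rewrite /conj_dg -!mulmxA; congr (_ *m (_ *m _)).
by rewrite !mulmxA (dg_orth on on') mul1mx.
Qed.

Lemma conj_dg_dg n n' (a a' : 'M[R]_2) :
  conj_dg n n' (dg a a') = dg (n *m a *m n^T) (n' *m a' *m n'^T).
Proof. by rewrite /conj_dg dg_tr !diag_block_mul. Qed.

Lemma conj_dg_ad n n' (a a' : 'M[R]_2) :
  conj_dg n n' (ad a a') = ad (n *m a *m n'^T) (n' *m a' *m n^T).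
Proof. by rewrite /conj_dg dg_tr dg_ad ad_dg. Qed.

Lemma conj_dg_comp m m' n n' M :
  conj_dg m m' (conj_dg n n' M) = conj_dg (m *m n) (m' *m n') M.
Proof. by rewrite /conj_dg -diag_block_mul trmx_mul !mulmxA. Qed.

Lemma det_orth_conj (n n' a : 'M[R]_2) :
  \det (n *m a *m n'^T) = \det n * \det n' * \det a.
Proof. by rewrite !det_mulmx det_tr mulrAC. Qed.

Lemma orth_conj (n n' a : 'M[R]_2) : orthogonal_group n -> orthogonal_group n' ->
  orthogonal_group a -> orthogonal_group (n *m a *m n'^T).
Proof. by move=> on on' oa; apply: orthM; [exact: orthM|exact: orthT]. Qed.

Lemma imprimitive_conj A eta delta n n' : orthogonal_group n -> orthogonal_group n' ->
  imprimitive A eta delta -> imprimitive (fun g => conj_dg n n' (A g)) eta delta.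
Proof.
move=> on on' [i1 i2 i3 i4 i5 i6 i7].
have dn : \det n * \det n = 1 by rewrite -expr2 orth_det_sqr.
have dn' : \det n' * \det n' = 1 by rewrite -expr2 orth_det_sqr.
split=> //.
- by move=> g h; rewrite i1 conj_dgM.
- move=> g /i6 [a [a' [oa oa' da da' ->]]]; rewrite conj_dg_dg.
  exists (n *m a *m n^T), (n' *m a' *m n'^T); split=> //; try exact: orth_conj.
    by rewrite det_orth_conj dn mul1r.
  by rewrite det_orth_conj dn' mul1r.
move=> g /i7 [a [a' [oa oa' da ->]]]; rewrite conj_dg_ad.
exists (n' *m a *m n^T), (n *m a' *m n'^T); split=> //; try exact: orth_conj.
by rewrite !det_orth_conj da (mulrC (\det n)).
Qed.

Lemma dg_cancel n n' M : orthogonal_group n -> orthogonal_group n' ->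
  conj_dg n^T n'^T (conj_dg n n' M) = M.
Proof.
move=> on on'; rewrite conj_dg_comp on on' /conj_dg -dg1 mul1mx trmx1.
by rewrite mulmx1.
Qed.

Lemma conj_dg_block n n' (Y : 'M[R]_(2 + 2)) : conj_dg n n' Y =
  block_mx (n *m ulsubmx Y *m n^T) (n *m ursubmx Y *m n'^T)
           (n' *m dlsubmx Y *m n^T) (n' *m drsubmx Y *m n'^T).
Proof.
rewrite -{1}[Y]submxK /conj_dg dg_tr !mulmx_block.
by rewrite !(mulmx0, mul0mx, addr0, add0r).
Qed.

Lemma mirror_conj A eta delta n n' Y : orthogonal_group n -> orthogonal_group n' ->
  mirror A eta delta Y ->
  mirror (fun g => conj_dg n n' (A g)) eta delta (conj_dg n n' Y).
Proof.
move=> on on' [sy cy ry]; split.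
- by rewrite /conj_dg !trmx_mul trmxK sy mulmxA.
- by move=> g; rewrite -!conj_dgM // cy.
move=> g a a' v w dg1 eg Ag v1 w1 av aw.
have uv : (n^T *m v)^T *m (n^T *m v) = 1%:M.
  by rewrite trmx_mul trmxK mulmxA -(mulmxA v^T) (mulmx1C on) mulmx1.
have uw : (n'^T *m w)^T *m (n'^T *m w) = 1%:M.
  by rewrite trmx_mul trmxK mulmxA -(mulmxA w^T) (mulmx1C on') mulmx1.
have Ag' : A g = dg (n^T *m a *m n) (n'^T *m a' *m n').
  by rewrite -[A g](dg_cancel _ on on') Ag conj_dg_dg !trmxK.
have nn : n *m n^T = 1%:M by apply: mulmx1C.
have nn' : n' *m n'^T = 1%:M by apply: mulmx1C.
have ev : (n^T *m a *m n) *m (n^T *m v) = - (n^T *m v).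
  by rewrite -!mulmxA (mulmxA n) nn mul1mx av mulmxN.
have ew : (n'^T *m a' *m n') *m (n'^T *m w) = - (n'^T *m w).
  by rewrite -!mulmxA (mulmxA n') nn' mul1mx aw mulmxN.
have := ry g _ _ _ _ dg1 eg Ag' uv uw ev ew.
rewrite conj_dg_block block_mxKul block_mxKur block_mxKdr.
by rewrite !trmx_mul !trmxK !mulmxA.
Qed.

(** Y commutes with diag(d, d), so that its four blocks are diagonal: diag(p',
    p) and diag(q', s) on the diagonal, and twice diag(r, q). The block
    diag(r, q) intertwines the actions on the two planes. If q is nonzero and
    r q >= 0, it forces the two blocks of each element to be equal, and the
    group lies in H_2; the sign condition is obtained by conjugating the first
    plane by d. If q = 0, the reflection property gives s = -p and p^2 = 1,
    and an element exchanging the planes gives p' = -p and q' = p. Commuting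
    with Y then makes all the blocks monomial, and the group lies in H_1 or in
    H_2. *)
Lemma imprimitive_mirror_H A eta delta Y (d := mx2 1 0 0 (-1) : 'M[R]_2) g0 k0 :
    imprimitive A eta delta -> mirror A eta delta Y ->
    delta g0 = -1 -> delta k0 = 1 -> eta k0 = -1 -> A k0 = dg d d ->
  exists n, orthogonal_group n /\
    ((forall g, H1 (conj_dg n 1%:M (A g))) \/ (forall g, H2 (conj_dg n 1%:M (A g)))).
Proof.
move=> hA hY g0d k0d k0e k0A.
have od : orthogonal_group d by apply/mx2_diag; rewrite sqrrN !expr1n.
(* Conjugating the first plane by d changes the sign of q and fixes r and k0.
   *)
wlog : A Y hA hY k0A / 0 <= (Y (lshift 2 0) (rshift 2 0)) * (Y (lshift 2 1) (rshift 2 1)).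
  move=> W; have [rq|rq] := leP 0 (Y (lshift 2 0) (rshift 2 0) * Y (lshift 2 1) (rshift 2 1)).
    exact: (W A Y).
  have o1 := @orth1 R 2.
  have [||||n [on Hn]] := W (fun g => conj_dg d 1%:M (A g)) (conj_dg d 1%:M Y).
  - exact: imprimitive_conj.
  - exact: mirror_conj.
  - rewrite k0A conj_dg_dg trmx1 mul1mx mulmx1; congr block_mx.
    by rewrite /d !mx2E; congr mx2; ring.
  - rewrite conj_dg_block !block_mxEur trmx1 !mulmx1.
    rewrite [ursubmx Y]mx2_eta !mx2E !mxE /=.
    by move: rq; rewrite !mul0r !mul1r !addr0 !add0r mulN1r mulrN oppr_ge0 => /ltW.
  exists (n *m d); split; first exact: orthM.
  by case: Hn => Hn; [left|right] => g; have := Hn g; rewrite conj_dg_comp mulmx1.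
move=> rq; exists 1%:M; split; first exact: orth1.
have c1 M : conj_dg 1%:M 1%:M M = M by rewrite /conj_dg -dg1 mul1mx trmx1 mulmx1.
suff : (forall g, H1 (A g)) \/ (forall g, H2 (A g)).
  by case=> H; [left|right] => g; rewrite c1.
case: hA => i1 i2 i3 i4 i5 i6 i7; case: hY => sy cy ry.
have diag_of_comm (M : 'M[R]_2) : M *m d = d *m M -> M = mx2 (M 0 0) 0 0 (M 1 1).
  rewrite {1 2}[M]mx2_eta /d !mx2E => /mx2_inj [_ h1 h2 _].
  rewrite {1}[M]mx2_eta; congr mx2; [move: h1|move: h2]; lra.
have := cy k0; rewrite k0A -[Y]submxK mulmx_block (mulmx_block d).
rewrite !mulmx0 !mul0mx !addr0 !add0r => /eq_block_mx.
case=> /diag_of_comm E11 /diag_of_comm E12 /diag_of_comm E21 /diag_of_comm E22.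
have s21 : dlsubmx Y = ursubmx Y.
  have := congr1 (@dlsubmx _ 2 2 2 2) sy; rewrite -[Y]submxK tr_block_mx !block_mxKdl.
  rewrite !block_mxKur => <-; rewrite E12 mx2T.
  by [].
move: rq.
have -> : Y (lshift 2 0) (rshift 2 0) = ursubmx Y 0 0 by rewrite !mxE.
have -> : Y (lshift 2 1) (rshift 2 1) = ursubmx Y 1 1 by rewrite !mxE.
move: cy ry; rewrite -[Y]submxK s21 block_mxKul block_mxKur block_mxKdr.
move: E11 E12 E22.
set p' : R := ulsubmx Y 0 0; set p : R := ulsubmx Y 1 1; set r : R := ursubmx Y 0 0.
set q : R := ursubmx Y 1 1; set q' : R := drsubmx Y 0 0; set s : R := drsubmx Y 1 1.
move=> -> -> -> cy ry rq; clearbody p' p r q q' s; clear sy E21 s21 Y.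
have ceven g a a' : A g = dg a a' ->
  [/\ a *m mx2 p' 0 0 p = mx2 p' 0 0 p *m a, a *m mx2 r 0 0 q = mx2 r 0 0 q *m a'
    & a' *m mx2 q' 0 0 s = mx2 q' 0 0 s *m a'].
  move=> Ag; have := cy g; rewrite Ag mulmx_block (mulmx_block a).
  rewrite !mulmx0 !mul0mx !addr0 !add0r => /eq_block_mx [-> -> _ ->].
  by [].
have codd g a a' : A g = ad a' a ->
  [/\ a' *m mx2 r 0 0 q = mx2 r 0 0 q *m a,
     mx2 p' 0 0 p *m a' = a' *m mx2 q' 0 0 s & mx2 q' 0 0 s *m a = a *m mx2 p' 0 0 p].
  move=> Ag; have := cy g; rewrite Ag mulmx_block (mulmx_block 0 a').
  by rewrite !mulmx0 !mul0mx !addr0 !add0r => /eq_block_mx [-> -> -> _].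
have refl2 (v w : 'cV[R]_2) a a' g : delta g = 1 -> eta g = -1 -> A g = dg a a' ->
    v^T *m v = 1%:M -> w^T *m w = 1%:M -> a *m v = - v -> a' *m w = - w ->
    (v^T *m mx2 p' 0 0 p *m v) 0 0 + (w^T *m mx2 q' 0 0 s *m w) 0 0 = 0 /\
    (v^T *m mx2 p' 0 0 p *m v) 0 0 ^+ 2 + (v^T *m mx2 r 0 0 q *m w) 0 0 ^+ 2 = 1.
  by move=> *; apply: (ry g a a').
clear cy ry.
(* A nonzero q intertwines the two planes strongly enough to identify them. *)
have [q0|q0] := eqVneq q 0; last first.
  right=> g; case: (i5 g) => dg.
    have [a [a' [oa oa' da da' Ag]]] := i6 g dg.
    have [_ e _] := ceven _ _ _ Ag.
    rewrite Ag -(orth_intertwine_eq oa oa' (etrans da (esym da')) q0 rq e).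
    exact: H2_dg.
  have [a [a' [oa oa' da Ag]]] := i7 g dg.
  have [e _ _] := codd _ _ _ Ag.
  rewrite Ag (orth_intertwine_eq oa' oa (esym da) q0 rq e).
  exact: H2_ad.
pose e0 : 'cV[R]_2 := delta_mx 0 0; pose e1 : 'cV[R]_2 := delta_mx 1 0.
have quad (M : 'M[R]_2) i j : (delta_mx i 0)^T *m M *m (delta_mx j 0 : 'cV[R]_2) = (M i j)%:M.
  rewrite [LHS]mx11_scalar; congr (_%:M).
  by rewrite trmx_delta -rowE -colE !mxE.
have eu i : (delta_mx i 0)^T *m (delta_mx i 0 : 'cV[R]_2) = 1%:M.
  by rewrite -[(_)^T]mulmx1 quad !mxE eqxx.
have eig (M : 'M[R]_2) : M = mx2 1 0 0 (-1) -> M *m e1 = - e1.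
  move=> ->; apply/matrixP; apply: forall_ord2 => j;
  rewrite !mxE !big_ord_recl big_ord0 !mxE /= ord1; ring.
have eig' (M : 'M[R]_2) : M = mx2 (-1) 0 0 1 -> M *m e0 = - e0.
  move=> ->; apply/matrixP; apply: forall_ord2 => j;
  rewrite !mxE !big_ord_recl big_ord0 !mxE /= ord1; ring.
have [ps pq] : p + s = 0 /\ p ^+ 2 = 1.
  have [h1 h2] := refl2 e1 e1 d d k0 k0d k0e k0A (eu _) (eu _) (eig _ erefl) (eig _ erefl).
  move: h1 h2; rewrite !quad !mxE eqxx q0 !mulr1n [0 ^+ 2]expr0n addr0.
  by split.
have p0 : p != 0.
  by apply/eqP => p0; move: pq; rewrite p0 expr0n => /eqP; rewrite eq_sym oner_eq0.
have sE : s = - p by apply/eqP; rewrite -addr_eq0 addrC ps.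
have [a0 [a0' [oa0 oa0' da0 A0]]] := i7 g0 g0d.
have [_ y1 y2] := codd _ _ _ A0.
(* M maps the eigenlines of one diagonal block of Y to those of the other. *)
have ent (M : 'M[R]_2) x y x' y' : mx2 x 0 0 y *m M = M *m mx2 x' 0 0 y' ->
   [/\ x * M 0 0 = x' * M 0 0, x * M 0 1 = y' * M 0 1,
       y * M 1 0 = x' * M 1 0 & y * M 1 1 = y' * M 1 1].
  rewrite {1 2}[M]mx2_eta !mx2E => /mx2_inj [h1 h2 h3 h4].
  by split; [move: h1|move: h2|move: h3|move: h4]; lra.
have [_ z2 z3 z4] := ent _ _ _ _ _ y1.
have a11 : a0' 1 1 = 0.
  have /eqP : (2 * p) * a0' 1 1 = 0 by move: z4; rewrite sE; lra.
  by rewrite !mulf_eq0 pnatr_eq0 (negPf p0) /= => /eqP.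
have orth_entries (M : 'M[R]_2) : orthogonal_group M ->
    M 0 0 ^+ 2 + M 1 0 ^+ 2 = 1 /\ M 0 1 ^+ 2 + M 1 1 ^+ 2 = 1.
  rewrite /orthogonal_group /= [M]mx2_eta !mx2E => /mx2_inj [h1 _ _ h2].
  by rewrite !mxE /= !expr2.
have orth_rows (M : 'M[R]_2) : orthogonal_group M ->
    M 0 0 ^+ 2 + M 0 1 ^+ 2 = 1 /\ M 1 0 ^+ 2 + M 1 1 ^+ 2 = 1.
  by move=> /orthT /orth_entries; rewrite !mxE.
have nz (x : R) : x ^+ 2 = 1 -> x != 0.
  by move=> x1; apply/eqP => x0; move: x1; rewrite x0 expr0n => /eqP; rewrite eq_sym oner_eq0.
have [_ n1] := orth_entries _ oa0'; have [_ n2] := orth_rows _ oa0'.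
rewrite a11 expr0n /= addr0 in n1; rewrite a11 expr0n /= addr0 in n2.
have p'E : p' = - p by apply: (mulIf (nz _ n1)); rewrite z2 sE.
have q'E : q' = p by apply: (mulIf (nz _ n2)); rewrite z3.
have evens g : delta g = 1 -> exists k1 k2, [/\ k1 ^+ 2 = 1, k2 ^+ 2 = 1 &
    A g = dg (mx2 k1 0 0 k2) (mx2 k1 0 0 k2)].
  move=> dg1.
  have base h : delta h = 1 -> exists k1 k2 k1' k2', [/\ [/\ k1 ^+ 2 = 1, k2 ^+ 2 = 1,
     k1' ^+ 2 = 1 & k2' ^+ 2 = 1], k1 * k2 = eta h, k1' * k2' = eta h
     & A h = dg (mx2 k1 0 0 k2) (mx2 k1' 0 0 k2')].
    move=> dh; have [a [a' [oa oa' da da' Ah]]] := i6 h dh.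
    have [c1' _ c2'] := ceven _ _ _ Ah.
    have offdiag (M : 'M[R]_2) x y : x != y -> M *m mx2 x 0 0 y = mx2 x 0 0 y *m M ->
        M 0 1 = 0 /\ M 1 0 = 0.
      move=> xy /esym /ent [_ h1 h2 _].
      have xy0 : x - y != 0 by rewrite subr_eq0.
      by split; apply: (mulfI xy0); rewrite mulr0 mulrBl; [rewrite h1|rewrite h2]; rewrite subrr.
    have pN : p != - p.
      by rewrite -addr_eq0 -mulr2n mulrn_eq0.
    have [|f1 f2] := offdiag a _ _ _ c1'; first by rewrite p'E eq_sym.
    have [|f3 f4] := offdiag a' _ _ _ c2'; first by rewrite q'E sE.
    have [k1 [k2 [x1 x2 aE]]] := orth_diag oa f1 f2.
    have [k1' [k2' [x3 x4 aE']]] := orth_diag oa' f3 f4.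
    exists k1, k2, k1', k2'; split=> //.
    - by rewrite -da aE mx2_det mulr0 subr0.
    - by rewrite -da' aE' mx2_det mulr0 subr0.
    by rewrite Ah aE aE'.
  (* Blocks diag(1, -1) and diag(-1, 1) in the same element would pair the
     eigenvalues p and p, or -p and -p, of Y on a plane where its trace is 0.
     *)
  have neg h : delta h = 1 -> eta h = -1 -> exists k1 k2, [/\ k1 ^+ 2 = 1, k2 ^+ 2 = 1 &
    A h = dg (mx2 k1 0 0 k2) (mx2 k1 0 0 k2)].
    move=> dh eh; have [k1 [k2 [k1' [k2' [[x1 x2 x3 x4] e12 e12' Ah]]]]] := base h dh.
    rewrite eh in e12 e12'.
    have sg (x y : R) : x ^+ 2 = 1 -> x * y = -1 -> (x = 1 /\ y = -1) \/ (x = -1 /\ y = 1).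
      move=> /eqP; rewrite sqrf_eq1 => /orP[]/eqP -> h1; [left|right]; split=> //; lra.
    have bad (P : Prop) : 2 * p = 0 -> P.
      by move/eqP; rewrite mulf_eq0 pnatr_eq0 (negPf p0).
    case: (sg _ _ x1 e12) (sg _ _ x3 e12') => -[k1E k2E] [] [k1E' k2E'];
      rewrite k1E k2E k1E' k2E' in Ah *.
    - by exists 1, (-1); rewrite sqrrN expr1n.
    - apply: bad; have [h1 _] := refl2 e1 e0 _ _ _ dh eh Ah (eu _) (eu _) (eig _ erefl) (eig' _ erefl).
      by move: h1; rewrite !quad !mxE /= !mulr1n q'E => <-; ring.
    - apply: bad; have [h1 _] := refl2 e0 e1 _ _ _ dh eh Ah (eu _) (eu _) (eig' _ erefl) (eig _ erefl).
      move: h1; rewrite !quad !mxE /= !mulr1n p'E sE => h1.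
      by apply: oppr_inj; rewrite oppr0 -h1; ring.
    by exists (-1), 1; rewrite sqrrN expr1n.
  case: (i4 g) => eg; last exact: neg.
  have [||k1 [k2 [x1 x2 E]]] := neg (g * k0)%g.
  - by rewrite i3 dg1 k0d mulr1.
  - by rewrite i2 eg k0e mul1r.
  exists k1, (- k2); rewrite sqrrN; split=> //.
  have dd : dg d d *m dg d d = 1%:M.
    have -> : dg d d *m dg d d = dg 1%:M 1%:M.
      by rewrite diag_block_mul /d !mx2E; congr block_mx; congr mx2; ring.
    by rewrite (scalar_mx_block 2 2).
  have := congr1 (fun M => M *m dg d d) E; rewrite i1 k0A -mulmxA dd mulmx1 => ->.
  by rewrite diag_block_mul /d !mx2E; congr block_mx; congr mx2; ring.
(* Y forces both blocks to be antidiagonal, and the equality of determinants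
   leaves one sign free. *)
have odds g : delta g = -1 -> exists b1 b2, [/\ b1 ^+ 2 = 1, b2 ^+ 2 = 1 &
    A g = ad (mx2 0 b1 b2 0) (mx2 0 b1 b2 0) \/ A g = ad (mx2 0 b1 b2 0) (- mx2 0 b1 b2 0)].
  move=> dg1; have [a [a' [oa oa' da Ag]]] := i7 g dg1.
  have [_ y1' y2'] := codd _ _ _ Ag.
  have pN (x : R) : p * x = - p * x -> x = 0.
    move=> h; have /eqP : (2 * p) * x = 0 by lra.
    by rewrite !mulf_eq0 pnatr_eq0 (negPf p0) /= => /eqP.
  have [f1 _ _ f2] := ent _ _ _ _ _ y1'; have [f3 _ _ f4] := ent _ _ _ _ _ y2'.
  rewrite ?p'E ?q'E ?sE in f1 f2 f3 f4.
  have [b1 [b2 [x1 x2 aE]]] := orth_antidiag oa' (pN _ (esym f1)) (pN _ f2).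
  have [b1' [b2' [x3 x4 aE']]] := orth_antidiag oa (pN _ f3) (pN _ (esym f4)).
  exists b1, b2; split=> //; rewrite Ag aE aE'.
  have bb : b1' * b2' = b1 * b2.
    move: da; rewrite aE aE' !mx2_det mulr0 !sub0r => /oppr_inj.
    by [].
  have /eqP := etrans x3 (esym x1); rewrite eqf_sqr => /orP[]/eqP b1E; [left|right].
    by congr block_mx; rewrite b1E; congr mx2; apply: (mulfI (nz _ x1)); rewrite -bb b1E.
  congr block_mx; rewrite !mx2E b1E !oppr0; congr mx2.
  by apply: (mulfI (nz _ x1)); rewrite mulrN -bb b1E mulNr opprK.
have [b1 [b2 [x1 x2 Hg0]]] := odds g0 g0d; clear c1.
(* Elements with the two signs cannot coexist: their product would be even
   with opposite diagonal blocks. *)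
have clash g (c1 c2 : R) (e : bool) : delta g = -1 -> c1 ^+ 2 = 1 -> c2 ^+ 2 = 1 ->
   A g = ad (mx2 0 c1 c2 0) ((-1) ^+ e *: mx2 0 c1 c2 0) ->
   A g0 = ad (mx2 0 b1 b2 0) (- (-1) ^+ e *: mx2 0 b1 b2 0) -> False.
  move=> dg1 y3 y4 Ag Ag0.
  have [|k1 [k2 [w1 w2 E]]] := evens (g * g0)%g.
    by rewrite i3 dg1 g0d mulrNN mulr1.
  move: E; rewrite i1 Ag Ag0 ad_ad !mx2E => /eq_block_mx [] /mx2_inj [h1 _ _ _] _ _.
  move=> /mx2_inj [h2 _ _ _].
  have := nz _ w1; have -> : k1 = 0; last by rewrite eqxx.
  have : (-1) ^+ e * (-1) ^+ e = 1 :> R by rewrite -expr2 sqrr_sign.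
  move: h1 h2; move: ((-1) ^+ e) => t h1 h2 tt.
  have h3 : k1 = - (t * (c1 * b2)) by rewrite -h1; ring.
  have h4 : k1 = t * (c1 * b2) by rewrite -h2; ring.
  lra.
have Hdiag k1 k2 : k1 ^+ 2 = 1 -> k2 ^+ 2 = 1 -> @orthogonal_group R 2 (mx2 k1 0 0 k2).
  by move=> *; apply/mx2_diag.
have Hanti k1 k2 : k1 ^+ 2 = 1 -> k2 ^+ 2 = 1 -> @orthogonal_group R 2 (mx2 0 k1 k2 0).
  move=> h1 h2; rewrite /orthogonal_group /= !mx2E.
  by congr mx2; [rewrite -h2| | |rewrite -h1]; ring.
case: Hg0 => Hg0; [right|left] => g; case: (i5 g) => dg1.
- have [k1 [k2 [y3 y4 ->]]] := evens g dg1.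
  by apply: H2_dg; apply: Hdiag.
- have [c1 [c2 [y3 y4 [->|Ag]]]] := odds g dg1; first by apply: H2_ad; apply: Hanti.
  exfalso; apply: (@clash g c1 c2 true) => //; first by rewrite Ag scaleN1r.
  by rewrite Hg0 opprK scale1r.
- have [k1 [k2 [y3 y4 ->]]] := evens g dg1.
  exact: H1_dg.
have [c1 [c2 [y3 y4 [Ag|->]]]] := odds g dg1; last exact: H1_ad.
exfalso; apply: (@clash g c1 c2 false) => //; first by rewrite Ag scale1r.
by rewrite Hg0 scaleN1r.
Qed.

(** Each block of k0 has determinant -1, so it can be brought to the form
    diag(1, -1) by conjugation in its plane. *)
Lemma imprimitive_mirror_conj A eta delta Y g0 k0 :
    imprimitive A eta delta -> mirror A eta delta Y ->
    delta g0 = -1 -> delta k0 = 1 -> eta k0 = -1 ->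
  exists n n', [/\ orthogonal_group n, orthogonal_group n' &
    (forall g, H1 (conj_dg n n' (A g))) \/ (forall g, H2 (conj_dg n n' (A g)))].
Proof.
move=> hA hY g0d k0d k0e.
have [a [a' [oa oa' da da' k0A]]] := impr_even hA k0d.
rewrite k0e in da da'.
have [n on na] := reflection_diag oa da; have [n' on' na'] := reflection_diag oa' da'.
have hA' := imprimitive_conj on on' hA; have hY' := mirror_conj on on' hY.
have k0A' : conj_dg n n' (A k0) = dg (mx2 1 0 0 (-1)) (mx2 1 0 0 (-1)).
  by rewrite k0A conj_dg_dg na na'.
have [m [om Hm]] := imprimitive_mirror_H hA' hY' g0d k0d k0e k0A'.
exists (m *m n), (1%:M *m n'); split; [exact: orthM|by rewrite mul1mx|].
by case: Hm => Hm; [left|right] => g; have := Hm g; rewrite conj_dg_comp.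
Qed.

End Imprimitive.

(** * Conjugation in the spin group, mirrors and stable planes *)

Section SpinMore.
Variables (R : realType) (n : nat).
Implicit Types (x y z : clifford R n) (v w : 'cV[R]_n).

Lemma spin_piZ (c : R) x : c ^+ 2 = 1 -> spin x -> spin_pi (c *: x) = spin_pi x.
Proof.
move=> c1 sx; apply: spin_pi_eq => [|w].
  apply/unitrP; exists (c *: x^-1).
  rewrite -!scalerAl -!scalerAr !scalerA -expr2 c1 !scale1r.
  by rewrite mulVr ?mulrV ?spin_unit.
by rewrite -scalerAl -scalerAr spin_pi_conj.
Qed.

Lemma comm_vec_spin z x : (forall v, z * cl_vec v = cl_vec v * z) -> spin x ->
  z * x = x * z.
Proof.
move=> cz [s [_ _ ->]]; elim: s => [|v s IH]; first by rewrite big_nil mulr1 mul1r.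
by rewrite big_cons mulrA cz -!mulrA IH.
Qed.

Lemma half_turn_self v : unit_vec v -> half_turn v *m v = v.
Proof.
move=> u; rewrite /half_turn mulmxBl mul1mx -scalemxAl -mulmxA u mulmx1.
by rewrite scaler_nat mulr2n addrK.
Qed.

Lemma half_turn_orth m v (B : 'M[R]_(n, m)) : v^T *m B = 0 -> half_turn v *m B = - B.
Proof.
move=> u; rewrite /half_turn mulmxBl mul1mx -scalemxAl -mulmxA u mulmx0 scaler0.
by rewrite sub0r.
Qed.

Lemma spin_pi2 v w : unit_vec v -> unit_vec w ->
  spin_pi (cl_vec v * cl_vec w) = half_turn v *m half_turn w.
Proof.
move=> uv uw; apply: spin_pi_eq => [|t]; first exact/spin_unit/spin2.
by rewrite -mulrA unit_vec_conj // mulrA unit_vec_conj // -mulmxA mulrA.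
Qed.

(** A subspace stable under an isometry X is stable under X^T = X^-1 as well.
    *)
Lemma orth_adjoint m (X : 'M[R]_n) (U : 'M[R]_(n, m)) A :
  X^T *m X = 1%:M -> U^T *m U = 1%:M -> X *m U = U *m A ->
  [/\ A^T *m A = 1%:M, X^T *m U = U *m A^T & U^T *m X = A *m U^T].
Proof.
move=> oX oU e.
have oA : A^T *m A = 1%:M.
  have -> : A^T *m A = (U *m A)^T *m (U *m A).
    by rewrite trmx_mul mulmxA -(mulmxA A^T) oU mulmx1.
  by rewrite -e trmx_mul mulmxA -(mulmxA U^T) oX mulmx1.
have e2 : X^T *m U = U *m A^T.
  have -> : X^T *m U = X^T *m (U *m A) *m A^T.
    by rewrite -!mulmxA (mulmx1C oA) mulmx1.
  by rewrite -e mulmxA oX mul1mx.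
split=> //; apply: trmx_inj.
by rewrite !trmx_mul !trmxK e2.
Qed.

Lemma restr_block m (X : 'M[R]_n) (U : 'M[R]_(n, m)) A :
  U^T *m U = 1%:M -> X *m U = U *m A -> U^T *m X *m U = A.
Proof. by move=> oU e; rewrite -mulmxA e mulmxA oU mul1mx. Qed.

Lemma half_turn_plane m (u : 'M[R]_(n, m)) (t : 'cV[R]_m) : u^T *m u = 1%:M ->
  half_turn (u *m t) *m u = - (u *m (1%:M - 2 *: (t *m t^T))).
Proof.
move=> uu; rewrite /half_turn mulmxBl mul1mx mulmxBr mulmx1 opprB -scalemxAl.
by rewrite -scalemxAr trmx_mul -!mulmxA uu mulmx1.
Qed.

(** x anticommutes with v and commutes with w, hence anticommutes with v w. *)
Lemma conj_opp x v w : spin x -> unit_vec v -> unit_vec w ->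
    spin_pi x *m v = - v -> spin_pi x *m w = w ->
  exists2 y, spin y & - x = y * x * y^-1.
Proof.
move=> sx uv uw xv xw; have sy := spin2 uv uw; exists (cl_vec v * cl_vec w) => //.
apply: (mulIr (spin_unit sy)); rewrite mulrVK ?spin_unit //.
rewrite mulNr mulrA (spin_pi_conj v sx) xv linearN /= mulNr mulNr opprK.
by rewrite -[LHS]mulrA (spin_pi_conj w sx) xw mulrA.
Qed.

End SpinMore.

Section ReflVec.
Variable R : realType.

(** A rotation of the plane other than -1 has no eigenvalue -1, and a
    reflection is determined by its eigenvector for -1. *)
Lemma reflection_eigenvector (a : 'M[R]_2) (v : 'cV[R]_2) :
  orthogonal_group a -> \det a = -1 -> v^T *m v = 1%:M -> a *m v = - v ->
  a = 1%:M - 2 *: (v *m v^T).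
Proof.
move=> oa da v1 av; have [x [y [e [[_ d1]|[aE _]]]]] := orth2P oa.
  have /eqP := etrans (esym da) d1; rewrite -subr_eq0 -opprD oppr_eq0.
  by rewrite -[1 + 1]/(2%:R) pnatr_eq0.
have := congr1 (fun M : 'M[R]_1 => M 0 0) v1; rewrite !mxE !big_ord_recl big_ord0 !mxE /= addr0.
have := congr1 (fun M : 'cV[R]_2 => M 1 0) av; have := congr1 (fun M : 'cV[R]_2 => M 0 0) av.
rewrite aE /refl !mxE !big_ord_recl !big_ord0 !mxE /= !addr0.
have -> : v *m v^T = mx2 (v 0 0 * v 0 0) (v 0 0 * v 1 0) (v 1 0 * v 0 0) (v 1 0 * v 1 0).
  by apply/matrixP; apply: forall_ord2; apply: forall_ord2; rewrite !mxE big_ord1 !mxE.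
have -> : lift ord0 ord0 = 1 :> 'I_2 by apply: val_inj.
have -> : ord0 = 0 :> 'I_2 by apply: val_inj.
rewrite !mx2E; move: (v 0 0) (v 1 0) => p q h1 h2 h3.
have hx : x = q * q - p * p.
  transitivity (x * (p * p + q * q)); first by rewrite h3 mulr1.
  transitivity ((x * p + y * q) * p - (y * p + - x * q) * q); first by ring.
  by rewrite h1 h2; ring.
have hy : y = - (2 * (p * q)).
  transitivity (y * (p * p + q * q)); first by rewrite h3 mulr1.
  transitivity ((x * p + y * q) * q + (y * p + - x * q) * p); first by ring.
  by rewrite h1 h2; ring.
by congr mx2; move: hx hy h3; lra.
Qed.

Lemma reflection_vec (a : 'M[R]_2) : orthogonal_group a -> \det a = -1 ->
  exists2 v : 'cV[R]_2, v^T *m v = 1%:M & a *m v = - v.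
Proof.
move=> oa da; have [n on na] := reflection_diag oa da.
pose d : 'cV[R]_2 := delta_mx 1 0; exists (n^T *m d).
  rewrite trmx_mul trmxK mulmxA -(mulmxA _ n) (mulmx1C on) mulmx1.
  by apply/matrixP => i j; rewrite !ord1 !mxE !big_ord_recl big_ord0 !mxE /= ; ring.
have -> : a *m (n^T *m d) = n^T *m (n *m a *m n^T *m d).
  by rewrite !mulmxA on mul1mx.
rewrite na -mulmxN; congr (_ *m _).
by apply/matrixP; apply: forall_ord2 => j;
  rewrite !mxE !big_ord_recl big_ord0 !mxE /= ?ord1 /=; ring.
Qed.

End ReflVec.

Section Main.
Variables (R : realType) (l : 'cV[R]_7) (u1 u2 u3 : 'M[R]_(7, 2)).
Hypothesis dec : orthogonal_decomposition l u1 u2 u3.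
Local Notation Cl := (clifford R 7).
Local Notation dg A B := (block_mx A 0 0 B : 'M[R]_(2 + 2)).
Local Notation ad A B := (block_mx 0 A B 0 : 'M[R]_(2 + 2)).
Local Notation U := (row_mx u1 u2).
Implicit Types (x y z : Cl) (v w : 'cV[R]_7).

Lemma U_orth : U^T *m U = 1%:M.
Proof.
have [_ [[g11 g12 _] [g22 _ _]]] := dec_gram dec.
have g21 : u2^T *m u1 = 0 by rewrite -[LHS]trmxK trmx_mul trmxK g12 trmx0.
by rewrite tr_row_mx mul_col_row g11 g12 g22 g21 (scalar_mx_block 2 2).
Qed.

Lemma unit_l : unit_vec l. Proof. by have [[]] := dec_gram dec. Qed.

Lemma frame_mx_eq (X X' : 'M[R]_7) : X *m l = X' *m l -> X *m u1 = X' *m u1 ->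
  X *m u2 = X' *m u2 -> X *m u3 = X' *m u3 -> X = X'.
Proof.
move=> el e1 e2 e3; pose P : 'M[R]_7 := row_mx l (row_mx u1 (row_mx u2 u3)).
have PP : P *m P^T = 1%:M by apply: mulmx1C; exact: dec.
have XP : X *m P = X' *m P.
  change (X *m row_mx l (row_mx u1 (row_mx u2 u3))
        = X' *m row_mx l (row_mx u1 (row_mx u2 u3))).
  by rewrite !mul_mx_row el e1 e2 e3.
by rewrite -[X]mulmx1 -PP mulmxA XP -mulmxA PP mulmx1.
Qed.

Lemma unit_u1 (v : 'cV[R]_2) : v^T *m v = 1%:M -> unit_vec (u1 *m v).
Proof.
have [_ [[g11 _ _] _]] := dec_gram dec => h.
by rewrite /unit_vec trmx_mul mulmxA -(mulmxA v^T) g11 mulmx1.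
Qed.

Lemma unit_u2 (v : 'cV[R]_2) : v^T *m v = 1%:M -> unit_vec (u2 *m v).
Proof.
have [_ [_ [g22 _ _]]] := dec_gram dec => h.
by rewrite /unit_vec trmx_mul mulmxA -(mulmxA v^T) g22 mulmx1.
Qed.

Lemma orth_im m k (A : 'M[R]_(7, m)) (B : 'M[R]_(7, k)) (v : 'cV[R]_m) :
  A^T *m B = 0 -> (A *m v)^T *m B = 0.
Proof. by move=> e; rewrite trmx_mul -mulmxA e mulmx0. Qed.

Lemma orth_tr m k (A : 'M[R]_(7, m)) (B : 'M[R]_(7, k)) : A^T *m B = 0 -> B^T *m A = 0.
Proof. by move=> e; rewrite -[LHS]trmxK trmx_mul trmxK e trmx0. Qed.

(** On l and F_3 the two half turns are both -1, and on each of F_1 and F_2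
    one of them is -1 and the other is the opposite of a reflection. *)
Lemma half_turns_action (v w : 'cV[R]_2) (p := u1 *m v) (s := u2 *m w) :
  v^T *m v = 1%:M -> w^T *m w = 1%:M ->
  [/\ half_turn p *m half_turn s *m l = l,
      half_turn p *m half_turn s *m u1 = u1 *m (1%:M - 2 *: (v *m v^T)),
      half_turn p *m half_turn s *m u2 = u2 *m (1%:M - 2 *: (w *m w^T))
    & half_turn p *m half_turn s *m u3 = u3].
Proof.
move=> v1 w1; have [[ll l1 l2 l3] [[g11 g12 g13] [g22 g23 g33]]] := dec_gram dec.
have pl : p^T *m l = 0 by apply: orth_im; apply: orth_tr.
have sl : s^T *m l = 0 by apply: orth_im; apply: orth_tr.
have p2 : p^T *m u2 = 0 by apply: orth_im.
have s1 : s^T *m u1 = 0 by apply: orth_im; apply: orth_tr.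
have p3 : p^T *m u3 = 0 by apply: orth_im.
have s3 : s^T *m u3 = 0 by apply: orth_im.
split; rewrite -mulmxA.
- by rewrite (half_turn_orth sl) mulmxN (half_turn_orth pl) opprK.
- by rewrite (half_turn_orth s1) mulmxN half_turn_plane // opprK.
- by rewrite half_turn_plane // mulmxN mulmxA (half_turn_orth p2) mulNmx opprK.
by rewrite (half_turn_orth s3) mulmxN (half_turn_orth p3) opprK.
Qed.

(** The surjection of M onto O(F_1) x O(F_2), as a relation. *)
Definition liftsM (n n' : 'M[R]_2) m := groupM l u1 u2 u3 m /\
  [/\ spin_pi m *m u1 = u1 *m n, spin_pi m *m u2 = u2 *m n' & spin_pi m *m u3 = u3].

Lemma liftsM_mul n n' m k k' m' : liftsM n n' m -> liftsM k k' m' ->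
  liftsM (n *m k) (n' *m k') (m * m').
Proof.
move=> [[[sm [c ml]] _ _ m3'] [m1 m2 m3]] [[[sm' [c' ml']] _ _ m3''] [m1' m2' _]].
have e := spin_piM sm sm'.
have e1 : spin_pi (m * m') *m u1 = u1 *m (n *m k) by rewrite e -mulmxA m1' mulmxA m1 mulmxA.
have e2 : spin_pi (m * m') *m u2 = u2 *m (n' *m k') by rewrite e -mulmxA m2' mulmxA m2 mulmxA.
have e3 : spin_pi (m * m') *m u3 = u3 by rewrite e -mulmxA m3'' m3.
split; split=> //; [|by eexists; eauto|by eexists; eauto].
split; first exact: spinM.
by exists (c' * c); rewrite e -mulmxA ml' -scalemxAr ml scalerA.
Qed.

(** The reflection in a vector p of F_1 is lifted by p l, which acts by -1 on
    l. *)
Lemma liftsM_refl1 (v : 'cV[R]_2) : v^T *m v = 1%:M ->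
  exists m, liftsM (1%:M - 2 *: (v *m v^T)) 1%:M m.
Proof.
move=> v1; have uv := unit_u1 v1; have [[ll l1 l2 l3] [[g11 g12 g13] _]] := dec_gram dec.
exists (cl_vec (u1 *m v) * cl_vec l); have e := spin_pi2 uv unit_l.
have h1 := half_turn_plane v g11.
have e1 : spin_pi (cl_vec (u1 *m v) * cl_vec l) *m u1 = u1 *m (1%:M - 2 *: (v *m v^T)).
  by rewrite e -mulmxA (half_turn_orth l1) mulmxN h1 opprK.
have e2 : spin_pi (cl_vec (u1 *m v) * cl_vec l) *m u2 = u2 *m 1%:M.
  by rewrite e -mulmxA (half_turn_orth l2) mulmxN (half_turn_orth (orth_im v g12)) opprK mulmx1.
have e3 : spin_pi (cl_vec (u1 *m v) * cl_vec l) *m u3 = u3.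
  by rewrite e -mulmxA (half_turn_orth l3) mulmxN (half_turn_orth (orth_im v g13)) opprK.
split; split=> //; [|by eexists; eauto|by eexists; eauto].
split; first by apply: spin2 => //; apply: unit_l.
exists (-1); rewrite e -mulmxA half_turn_self; last exact: unit_l.
by rewrite (half_turn_orth (orth_im v (orth_tr l1))) scaleN1r.
Qed.

Lemma liftsM_refl2 (v : 'cV[R]_2) : v^T *m v = 1%:M ->
  exists m, liftsM 1%:M (1%:M - 2 *: (v *m v^T)) m.
Proof.
move=> v1; have uv := unit_u2 v1.
have [[ll l1 l2 l3] [[g11 g12 g13] [g22 g23 g33]]] := dec_gram dec.
exists (cl_vec (u2 *m v) * cl_vec l); have e := spin_pi2 uv unit_l.
have h1 := half_turn_plane v g22.
have e1 : spin_pi (cl_vec (u2 *m v) * cl_vec l) *m u2 = u2 *m (1%:M - 2 *: (v *m v^T)).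
  by rewrite e -mulmxA (half_turn_orth l2) mulmxN h1 opprK.
have e2 : spin_pi (cl_vec (u2 *m v) * cl_vec l) *m u1 = u1 *m 1%:M.
  rewrite e -mulmxA (half_turn_orth l1) mulmxN.
  by rewrite (half_turn_orth (orth_im v (orth_tr g12))) opprK mulmx1.
have e3 : spin_pi (cl_vec (u2 *m v) * cl_vec l) *m u3 = u3.
  by rewrite e -mulmxA (half_turn_orth l3) mulmxN (half_turn_orth (orth_im v g23)) opprK.
split; split=> //; [|by eexists; eauto|by eexists; eauto].
split; first by apply: spin2 => //; apply: unit_l.
exists (-1); rewrite e -mulmxA half_turn_self; last exact: unit_l.
by rewrite (half_turn_orth (orth_im v (orth_tr l2))) scaleN1r.
Qed.

(** Every element of O(2) is a reflection or a product of two reflections. *)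
Lemma orth2_ind (P : 'M[R]_2 -> Prop) :
  (forall v : 'cV[R]_2, v^T *m v = 1%:M -> P (1%:M - 2 *: (v *m v^T))) ->
  (forall a b, P a -> P b -> P (a *m b)) ->
  forall a, orthogonal_group a -> P a.
Proof.
move=> Pr PM; have Pdet a : orthogonal_group a -> \det a = -1 -> P a.
  move=> oa da; have [v v1 av] := reflection_vec oa da.
  by rewrite (reflection_eigenvector oa da v1 av); apply: Pr.
move=> a oa; case: (orth_det oa) => da; last exact: Pdet.
have [os ds] := swap2_orth R.
have -> : a = (a *m swap2 R) *m (swap2 R)^T.
  by rewrite -mulmxA (mulmx1C os) mulmx1.
apply: PM; apply: Pdet; try exact: orthM; try exact: orthT.
  by rewrite det_mulmx da ds mul1r.
by rewrite det_tr.
Qed.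

Lemma liftsM_exists n n' : orthogonal_group n -> orthogonal_group n' ->
  exists m, liftsM n n' m.
Proof.
move=> on on'.
have [m hm] : exists m, liftsM n 1%:M m.
  move: n on; apply: orth2_ind; first exact: liftsM_refl1.
  move=> a b [m hm] [m' hm']; exists (m * m').
  by have := liftsM_mul hm hm'; rewrite mulmx1.
have [m' hm'] : exists m, liftsM 1%:M n' m.
  move: n' on'; apply: orth2_ind; first exact: liftsM_refl2.
  move=> a b [k hk] [k' hk']; exists (k * k').
  by have := liftsM_mul hk hk'; rewrite mulmx1.
by exists (m * m'); have := liftsM_mul hm hm'; rewrite mulmx1 mul1mx.
Qed.

Lemma liftsM_U n n' m : liftsM n n' m -> spin_pi m *m U = U *m dg n n'.
Proof.
move=> [_ [e1 e2 _]]; rewrite mul_mx_row e1 e2 mul_row_block !mulmx0.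
by rewrite addr0 add0r.
Qed.

Lemma liftsM_restr n n' m x A : liftsM n n' m -> spin x -> spin_pi x *m U = U *m A ->
  spin_pi (m * x * m^-1) *m U = U *m conj_dg n n' A /\
  restr12 u1 u2 (m * x * m^-1) = conj_dg n n' A.
Proof.
move=> hm sx xU; have sm : spin m by case: hm => [[[]]].
have [oM _ _] := spin_piP sm.
have [_ e2 _] := orth_adjoint oM U_orth (liftsM_U hm).
have e : spin_pi (m * x * m^-1) *m U = U *m conj_dg n n' A.
  rewrite (spin_piM (spinM sm sx) (spinV sm)) (spin_piM sm sx) (spin_piV sm).
  rewrite -!mulmxA e2 [spin_pi x *m _]mulmxA xU !mulmxA (liftsM_U hm).
  by rewrite /conj_dg ?mulmxA.
by split=> //; apply: restr_block => //; apply: U_orth.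
Qed.

Lemma ulsub_restr (X : 'M[R]_7) : U^T *m X *m U =
  block_mx (u1^T *m X *m u1) (u1^T *m X *m u2) (u2^T *m X *m u1) (u2^T *m X *m u2).
Proof. by rewrite tr_row_mx mul_col_mx mul_col_row. Qed.

(** Let p = u1 v and s = u2 w. The element r(g) acts on R^7 as p s does, so
    r(g) = z p s for some z commuting with all vectors. As x r(g) x^-1 = -
    r(g), the element x anticommutes with p s. Hence X = pi(x) preserves the
    plane of p and s and reverses its orientation, so that it has matrix ((al,
    be), (be, -al)) with al^2 + be^2 = 1 on (p, s). Symmetrising the
    compression keeps these entries. *)
Lemma mirror_of_conj (Gamma : groupType) (r : Gamma -> Cl) (eta delta : Gamma -> R) x
    (Y0 := U^T *m spin_pi x *m U) :
    spin x -> (forall g, spin (r g)) -> (forall g, eta g ^+ 2 = 1) ->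
    (forall g, spin_pi (r g) *m U = U *m restr12 u1 u2 (r g)) ->
    (forall g, spin_pi (r g) *m l = l) ->
    (forall g, spin_pi (r g) *m u3 = delta g *: u3) ->
    (forall g a a', delta g = 1 -> eta g = -1 -> restr12 u1 u2 (r g) = dg a a' ->
       [/\ orthogonal_group a, orthogonal_group a', \det a = -1 & \det a' = -1]) ->
    (forall g, eta g *: r g = x * r g * x^-1) ->
  mirror (fun g => restr12 u1 u2 (r g)) eta delta (2^-1 *: (Y0 + Y0^T)).
Proof.
move=> sx sr eta1 rU rl r3 rdet hx; have [oX _ cX] := spin_piP sx.
have xr g : x * r g = eta g *: (r g * x) by rewrite scalerAl hx mulrVK ?spin_unit.
have XR g : spin_pi x *m spin_pi (r g) = spin_pi (r g) *m spin_pi x.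
  have sxr := spinM sx (sr g); have srx := spinM (sr g) sx.
  by rewrite -spin_piM // xr spin_piZ // spin_piM.
have Y0comm g : Y0 *m restr12 u1 u2 (r g) = restr12 u1 u2 (r g) *m Y0.
  have [oR _ _] := spin_piP (sr g).
  have [_ _ e3] := orth_adjoint oR U_orth (rU g).
  rewrite /Y0 -[LHS]mulmxA -rU mulmxA -(mulmxA U^T) XR.
  by rewrite mulmxA e3 -!mulmxA.
have oA g : (restr12 u1 u2 (r g))^T *m restr12 u1 u2 (r g) = 1%:M.
  have [oR _ _] := spin_piP (sr g).
  by have [] := orth_adjoint oR U_orth (rU g).
have Y0Tcomm g : Y0^T *m restr12 u1 u2 (r g) = restr12 u1 u2 (r g) *m Y0^T.
  move: (restr12 u1 u2 (r g)) (Y0comm g) (oA g) => A YA o.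
  have h : A^T *m Y0^T = Y0^T *m A^T by rewrite -!trmx_mul YA.
  have oo := mulmx1C o.
  transitivity (A *m (A^T *m Y0^T) *m A); first by rewrite mulmxA oo mul1mx.
  by rewrite h -!mulmxA o mulmx1.
split.
- by rewrite linearZ /= linearD /= trmxK addrC.
- by move=> g; rewrite -scalemxAl -scalemxAr mulmxDl mulmxDr Y0comm Y0Tcomm.
move=> g a a' v w dg1 eg Ag v1 w1 av aw.
have [oa oa' da da'] := rdet g a a' dg1 eg Ag.
pose p := u1 *m v; pose s := u2 *m w.
have up : unit_vec p := unit_u1 v1; have us : unit_vec s := unit_u2 w1.
have [[ll l1 l2 l3] [[g11 g12 g13] [g22 g23 g33]]] := dec_gram dec.
have ps : p^T *m s = 0 by rewrite /s mulmxA (orth_im v g12) mul0mx.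
have [hl h1 h2 h3] := half_turns_action v1 w1.
have Rps : spin_pi (r g) = spin_pi (cl_vec p * cl_vec s).
  rewrite (spin_pi2 up us); have := rU g; rewrite Ag mul_mx_row mul_row_block.
  rewrite !mulmx0 addr0 add0r => /eq_row_mx [R1 R2].
  apply: frame_mx_eq.
  - by rewrite rl hl.
  - by rewrite R1 h1 (reflection_eigenvector oa da v1 av).
  - by rewrite R2 h2 (reflection_eigenvector oa' da' w1 aw).
  - by rewrite r3 dg1 scale1r h3.
have sJ := spin2 up us; set J := cl_vec p * cl_vec s in Rps sJ.
pose z := r g * J^-1; have uJ := spin_unit sJ.
have sz : spin z by apply: spinM => //; apply: spinV.
have zc t : z * cl_vec t = cl_vec t * z.
  have [oJ _ _] := spin_piP sJ.
  rewrite (spin_pi_conj t sz) (spin_piM (sr g) (spinV sJ)) (spin_piV sJ) Rps.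
  by rewrite (mulmx1C oJ) mul1mx.
have zx := comm_vec_spin zc sx.
have rzJ : r g = z * J by rewrite mulrVK.
(* z commutes with x, so the relation for r(g) = z J passes to J. *)
have xJ : x * J = - (J * x).
  apply: (mulrI (spin_unit sz)); rewrite mulrN [z * (x * J)]mulrA zx -[x * z * J]mulrA.
  by rewrite -rzJ xr eg scaleN1r [z * (J * x)]mulrA -rzJ.
have iso v' w' : (spin_pi x *m v')^T *m (spin_pi x *m w') = v'^T *m w'.
  by rewrite trmx_mul mulmxA -(mulmxA v'^T) oX mulmx1.
have EXX : cl_vec (spin_pi x *m p) * cl_vec (spin_pi x *m s) = -1 *: J.
  apply: (mulIr (spin_unit sx)); rewrite scaleN1r mulNr -xJ /J mulrA cX -!mulrA.
  by rewrite cX.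
have uX1 : unit_vec (spin_pi x *m p) by rewrite /unit_vec iso.
have uX2 : unit_vec (spin_pi x *m s) by rewrite /unit_vec iso.
have oX12 : (spin_pi x *m p)^T *m (spin_pi x *m s) = 0 by rewrite iso.
have [al [be [ga [de [X1 X2 dt]]]]] := bivector_plane up us ps uX1 uX2 oX12 EXX.
have sp := orth_tr ps.
have dot (c1 c2 c3 c4 : R) : (c1 *: p + c2 *: s)^T *m (c3 *: p + c4 *: s)
   = (c1 * c3 + c2 * c4)%:M.
  rewrite [(_ + _)^T]linearD /= ![(_ *: _)^T]linearZ /= mulmxDl !mulmxDr.
  rewrite -!scalemxAl -!scalemxAr up us ps sp !scaler0 addr0 add0r !scalemx1.
  by rewrite !scale_scalar_mx; apply/matrixP => i j; rewrite !mxE !ord1 eqxx !mulr1n; ring.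
have sc (c d : R) : c%:M = d%:M :> 'M[R]_1 -> c = d.
  by move/matrixP/(_ 0 0); rewrite !mxE eqxx !mulr1n.
have n1 : al * al + be * be = 1 by apply: sc; rewrite -dot -X1 uX1.
have n2 : al * ga + be * de = 0 by apply: sc; rewrite -dot -X1 -X2 oX12 raddf0.
(* An orthogonal matrix of size 2 and determinant -1 is symmetric of trace 0.
   *)
have deE : de = - al.
  transitivity (de * (al * al + be * be)); first by rewrite n1 mulr1.
  transitivity (al * (al * de - be * ga) + be * (al * ga + be * de)); first by ring.
  by rewrite dt n2; ring.
have gaE : ga = be.
  transitivity (ga * (al * al + be * be)); first by rewrite n1 mulr1.
  transitivity (al * (al * ga + be * de) - be * (al * de - be * ga)); first by ring.
  by rewrite dt n2; ring.
have pXp : p^T *m spin_pi x *m p = al%:M.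
  rewrite -mulmxA X1 mulmxDr -!scalemxAr up ps scaler0 addr0 scalemx1.
  by [].
have sXs : s^T *m spin_pi x *m s = (- al)%:M.
  rewrite -mulmxA X2 mulmxDr -!scalemxAr us sp scaler0 add0r scalemx1 deE.
  by [].
have pXs : p^T *m spin_pi x *m s = be%:M.
  rewrite -mulmxA X2 mulmxDr -!scalemxAr up ps scaler0 addr0 scalemx1 gaE.
  by [].
have sXp : s^T *m spin_pi x *m p = be%:M.
  rewrite -mulmxA X1 mulmxDr -!scalemxAr us sp scaler0 add0r scalemx1.
  by [].
have quad (t t' : 'cV[R]_2) (ua ub : 'M[R]_(7, 2)) (e : R) :
    (ua *m t)^T *m spin_pi x *m (ub *m t') = e%:M ->
    (ub *m t')^T *m spin_pi x *m (ua *m t) = e%:M ->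
    (t^T *m (2^-1 *: (ua^T *m spin_pi x *m ub + (ub^T *m spin_pi x *m ua)^T)) *m t') 0 0 = e.
  move=> q1 q2.
  rewrite -scalemxAr -scalemxAl mulmxDr mulmxDl.
  have -> : t^T *m (ua^T *m spin_pi x *m ub) *m t' = e%:M by rewrite -q1 trmx_mul !mulmxA.
  have -> : t^T *m (ub^T *m spin_pi x *m ua)^T *m t' = e%:M.
    by rewrite -[RHS]tr_scalar_mx -q2 !trmx_mul !trmxK !mulmxA.
  by rewrite !mxE eqxx !mulr1n; field.
have YE : 2^-1 *: (Y0 + Y0^T) = block_mx
   (2^-1 *: (u1^T *m spin_pi x *m u1 + (u1^T *m spin_pi x *m u1)^T))
   (2^-1 *: (u1^T *m spin_pi x *m u2 + (u2^T *m spin_pi x *m u1)^T))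
   (2^-1 *: (u2^T *m spin_pi x *m u1 + (u1^T *m spin_pi x *m u2)^T))
   (2^-1 *: (u2^T *m spin_pi x *m u2 + (u2^T *m spin_pi x *m u2)^T)).
  by rewrite /Y0 ulsub_restr tr_block_mx add_block_mx scale_block_mx.
rewrite YE block_mxKul block_mxKur block_mxKdr.
rewrite (quad v v u1 u1 al) // (quad w w u2 u2 (- al)) // (quad v w u1 u2 be) //.
by rewrite subrr !expr2 n1.
Qed.

(** What the argument uses of H_1 and H_2. The last clause ties the character
    carried by W to the determinant on F_1, that is to eta. *)
Definition stable_planes (H : set 'M[R]_(2 + 2)) (W W' : 'M[R]_(2 + 2, 2)) : Prop :=
  [/\ W^T *m W = 1%:M, W'^T *m W' = 1%:M &
    forall A, H A -> exists c c', [/\ A *m W = W *m c, A *m W' = W' *m c',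
      orthogonal_group c, orthogonal_group c' &
      \det c = \det c' /\ forall a a', A = dg a a' -> \det a = \det c]].

(** The planes of the vectors (v, v) and of the vectors (v, -v). *)
Lemma H2_planes : exists W W', stable_planes (@H2 R) W W'.
Proof.
pose s : R := (Num.sqrt 2)^-1.
have s2 : s * s + s * s = 1.
  have : s ^+ 2 * 2 = 1 by rewrite exprVn sqr_sqrtr // mulVf // pnatr_eq0.
  by move=> <-; ring.
pose W : 'M[R]_(2 + 2, 2) := col_mx s%:M s%:M.
pose W' : 'M[R]_(2 + 2, 2) := col_mx s%:M (- s)%:M.
exists W, W'; split.
- by rewrite /W tr_col_mx mul_row_col !tr_scalar_mx -!scalar_mxM -raddfD /= s2.
- by rewrite /W' tr_col_mx mul_row_col !tr_scalar_mx -!scalar_mxM -raddfD /= mulrNN s2.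
move=> A /H2_inv [a oa [->|->]].
  exists a, a; split=> //.
  - by rewrite /W mul_block_col mul_col_mx !mul0mx addr0 add0r !scalar_mxC.
  - by rewrite /W' mul_block_col mul_col_mx !mul0mx addr0 add0r !scalar_mxC.
  by split=> // c c' /eq_block_mx [->].
exists a, (- a); split=> //.
- by rewrite /W mul_block_col mul_col_mx !mul0mx addr0 add0r !scalar_mxC.
- rewrite /W' mul_block_col mul_col_mx !mul0mx addr0 add0r !mulmxN -!scalar_mxC.
  by rewrite !mul_mx_scalar !scaleNr opprK.
- exact: orthN.
split; first by rewrite -scaleN1r detZ sqrrN expr1n mul1r.
by move=> c c' /eq_block_mx [<- -> _ _].
Qed.

(** Numbering the basis of R^4 from 1, the planes spanned by the vectors 1 and
    4, and by the vectors 2 and 3. *)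
Lemma H1_planes : exists W W', stable_planes (@H1 R) W W'.
Proof.
pose W : 'M[R]_(2 + 2, 2) := col_mx (mx2 1 0 0 0) (mx2 0 0 0 1).
pose W' : 'M[R]_(2 + 2, 2) := col_mx (mx2 0 0 1 0) (mx2 0 1 0 0).
exists W, W'; split.
- by rewrite /W tr_col_mx mul_row_col !mx2E; congr mx2; ring.
- by rewrite /W' tr_col_mx mul_row_col !mx2E; congr mx2; ring.
have od k1 k2 : k1 ^+ 2 = 1 -> k2 ^+ 2 = 1 -> @orthogonal_group R 2 (mx2 k1 0 0 k2).
  by move=> *; apply/mx2_diag.
have oa k1 k2 : k1 ^+ 2 = 1 -> k2 ^+ 2 = 1 -> @orthogonal_group R 2 (mx2 0 k1 k2 0).
  move=> h1 h2; rewrite /orthogonal_group /= !mx2E.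
  by congr mx2; [rewrite -h2| | |rewrite -h1]; ring.
move=> A /H1_inv [k1 [k2 [e1 e2 [->|->]]]].
  exists (mx2 k1 0 0 k2), (mx2 k2 0 0 k1); split; try exact: od.
  - rewrite /W mul_block_col mul_col_mx !mul0mx addr0 add0r !mx2E.
    by congr col_mx; congr mx2; ring.
  - rewrite /W' mul_block_col mul_col_mx !mul0mx addr0 add0r !mx2E.
    by congr col_mx; congr mx2; ring.
  by split=> [|c c' /eq_block_mx [<- _ _ _]]; rewrite !mx2_det //; ring.
exists (mx2 0 k1 (- k2) 0), (mx2 0 k2 (- k1) 0); split; try by apply: oa; rewrite ?sqrrN.
- rewrite /W mul_block_col mul_col_mx !mul0mx addr0 add0r !mx2E.
  by congr col_mx; congr mx2; ring.
- rewrite /W' mul_block_col mul_col_mx !mul0mx addr0 add0r !mx2E.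
  by congr col_mx; congr mx2; ring.
split=> [|c c' /eq_block_mx [<- + _ _]]; first by rewrite !mx2_det; ring.
rewrite (@mx2_0 R) => /mx2_inj [_ -> _ _].
by rewrite !mx2_det; ring.
Qed.

(** In the expansion of the product of the images of the two basis vectors,
    the scalar part vanishes because they are orthogonal, and the coefficient
    of the bivector is det c. *)
Lemma plane_conj x (V : 'M[R]_(7, 2)) c : spin x -> V^T *m V = 1%:M ->
  orthogonal_group c -> spin_pi x *m V = V *m c ->
  let T := cl_vec (col 0 V) * cl_vec (col 1 V) in
  spin T /\ x * T = \det c *: (T * x).
Proof.
move=> sx VV oc xV; set p := col 0 V; set s := col 1 V.
have g (i j : 'I_2) : (col i V)^T *m col j V = (i == j)%:R%:M.
  by rewrite [LHS]mx11_scalar tr_col -col_mulmx -row_mul VV !mxE.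
have up : unit_vec p by rewrite /unit_vec g.
have us : unit_vec s by rewrite /unit_vec g.
have sp : s^T *m p = 0 by rewrite g raddf0.
move=> T; split; first exact: spin2.
rewrite {}/T.
have cols j : spin_pi x *m col j V = c 0 j *: p + c 1 j *: s.
  rewrite -col_mulmx xV col_mulmx; apply/matrixP => i k.
  rewrite !mxE !big_ord_recl big_ord0 addr0 !mxE mulrC [X in _ + X]mulrC.
  by congr (_ * _ + c _ _ * V _ _); apply: val_inj.
rewrite mulrA (spin_pi_conj p sx) -[LHS]mulrA (spin_pi_conj s sx) mulrA !cols.
rewrite scalerAl; congr (_ * _).
have : c^T *m c = 1%:M by [].
rewrite [c]mx2_eta !mx2E; move: (c 0 0) (c 0 1) (c 1 0) (c 1 1) => al ga be de.
case/mx2_inj => _ o _ _; rewrite !mxE /=.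
rewrite !linearD !linearZ /= mulrDl !mulrDr -!scalerAl -!scalerAr.
rewrite !unit_vec_sqr // (orth_anticomm sp) !scalerN !scalerA.
set w := cl_vec p * _; rewrite (addrC (- _)) addrACA -scalerBl -scalerDl o scale0r add0r.
by congr (_ *: _); ring.
Qed.

(** Let T1 and T2 be the bivectors of the two planes, multiplied by the same
    character chi under conjugation, and T3 = e_5 l, multiplied by delta. The
    characters chi and eta agree on the kernel of delta, so that chi = eta
    when they agree at g0, and chi delta = eta otherwise. Accordingly T1 or T2
    T3 is the required element. *)
Lemma conj_of_planes (Gamma : groupType) (r : Gamma -> Cl) (A : Gamma -> 'M[R]_(2 + 2))
    (eta delta : Gamma -> R) (H : set 'M[R]_(2 + 2)) W W' g0 :
  stable_planes H W W' -> (forall g, H (A g)) -> imprimitive A eta delta ->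
  delta g0 = -1 -> (forall g, spin (r g)) -> (forall g h, r (g * h)%g = r g * r h) ->
  (forall g, spin_pi (r g) *m U = U *m A g) -> (forall g, spin_pi (r g) *m l = l) ->
  (forall g, spin_pi (r g) *m u3 = delta g *: u3) ->
  exists2 T, spin T & forall g, eta g *: r g = T * r g * T^-1.
Proof.
move=> [WW WW' st] HA hA g0d sr rM rU rl r3.
have [[ll l1 l2 l3] [_ [_ _ g33]]] := dec_gram dec.
have UW (Z : 'M[R]_(2 + 2, 2)) : Z^T *m Z = 1%:M -> (U *m Z)^T *m (U *m Z) = 1%:M.
  by move=> ZZ; rewrite trmx_mul mulmxA -(mulmxA Z^T) U_orth mulmx1.
pose T1 := cl_vec (col 0 (U *m W)) * cl_vec (col 1 (U *m W)).
pose T2 := cl_vec (col 0 (U *m W')) * cl_vec (col 1 (U *m W')).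
pose T3 := cl_vec (col 0 u3) * cl_vec l.
have ul := unit_l.
have u5 : unit_vec (col 0 u3) by exact: (frame_unit dec (isT : (5 < 7)%N)).
have s3 : spin T3 by apply: spin2.
have x3 g : r g * T3 = delta g *: (T3 * r g).
  rewrite /T3 mulrA (spin_pi_conj _ (sr g)) -col_mulmx r3 -[LHS]mulrA.
  rewrite (spin_pi_conj _ (sr g)) rl mulrA.
  by rewrite -[col 0 (_ *: _)]/(_ : 'cV_7) (_ : col 0 (delta g *: u3) = delta g *: col 0 u3)
    ?linearZ -?scalerAl //; apply/matrixP => i j; rewrite !mxE.
have key g : exists chi : R, [/\ chi ^+ 2 = 1, r g * T1 = chi *: (T1 * r g),
    r g * T2 = chi *: (T2 * r g), spin T1 /\ spin T2 & delta g = 1 -> chi = eta g].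
  have [c [c' [e e' oc oc' [dd cd]]]] := st _ (HA g).
  have e1 : spin_pi (r g) *m (U *m W) = U *m W *m c by rewrite mulmxA rU -mulmxA e mulmxA.
  have e2 : spin_pi (r g) *m (U *m W') = U *m W' *m c' by rewrite mulmxA rU -mulmxA e' mulmxA.
  have [sT1 h1] := plane_conj (sr g) (UW _ WW) oc e1.
  have [sT2 h2] := plane_conj (sr g) (UW _ WW') oc' e2.
  exists (\det c); split=> //; [exact: orth_det_sqr|by rewrite dd|].
  by move=> dg1; have [a [a' [_ _ <- _ Ag]]] := impr_even hA dg1; rewrite (cd _ _ Ag).
have [chi0 [q0 h10 _ [sT1 sT2] _]] := key g0.
have sq (s : R) : s = 1 \/ s = -1 -> s ^+ 2 = 1 by case=> ->; rewrite ?sqrrN expr1n.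
have eta2 g : eta g ^+ 2 = 1 by apply/sq/(impr_eta hA).
have delta2 g : delta g ^+ 2 = 1 by apply/sq/(impr_delta hA).
have T10 : T1 * (r g0 * r g0) != 0 :> Cl.
  apply/eqP => T0; have : T1 * (r g0 * r g0) \is a GRing.unit.
    by apply: spin_unit; apply: spinM => //; apply: spinM.
  by rewrite T0 unitr0.
pose e0 := eta g0 * chi0.
(* g g0 is in the kernel of delta, where chi and eta agree. *)
have chiE g chi : r g * T1 = chi *: (T1 * r g) -> chi ^+ 2 = 1 ->
    (delta g = 1 -> chi = eta g) -> delta g = -1 -> chi = eta g * e0.
  move=> h1 _ _ dg1.
  have [chi' [_ h1' _ _ h']] := key (g * g0)%g.
  have chi'E : chi' = eta g * eta g0.
    by rewrite h' ?(impr_etaM hA) // (impr_deltaM hA) dg1 g0d mulrNN mulr1.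
  have u : T1 * (r g * r g0) \is a GRing.unit.
    by apply: spin_unit; apply: spinM => //; apply: spinM.
  have h2 : r g * r g0 * T1 = (chi * chi0) *: (T1 * (r g * r g0)).
    rewrite -[LHS]mulrA h10 -scalerAr [r g * (T1 * _)]mulrA h1 -scalerAl scalerA.
    by rewrite -[T1 * _ * _]mulrA (mulrC chi0).
  have : (chi * chi0 - chi') *: (T1 * (r g * r g0)) = 0.
    by rewrite scalerBl -h2 -rM -h1' rM subrr.
  move/eqP; rewrite scaler_eq0 => /orP[|/eqP T0]; last by move: u; rewrite T0 unitr0.
  rewrite subr_eq0 chi'E => /eqP h3; rewrite /e0.
  by transitivity (chi * chi0 * chi0); [rewrite -mulrA -expr2 q0 mulr1|rewrite h3; ring].
have fin T : spin T -> (forall g, r g * T = eta g *: (T * r g)) ->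
    exists2 T, spin T & forall g, eta g *: r g = T * r g * T^-1.
  move=> sT hT; exists T => // g; apply: (mulIr (spin_unit sT)).
  rewrite mulrVK ?spin_unit // -scalerAl hT scalerA -expr2 eta2 scale1r.
  by [].
have e02 : e0 ^+ 2 = 1 by rewrite exprMn eta2 q0 mulr1.
have /eqP := e02; rewrite sqrf_eq1 => /orP[]/eqP e0E.
  apply: (fin T1) => // g; have [chi [q1 h1 _ _ h]] := key g.
  case: (impr_delta hA g) => dg1; first by rewrite h1 h.
  by rewrite h1 (chiE g chi) // e0E mulr1.
apply: (fin (T2 * T3)); first exact: spinM.
move=> g; have [chi [q1 h1 h2 _ h]] := key g.
rewrite [LHS]mulrA h2 -scalerAl -[T2 * r g * _]mulrA x3 -scalerAr scalerA.
rewrite [T2 * (T3 * _)]mulrA; congr (_ *: _).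
case: (impr_delta hA g) => dg1; first by rewrite h // dg1 mulr1.
by rewrite (chiE g chi) // e0E dg1 -mulrA mulrNN !mulr1.
Qed.

End Main.

(** * The acceptability criterion *)

Lemma of_order2_ex (R : realType) (Gamma : Type) (eta : Gamma -> R) :
  of_order2 eta -> exists g, eta g = -1.
Proof.
move=> [e2 ne]; apply: contrapT => H; apply: ne; apply/funext => g.
have /eqP := e2 g; rewrite sqrf_eq1 => /orP[]/eqP // h.
by case: H; exists g.
Qed.

(** If eta = -1 at g2 but delta(g2) = -1 as well, multiply g2 by an element
    where eta and delta differ. *)
Lemma independent_characters (R : realType) (Gamma : groupType) (eta delta : Gamma -> R) :
  of_order2 eta -> of_order2 delta -> eta <> delta ->
  (forall g h, eta (g * h)%g = eta g * eta h) ->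
  (forall g h, delta (g * h)%g = delta g * delta h) ->
  exists g, delta g = 1 /\ eta g = -1.
Proof.
move=> oe od ne eM dM; have [g2 e2] := of_order2_ex oe.
have sg (c : Gamma -> R) g : of_order2 c -> c g = 1 \/ c g = -1.
  by move=> [c2 _]; have /eqP := c2 g; rewrite sqrf_eq1 => /orP[]/eqP; auto.
case: (sg _ g2 od) => d2; first by exists g2.
have [g1 n1] : exists g, eta g <> delta g.
  apply: contrapT => H; apply: ne; apply/funext => g; apply: contrapT => h.
  by apply: H; exists g.
case: (sg _ g1 oe) (sg _ g1 od) => e1 [] d1; rewrite e1 d1 in n1 => //.
  by exists (g1 * g2)%g; rewrite eM dM e1 e2 d1 d2 mulrNN !mul1r.
by exists g1.
Qed.

Theorem proposition5p13 (R : realType)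
    (l : 'cV[R]_7) (u1 u2 u3 : 'M[R]_(7, 2))
    (sigma : clifford R 7 -> 'M[R[i]]_(2 + 2))
    (rho : 'M[R[i]]_2 * 'M[R[i]]_2 -> clifford R 7)
    (Gamma : groupType) (f : Gamma -> 'M[R[i]]_2 * 'M[R[i]]_2) :
  orthogonal_decomposition l u1 u2 u3 ->
  unitary_half_spin l (basisF u1 u2 u3) sigma ->
  block_embedding l (basisF u1 u2 u3) sigma rho ->
  torus_adapted rho u1 u2 u3 ->
  (forall gamma, calG (f gamma)) ->
  (forall gamma gamma', f (gamma * gamma')%g = f gamma * f gamma') ->
  let eta gamma := upsilon (f gamma) in
  let delta gamma := dchar (f gamma) in
  let r gamma := rho (f gamma) in
  of_order2 eta -> of_order2 delta -> eta <> delta ->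
  satisfies_U1 r eta /\
  (acceptable r eta <->
   exists2 m, groupM l u1 u2 u3 m &
     (forall gamma, H1 (restr12 u1 u2 (m * r gamma * m^-1))) \/
     (forall gamma, H2 (restr12 u1 u2 (m * r gamma * m^-1)))).
Proof.
move=> dec [hs _] emb tor fG fM eta delta r oe od ne.
pose U := row_mx u1 u2; pose A g := restr12 u1 u2 (r g).
have [[ll l1 l2 l3] [[g11 g12 g13] [g22 g23 g33]]] := dec_gram dec.
have sr g : spin (r g) by have [] := rhoP dec emb (fG g).
have rM g h : r (g * h)%g = r g * r h by rewrite /r fM (rhoM dec hs emb tor).
have etaM g h : eta (g * h)%g = eta g * eta h.
  by rewrite /eta fM; have [_ -> _] := calG_mul (fG g) (fG h).
have deltaM g h : delta (g * h)%g = delta g * delta h.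
  by rewrite /delta fM; have [_ _ ->] := calG_mul (fG g) (fG h).
have etaS g : eta g = 1 \/ eta g = -1 by have [] := calG_signs (fG g).
have deltaS g : delta g = 1 \/ delta g = -1 by have [] := calG_signs (fG g).
have eta2 g : eta g ^+ 2 = 1 by case: oe.
have rl g : spin_pi (r g) *m l = l by exact: (rho_l dec emb (fG g)).
have r3 g : spin_pi (r g) *m u3 = delta g *: u3 by exact: (rho_u3 dec hs emb tor (fG g)).
have even g : delta g = 1 -> exists a a', [/\ orthogonal_group a, orthogonal_group a',
    \det a = eta g, \det a' = eta g & spin_pi (r g) *m U = U *m block_mx a 0 0 a'].
  move=> dg; have [a [a' [oa oa' da da' [e1 e2]]]] := rho_F12_even dec hs emb tor (fG g) dg.
  exists a, a'; split=> //.
  by rewrite /U mul_mx_row e1 e2 mul_row_block !mulmx0 addr0 add0r.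
have odd g : delta g = -1 -> exists a a', [/\ orthogonal_group a, orthogonal_group a',
    \det a = \det a' & spin_pi (r g) *m U = U *m block_mx 0 a' a 0].
  move=> dg; have [a [a' [oa oa' da [e1 e2]]]] := rho_F12_odd dec hs emb tor (fG g) dg.
  exists a, a'; split=> //.
  by rewrite /U mul_mx_row e1 e2 mul_row_block !mulmx0 addr0 add0r.
have oU := U_orth dec.
have rA g B : spin_pi (r g) *m U = U *m B -> A g = B by apply: restr_block.
have rU g : spin_pi (r g) *m U = U *m A g.
  case: (deltaS g) => dg.
    by have [a [a' [_ _ _ _ e]]] := even g dg; rewrite (rA _ _ e).
  by have [a [a' [_ _ _ e]]] := odd g dg; rewrite (rA _ _ e).
have hA : imprimitive A eta delta.
  split=> //.
  - move=> g h; apply: rA; rewrite rM (spin_piM (sr g) (sr h)).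
    by rewrite -mulmxA rU mulmxA rU mulmxA.
  - move=> g dg; have [a [a' [oa oa' da da' e]]] := even g dg.
    by exists a, a'; split=> //; apply: rA.
  move=> g dg; have [a [a' [oa oa' da e]]] := odd g dg.
  by exists a, a'; split=> //; apply: rA.
have [g0 g0d] := of_order2_ex od.
have [k0 [k0d k0e]] := independent_characters oe od ne etaM deltaM.
have U1 : satisfies_U1 r eta.
  move=> g; case: (etaS g) => eg.
    by exists 1; [exact: spin1|rewrite eg scale1r mul1r invr1 mulr1].
  rewrite eg scaleN1r.
  (* When d = 1 the eigenvector for -1 is found in F_1, where the determinant
     is upsilon = -1; when d = -1 the whole plane F_3 is available. *)
  have [v uv xv] : exists2 v, unit_vec v & spin_pi (r g) *m v = - v.
    case: (deltaS g) => dg.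
      have [a [a' [oa oa' da da' e]]] := even g dg.
      rewrite eg in da; have [v v1 av] := reflection_vec oa da.
      exists (u1 *m v); first exact: (unit_u1 dec).
      move: e; rewrite /U mul_mx_row mul_row_block !mulmx0 addr0 add0r.
      by case/eq_row_mx => e _; rewrite mulmxA e -mulmxA av mulmxN.
    exists (col 0 u3); first by exact: (frame_unit dec (isT : (5 < 7)%N)).
    rewrite -col_mulmx r3 dg scaleN1r.
    by apply/matrixP => i j; rewrite !mxE.
  exact: (conj_opp (sr g) uv (unit_l dec) xv (rl g)).
split=> //; rewrite /acceptable /unacceptable.
have -> : (~ (satisfies_U1 r eta /\ satisfies_U2 r eta)) <->
    exists2 x, spin x & forall g, eta g *: r g = x * r g * x^-1.
  split; last by move=> ex [_ []].
  by move=> H; apply: contrapT => nex; apply: H.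
split.
  move=> [x sx hx].
  have hY := mirror_of_conj dec sx sr eta2 rU rl r3 _ hx.
  have [|n [n' [on on' hn]]] := imprimitive_mirror_conj hA (hY _) g0d k0d k0e.
    move=> g a a' dg eg Ag; have [b [b' [ob ob' db db' e]]] := even g dg.
    move: Ag; rewrite -/(A g) (rA _ _ e) => /eq_block_mx [<- _ _ <-].
    by rewrite db db' eg.
  have [m hm] := liftsM_exists dec on on'.
  exists m; first by case: hm.
  have e g : restr12 u1 u2 (m * r g * m^-1) = conj_dg n n' (A g).
    by have [] := liftsM_restr dec hm (sr g) (rU g).
  by case: hn => hn; [left|right] => g; rewrite e.
move=> [m Mm HH].
have [[sm [c ml]] [a ma] [b mb] m3] := Mm.
have [oM _ _] := spin_piP sm.
have hm : liftsM l u1 u2 u3 a b m by split.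
have oa : orthogonal_group a by apply: (orth_block oM g11 g11 ma).
have ob : orthogonal_group b by apply: (orth_block oM g22 g22 mb).
(* The criterion is invariant under conjugation by m, so the stable planes are
   used for the conjugate r'. *)
pose r' g := m * r g * m^-1.
have um := spin_unit sm.
have sr' g : spin (r' g) by apply: spinM; [exact: spinM|exact: spinV].
have r'U g : spin_pi (r' g) *m U = U *m conj_dg a b (A g).
  by have [] := liftsM_restr dec hm (sr g) (rU g).
have r'A g : restr12 u1 u2 (r' g) = conj_dg a b (A g).
  by have [] := liftsM_restr dec hm (sr g) (rU g).
have r'pi g : spin_pi (r' g) = spin_pi m *m spin_pi (r g) *m (spin_pi m)^T.
  by rewrite (spin_piM (spinM sm (sr g)) (spinV sm)) (spin_piM sm (sr g)) (spin_piV sm).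
have m3' : (spin_pi m)^T *m u3 = u3 by rewrite -{1}m3 mulmxA oM mul1mx.
have ml' : (spin_pi m)^T *m l = c *: l.
  have e : spin_pi m *m l = l *m c%:M by rewrite mul_mx_scalar.
  by have [_ -> _] := orth_adjoint oM ll e; rewrite tr_scalar_mx mul_mx_scalar.
have c2 : c * c = 1.
  have : (spin_pi m *m l)^T *m (spin_pi m *m l) = 1%:M.
    by rewrite trmx_mul mulmxA -(mulmxA l^T) oM mulmx1.
  rewrite ml -scalemxAr [(_ *: _)^T]linearZ /= -scalemxAl ll scalerA.
  by move/matrixP/(_ 0 0); rewrite !mxE eqxx mulr1.
have r'l g : spin_pi (r' g) *m l = l.
  by rewrite r'pi -!mulmxA ml' -!scalemxAr rl ml scalerA c2 scale1r.
have r'3 g : spin_pi (r' g) *m u3 = delta g *: u3.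
  by rewrite r'pi -!mulmxA m3' r3 -scalemxAr m3.
have r'M g h : r' (g * h)%g = r' g * r' h.
  by rewrite /r' rM !mulrA mulrVK.
have hA' := imprimitive_conj oa ob hA.
have [T sT hT] : exists2 T, spin T & forall g, eta g *: r' g = T * r' g * T^-1.
  case: HH => HH.
    have [W [W' st]] := H1_planes R.
    apply: (conj_of_planes dec st _ hA' g0d sr' r'M r'U r'l r'3) => g.
    by rewrite -r'A; apply: HH.
  have [W [W' st]] := H2_planes R.
  apply: (conj_of_planes dec st _ hA' g0d sr' r'M r'U r'l r'3) => g.
  by rewrite -r'A; apply: HH.
have uT := spin_unit sT.
exists (m^-1 * T * m).
  by apply: spinM => //; apply: spinM => //; apply: spinV.
move=> g; have e : r g = m^-1 * r' g * m by rewrite /r' !mulrA mulVr // mul1r mulrVK.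
have inv : (m^-1 * T * m)^-1 = m^-1 * T^-1 * m.
  rewrite (invrM (spin_unit (spinM (spinV sm) sT)) um).
  by rewrite (invrM (spin_unit (spinV sm)) uT) invrK mulrA.
rewrite inv {1}e scalerAl scalerAr hT /r'.
by rewrite !mulrA.
Qed.
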